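(* Let $\tilde w=s_{\beta_1}\cdots s_{\beta_r}$ be an expression (not necessarily reduced) in simple reflections of the Weyl group of a Kac-Moody group $G$, with toric limit $Y_{\tilde w}$. For $1\le i\le r$ let $I_i=\tilde I_i$ and $L_{I_i}\subset Y_{\tilde w}$ be the index sequence and curve defined in the context. Then the extremal rays of (the Mori cone $\overline{NE}(Y_{\tilde w})$ of) $Y_{\tilde w}$ are precisely those generated by the classes of the curves $L_{I_i}$, $1\le i\le r$.
   Context: We work over $\mathbb C$. $G$ is a Kac-Moody group; the $\beta_i$ are simple roots and $\beta_{ij}:=\langle\beta_j,\check\beta_i\rangle$, with $\check\beta_i$ the coroot of $\beta_i$. The toric limit $Y_{\tilde w}$ (the special fibre of a toric degeneration of the Bott-Samelson-Demazure-Hansen variety $Z(\tilde w)$) is the smooth projective toric variety whose fan $\Sigma$ in $\mathbb R^r$ has as cones those generated by subsets of $\{e_1^{\pm},\dots,e_r^{\pm}\}$ containing no pair $\{e_i^+,e_i^-\}$, where $e_1^+,\dots,e_r^+$ is the standard basis of $\mathbb Z^r$ and $e_i^-:=-e_i^+-\sum_{j>i}\beta_{ij}e_j^+$. For $1\le j\le r$ let $\tilde w_j=s_{\beta_1}\cdots s_{\beta_j}$. Projection $\mathbb Z^j\to\mathbb Z^{j-1}$ onto the first $j-1$ coordinates induces a toric $\mathbb P^1$-fibration $f_j:Y_{\tilde w_j}\to Y_{\tilde w_{j-1}}$ ($Y_{\tilde w_0}$ a point) with two disjoint toric sections: the Schubert section, with image the toric divisor of the ray generated by $e_j^+$, and the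 non-Schubert section, with image the toric divisor of the ray generated by $e_j^-$. The Schubert point of $Y_{\tilde w_j}$ is the torus-fixed point of the cone generated by $e_1^+,\dots,e_j^+$; the Schubert line $L_j\subset Y_{\tilde w_j}$ is the fibre of $f_j$ over the Schubert point of $Y_{\tilde w_{j-1}}$. For $I=(i_1<\dots<i_m)$ in $\{1,\dots,r\}$, $L_I\subset Y_{\tilde w}$ is the curve obtained from the Schubert line $L_{i_1}\subset Y_{\tilde w_{i_1}}$ by applying successively, for $k=i_1+1,\dots,r$, the non-Schubert section $Y_{\tilde w_{k-1}}\to Y_{\tilde w_k}$ if $k\in I$ and the Schubert section if $k\notin I$. Definition of $\tilde I_i$: put $j_1=i$ and $a_{1,j}:=\beta_{ij}$ for $j>i$. Let $j_2>j_1$ be the least integer $\leq r$ with $a_{1,j_2}>0$ (if any), and for $j>j_2$ put $a_{2,j}:=\beta_{ij_2}\beta_{j_2j}-\beta_{ij}$. For $k>2$, let $j_k>j_{k-1}$ be the least integer $\le r$ with $a_{k-1,j_k}<0$ (if any), and for $j>j_k$ put $a_{k,j}:=-a_{k-1,j_k}\beta_{j_kj}+a_{k-1,j}$. The process stops when no such integer exists; $\tilde I_i:=\{j_1,\dots,j_m\}$ is the set of all indices produced. $N_1(X)$ is the real vector space of 1-cycles modulo numerical equivalence; $\overline{NE}(X)\subset N_1(X)$ is the closure of the convex cone generated by classes of irreducible curves. A subcone $Q$ of a closed cone $K$ is extremal if $u,v\in K$, $u+v\in Q$ imply $u,v\in Q$; an extremal ray is a one-dimensional extremal subcone. *)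

(* Defs.v *)
From HB Require Import structures.
From mathcomp Require Import all_boot all_order all_algebra.
From mathcomp Require Import all_classical all_reals all_analysis.
From mathcomp Require Import complex.

Set Implicit Arguments.
Unset Strict Implicit.
Unset Printing Implicit Defensive.

Import Order.TTheory GRing.Theory Num.Theory.
Import numFieldNormedType.Exports.

Local Open Scope ring_scope.

Definition dot n (m u : 'rV[int]_n) : int := \sum_i m 0 i * u 0 i.

(* A fan of simplicial cones in R^n: each cone is encoded by the set of its
   rays, so that the common face of two cones A and B is A :&: B. *)
Record fan n := Fan {
  ray : finType;
  gen : ray -> 'rV[int]_n;
  cones : {set {set ray}} }.

Section ToricVariety.
Variables (n : nat) (F : fan n).

(* The lattice points S_A of the dual of the cone A; U_A = Spec C[S_A]. *)
Definition dual (A : {set ray F}) (m : 'rV[int]_n) : bool :=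
  [forall p in A, 0 <= dot m (gen p)].

(* K-points of U_A are the monoid morphisms from S_A to (K, * ); the values of
   phi outside S_A are irrelevant. *)
Definition chart_point (K : fieldType) (A : {set ray F})
    (phi : 'rV[int]_n -> K) : Prop :=
  phi 0 = 1 /\
  forall m m', dual A m -> dual A m' -> phi (m + m') = phi m * phi m'.

(* A K-point of the variety is a K-point of some chart; the charts of A and B
   are glued along the chart of A :&: B. *)
Definition tpoint (K : fieldType) : Type :=
  ({set ray F} * ('rV[int]_n -> K))%type.

Definition is_point (K : fieldType) (x : tpoint K) : Prop :=
  x.1 \in cones F /\ chart_point x.1 x.2.

Definition glue (K : fieldType) (x y : tpoint K) (om : 'rV[int]_n -> K) :=
  [/\ chart_point (x.1 :&: y.1) om,
      forall m, dual x.1 m -> om m = x.2 m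
    & forall m, dual y.1 m -> om m = y.2 m].

Definition same_point (K : fieldType) (x y : tpoint K) : Prop :=
  exists om, glue x y om.

Variable C : fieldType.

(* Elements of C[S_A] are the finitely supported functions on Z^n with support
   in S_A; the product is convolution. *)
Definition regular (A : {set ray F}) (f : 'rV[int]_n -> C) : Prop :=
  finite_set [set m | f m != 0]%classic /\ (forall m, f m != 0 -> dual A m).

Definition lmul (f g : 'rV[int]_n -> C) : 'rV[int]_n -> C :=
  fun m => \sum_(a \in [set: 'rV[int]_n]%classic) f a * g (m - a).

Definition lone : 'rV[int]_n -> C := fun m => (m == 0)%:R.

Definition leval (K : fieldType) (iota : {rmorphism C -> K})
    (phi : 'rV[int]_n -> K) (f : 'rV[int]_n -> C) : K :=
  \sum_(m \in [set m | f m != 0]%classic) iota (f m) * phi m.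

(* Line bundles, trivialised on the charts U_A, by their transition functions:
   local sections s_A, s_B define the same section when s_A = tr A B * s_B.
   When the fan is smooth, U_A is the product of an affine space and a torus,
   so all line bundles on it are trivial and all line bundles on the variety
   are obtained in this way. tr A B is a unit of C[S_(A :&: B)], with
   inverse tr B A. *)
Record line_bundle := LineBundle {
  tr : {set ray F} -> {set ray F} -> 'rV[int]_n -> C;
  tr_regular : forall A B, A \in cones F -> B \in cones F ->
    regular (A :&: B) (tr A B);
  tr_id : forall A, A \in cones F -> tr A A = lone;
  tr_cocycle : forall A B D, A \in cones F -> B \in cones F ->
    D \in cones F -> lmul (tr A B) (tr B D) = tr A D }.

(* An irreducible curve (integral closed subscheme of dimension 1) is given by
   its generic point: a K-point where K is the residue field of that point,
   i.e. K is generated as a field by the values of the regular functions, and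
   has transcendence degree 1 over C. *)
Record curve := Curve {
  cfield : fieldType;
  cincl : {rmorphism C -> cfield};
  cpt : tpoint cfield;
  cpt_point : is_point cpt;
  cpt_residue : forall a : cfield, exists f g,
    [/\ regular cpt.1 f, regular cpt.1 g, leval cincl cpt.2 g != 0
      & a = leval cincl cpt.2 f / leval cincl cpt.2 g];
  cpt_trdeg1 : exists z : cfield, ~ algebraicOver cincl z /\
    forall a : cfield, exists2 P : {poly {poly C}}, P != 0 &
      root (map_poly (fun p => (map_poly cincl p).[z]) P) a }.

(* Normalised discrete valuations of K trivial on C, i.e. the closed points of
   the normalisation of the curve; the value at 0 is 0 by convention. *)
Definition valuation (K : fieldType) (iota : {rmorphism C -> K})
    (v : K -> int) : Prop :=
  [/\ v 0 = 0,
      forall x y, x != 0 -> y != 0 -> v (x * y) = v x + v y,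
      forall x y, x != 0 -> y != 0 -> x + y != 0 ->
        Num.min (v x) (v y) <= v (x + y),
      forall c, c != 0 -> v (iota c) = 0
    & exists2 x, x != 0 & v x = 1].

(* Let x = (A, phi) be the generic point of the curve. The order at v of the
   rational section of L that is the constant 1 in the trivialisation over
   U_A; it is computed in the trivialisation over a chart U_B containing the
   image of v, i.e. such that all regular functions on U_B are regular at v. *)
Definition section_order (L : line_bundle) (Z : curve)
    (v : cfield Z -> int) (k : int) : Prop :=
  exists B psi om,
    [/\ is_point (B, psi), glue (cpt Z) (B, psi) om,
        forall m, dual B m -> 0 <= v (psi m)
      & k = v (leval (cincl Z) om (tr L B (cpt Z).1))].

(* The intersection number L.Z, i.e. the degree of the pull-back of L to the
   normalisation of Z, i.e. the degree of the divisor of that section. *)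
Definition intersection (L : line_bundle) (Z : curve) : int :=
  \sum_(v \in [set v | valuation (cincl Z) v]%classic)
    xget 0 [set k | section_order L v k]%classic.

Variable R : realType.

(* Two real 1-cycles are numerically equivalent when they define the same
   function of L; N_1 is the space of these functions. *)
Definition one_cycle : Type := seq (R * curve).

Definition cycle_class (z : one_cycle) : line_bundle -> R :=
  fun L => \sum_(p <- z) p.1 * (intersection L p.2)%:~R.

Definition N1 : set (line_bundle -> R) :=
  [set c | exists z : one_cycle, c = cycle_class z]%classic.

Definition effective_classes : set (line_bundle -> R) :=
  [set c | exists2 z : one_cycle,
     all (fun p => 0 <= p.1) z & c = cycle_class z]%classic.

(* N_1 has finite dimension, hence only one Hausdorff vector space topology:
   here it is the restriction of the topology of pointwise convergence. *)
Definition mori_cone : set (line_bundle -> R) :=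
  (N1 `&` closure (effective_classes : set {ptws line_bundle -> R}))%classic.

Definition class_of (Z : curve) : line_bundle -> R := cycle_class [:: (1, Z)].

End ToricVariety.

Section Cones.
Local Open Scope classical_set_scope.
Variables (R : realType) (V : lmodType R).

Definition convex_cone (Q : set V) : Prop :=
  [/\ Q 0, forall u v, Q u -> Q v -> Q (u + v)
    & forall (t : R) u, 0 <= t -> Q u -> Q (t *: u)].

Definition extremal (K Q : set V) : Prop :=
  [/\ convex_cone Q, Q `<=` K
    & forall u v, K u -> K v -> Q (u + v) -> Q u /\ Q v].

Definition extremal_ray (K Q : set V) : Prop :=
  extremal K Q /\
  exists2 u, Q u /\ u != 0 & forall v, Q v -> exists t : R, v = t *: u.

Definition ray_through (u : V) : set V := [set t *: u | t in [set t | 0 <= t]].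

End Cones.

(* In this part all indices start at 0. *)

Definition generalized_Cartan d (A : 'M[int]_d) : Prop :=
  [/\ forall i, A i i = 2,
      forall i j, i != j -> A i j <= 0
    & forall i j, A i j = 0 -> A j i = 0].

(* A i j is the pairing of the j-th simple root with the i-th simple coroot;
   a word is the sequence of the indices of its simple roots. *)
Definition word_pairing d (A : 'M[int]_d) (w : seq 'I_d) (i j : nat) : int :=
  if (onth w i, onth w j) is (Some a, Some b) then A a b else 0.

Section ToricLimit.
Variable beta : nat -> nat -> int.

(* The rays (i, true) and (i, false) are e_i^+ and e_i^-. *)
Definition limit_gen n (p : 'I_n * bool) : 'rV[int]_n :=
  let e (j : 'I_n) : 'rV[int]_n := delta_mx 0 j in
  if p.2 then e p.1
  else - e p.1 - \sum_(j < n | (p.1 < j)%N) beta p.1 j *: e j.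

Definition toric_limit n : fan n :=
  @Fan n ('I_n * bool)%type (@limit_gen n)
    [set A : {set 'I_n * bool} |
       [forall i, ~~ (((i, true) \in A) && ((i, false) \in A))]].

Variable K : fieldType.

Definition restr n (m : 'rV[int]_n.+1) : 'rV[int]_n :=
  \row_j m 0 (lift ord_max j).

Definition extend n (m : 'rV[int]_n) : 'rV[int]_n.+1 :=
  \row_j oapp (m 0) 0 (unlift ord_max j).

(* The toric morphism given by the projection from Z^(n+1) to Z^n; [extend] is
   the dual map. *)
Definition proj n (x : tpoint (toric_limit n.+1) K) :
    tpoint (toric_limit n) K :=
  ([set p | (lift ord_max p.1, p.2) \in x.1], fun m => x.2 (extend m)).

(* The section of [proj] whose image is the toric divisor of the ray (n, b),
   i.e. the locus where the characters m with <m, (n, b)> > 0 vanish: the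
   Schubert section if b is true, the non-Schubert section otherwise. *)
Definition section_pt n (b : bool) (x : tpoint (toric_limit n) K) :
    tpoint (toric_limit n.+1) K :=
  ((ord_max, b) |: [set (lift ord_max p.1, p.2) | p in x.1],
   fun m : 'rV[int]_n.+1 => if m 0 ord_max == 0 then x.2 (restr m) else 0).

Definition schubert_point n : tpoint (toric_limit n) K :=
  ([set p : 'I_n * bool | p.2],
   fun m : 'rV[int]_n => (m == 0)%:R).

(* For I increasing with first element i: x is the generic point of the image
   of L_I in the n-th variety. For n = i + 1 this is the Schubert line: it
   is the only irreducible curve that [proj] maps to the Schubert point. *)
Fixpoint generic_pt_L (I : seq nat) n : tpoint (toric_limit n) K -> Prop :=
  match n with
  | 0 => fun=> False
  | k.+1 => fun x =>
      if k == head 0 I then same_point (proj x) (schubert_point k)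
      else exists y, [/\ is_point y, generic_pt_L I y
                       & same_point x (section_pt (k \notin I) y)]
  end.

End ToricLimit.

Definition is_L (C : fieldType) (beta : nat -> nat -> int) (I : seq nat) n
    (Z : curve (toric_limit beta n) C) : Prop :=
  generic_pt_L I (cpt Z).

Section Indices.
Variables (beta : nat -> nat -> int) (r : nat).

Definition next_index (j : nat) (P : pred nat) : option nat :=
  ohead [seq l <- iota j.+1 (r - j.+1) | P l].

(* The indices j_k, j_(k+1), ... for k > 2, from j = j_(k-1) and
   a = a_(k-1). The increasing indices are less than r, so the fuel r is
   enough. *)
Fixpoint indices_from (fuel j : nat) (a : nat -> int) : seq nat :=
  if fuel is fuel'.+1 then
    if next_index j (fun l => a l < 0) is Some l then
      l :: indices_from fuel' l (fun h => - a l * beta l h + a h)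
    else [::]
  else [::].

Definition tildeI (i : nat) : seq nat :=
  i :: (if next_index i (fun l => 0 < beta i l) is Some l then
          l :: indices_from r l (fun h => beta i l * beta l h - beta i h)
        else [::]).

End Indices.

(* Main.v *)
Require Import Defs.
From HB Require Import structures.
From mathcomp Require Import all_boot all_order all_algebra.
From mathcomp Require Import all_classical all_reals all_analysis.
From mathcomp Require Import complex generic_quotient separable.
From mathcomp Require Import zify ring lra.

(* A family (m_A) of characters with m_A - m_B orthogonal to the
   common face of A and B describes a line bundle, and every line bundle is of
   this form because the units of a Laurent polynomial ring are monomials. If
   the generic point of a curve lies in the orbit of the cone t and v is a point
   of its normalisation with centre in the chart of B, then the order at v is
   the valuation of the character m_B - m_t. So, as principal divisors have
   degree 0, intersection numbers depend only on the values a_p of the support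
   function on the rays, linearly and up to linear functions. Modulo linear
   functions these values are determined by the r numbers
   a(e_i^+) + a(e_i^-) - sum_l c_il a(e_l^+-) attached to the primitive relations
   e_i^+ + e_i^- = sum_l c_il e_l^+-, c_il >= 0; the signs in the i-th relation
   are what the algorithm defining tildeI computes. By Batyrev's criterion the
   dual basis consists of nef line bundles M_j, and L_(tildeI i) is the invariant
   curve of the wall with rays the e_l^+-, l <> i, on which M_j has degree 0 for
   j <> i and positive degree for j = i. Hence the Mori cone is simplicial,
   generated by the classes of these curves.

   Principal divisors have degree 0 by Riemann's counting argument: for x
   transcendental over C and n = [K : C(x)], independence of valuations bounds
   the number of zeros by n, while the n(k+1) independent functions u_i x^j,
   j <= k, lie in a space of dimension k (number of poles) + O(1), so that there
   are at least n poles; then exchange x and 1/x. *)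

Set Implicit Arguments.
Unset Strict Implicit.
Unset Printing Implicit Defensive.

Import Order.TTheory GRing.Theory Num.Theory.
Import numFieldNormedType.Exports.

Local Open Scope ring_scope.

(** * Discrete valuations *)

Section Valuation.
Variables (C K : fieldType) (iota : {rmorphism C -> K}).

(** A [curve] is only a generic point: no smooth model of its function field K comes with it, so the
    places of K have to be studied from K alone. Everything rests on one bound: [K : C(x)] is finite
    for x transcendental, because K is generated by the values of finitely many characters and the
    characteristic is 0. This bound makes a maximal subring avoiding x^-1 a discrete valuation ring,
    so that x has a zero; it forces residue fields to be C; and it limits the number of zeros. The
    existence of zeros is used twice: functions without poles are constant, and M_i has positive
    degree on its curve because a generator of the character group of the orbit vanishes somewhere.
    A curve may lie in the boundary, where the canonical section of an invariant divisor can vanish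
    identically; hence the families (m_A) run over all cones, and m_t gives a section that is
    nonzero at the generic point. The closure in the Mori cone is controlled by the inequalities
    c(M_j) >= 0, which pass to limits, while a class in N_1 is a linear function of its r values on
    the M_j. *)

Definition ev (x : K) (p : {poly C}) : K := (map_poly iota p).[x].

Lemma evD x p q : ev x (p + q) = ev x p + ev x q.
Proof. by rewrite /ev rmorphD hornerD. Qed.

Lemma evB x p q : ev x (p - q) = ev x p - ev x q.
Proof. by rewrite /ev rmorphB hornerD hornerN. Qed.

Lemma evM x p q : ev x (p * q) = ev x p * ev x q.
Proof. by rewrite /ev rmorphM hornerM. Qed.

Lemma evC x c : ev x c%:P = iota c.
Proof. by rewrite /ev map_polyC hornerC. Qed.

Lemma evX x : ev x 'X = x.
Proof. by rewrite /ev map_polyX hornerX. Qed.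

Lemma ev_sum x I (r : seq I) (P : pred I) (F : I -> {poly C}) :
  ev x (\sum_(i <- r | P i) F i) = \sum_(i <- r | P i) ev x (F i).
Proof. by rewrite /ev rmorph_sum horner_sum. Qed.

Lemma evXn x n : ev x 'X^n = x ^+ n.
Proof. by rewrite /ev map_polyXn hornerXn. Qed.

Lemma evE x p : ev x p = \sum_(i < size p) iota p`_i * x ^+ i.
Proof.
rewrite /ev horner_coef size_map_poly.
by apply: eq_bigr => i _; rewrite coef_map.
Qed.

Lemma ev_eq0 x p : ~ algebraicOver iota x -> (ev x p == 0) = (p == 0).
Proof.
move=> hx; apply/idP/idP => [h0|/eqP->]; last by rewrite /ev rmorph0 horner0.
by apply/eqP/eqP/negP => /negP p0; apply: hx; exists p.
Qed.

(** [v 0 = 0] is a convention, so 0 is put into every level of the filtration by hand, as if its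
    value were infinite. *)
Definition vge (v : K -> int) (k : int) (x : K) := (x == 0) || (k <= v x).

Section OneValuation.
Variables (v : K -> int) (hv : valuation iota v).

Lemma val0 : v 0 = 0. Proof. by case: hv. Qed.

Lemma valM x y : x != 0 -> y != 0 -> v (x * y) = v x + v y.
Proof. by case: hv => _ h _ _ _; exact: h. Qed.

Lemma val_iota c : v (iota c) = 0.
Proof.
have [->|c0] := eqVneq c 0; first by rewrite rmorph0 val0.
by case: hv => _ _ _ h _; exact: h.
Qed.

Lemma val1 : v 1 = 0. Proof. by rewrite -(rmorph1 iota) val_iota. Qed.

Lemma valV x : v x^-1 = - v x.
Proof.
have [->|x0] := eqVneq x 0; first by rewrite invr0 val0 oppr0.
have := valM x0 (invr_neq0 x0); rewrite divff // val1 => h; lia.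
Qed.

Lemma valX x n : v (x ^+ n) = v x *+ n.
Proof.
have [->|x0] := eqVneq x 0.
  by rewrite expr0n val0 mul0rn; case: eqP => _; rewrite ?val1 ?val0.
elim: n => [|n IH]; first by rewrite expr0 val1.
by rewrite exprS valM ?expf_neq0 // IH mulrS.
Qed.

Lemma valN x : v (- x) = v x.
Proof.
have [->|x0] := eqVneq x 0; first by rewrite oppr0.
have h1 : - 1 != 0 :> K by rewrite oppr_eq0 oner_eq0.
by rewrite -mulN1r valM // -(rmorph1 iota) -rmorphN val_iota add0r.
Qed.

Lemma val_uniformizer : exists2 t, t != 0 & v t = 1.
Proof. by case: hv. Qed.

Lemma vge0 k : vge v k 0. Proof. by rewrite /vge eqxx. Qed.

Lemma vgeE k x : x != 0 -> vge v k x = (k <= v x).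
Proof. by rewrite /vge => /negbTE->. Qed.

Lemma vgeW k l x : l <= k -> vge v k x -> vge v l x.
Proof. by rewrite /vge => h /orP[->//|h']; rewrite (le_trans h h') orbT. Qed.

Lemma vgeD k x y : vge v k x -> vge v k y -> vge v k (x + y).
Proof.
have [->|x0] := eqVneq x 0; first by rewrite add0r.
have [->|y0] := eqVneq y 0; first by rewrite addr0.
have [->|xy0] := eqVneq (x + y) 0; first by rewrite vge0.
rewrite !vgeE // => hx hy; case: hv => _ _ h _ _.
by apply: le_trans (h _ _ x0 y0 xy0); rewrite le_min hx.
Qed.

Lemma vgeN k x : vge v k (- x) = vge v k x.
Proof. by rewrite /vge oppr_eq0 valN. Qed.

Lemma vgeB k x y : vge v k x -> vge v k y -> vge v k (x - y).
Proof. by move=> hx hy; apply: vgeD; rewrite ?vgeN. Qed.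

Lemma vgeM k l x y : vge v k x -> vge v l y -> vge v (k + l) (x * y).
Proof.
have [->|x0] := eqVneq x 0; first by rewrite mul0r !vge0.
have [->|y0] := eqVneq y 0; first by rewrite mulr0 !vge0.
by rewrite !vgeE ?mulf_neq0 // valM // => hx hy; apply: lerD.
Qed.

Lemma vge_sum k I (r : seq I) (P : pred I) F :
  (forall i, P i -> vge v k (F i)) -> vge v k (\sum_(i <- r | P i) F i).
Proof. by move=> h; apply: (big_ind (vge v k)) => //; [exact: vge0 | exact: vgeD]. Qed.

Lemma vge_iota c : vge v 0 (iota c).
Proof. by rewrite /vge val_iota lexx orbT. Qed.

Lemma vge_iotaM k c x : vge v k x -> vge v k (iota c * x).
Proof. by move=> h; rewrite -[k]add0r vgeM ?vge_iota. Qed.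

Lemma vgeX k x n : vge v k x -> vge v (k *+ n) (x ^+ n).
Proof.
move=> hx; elim: n => [|n IH]; last by rewrite exprS mulrS vgeM.
by rewrite expr0 mulr0n -(rmorph1 iota); exact: vge_iota.
Qed.

Lemma vge_ev x p : vge v 0 x -> vge v 0 (ev x p).
Proof.
move=> hx; rewrite evE; apply: vge_sum => i _; apply: vge_iotaM.
by rewrite -(mul0rn _ i) vgeX.
Qed.

(** Reduction at a zero of x: every term of p(x) beyond the constant one is divisible by x. *)
Lemma vge_ev_sub x p : vge v 1 x -> vge v 1 (ev x p - iota p`_0).
Proof.
move=> hx; rewrite evE; case: (size p) (size_poly_eq0 p) => [/esym/eqP->|n _].
  by rewrite big_ord0 coef0 rmorph0 subrr vge0.
rewrite big_ord_recl /= expr0 mulr1 addrC addKr.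
apply: vge_sum => i _; apply: vge_iotaM; rewrite exprS -[1]addr0.
by apply: vgeM => //; rewrite -(mul0rn _ i) vgeX // (vgeW _ hx).
Qed.

Lemma vge1_iota c : vge v 1 (iota c) -> c = 0.
Proof. by rewrite /vge val_iota orbF fmorph_eq0 => /eqP. Qed.

(** The term of strictly least value dominates: otherwise x = (x + y) - y would have value greater
    than [v x]. *)
Lemma val_dom x y : x != 0 -> vge v (v x + 1) y ->
  x + y != 0 /\ v (x + y) = v x.
Proof.
move=> x0 hy; have xy0 : x + y != 0.
  apply/negP => /eqP/(canRL (addrK _)); rewrite sub0r => e.
  move: hy; rewrite -vgeN -e vgeE //; lia.
split=> //; apply/eqP; rewrite eq_le.
have h1 : vge v (v x) (x + y).
  apply: vgeD; first by rewrite vgeE.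
  by apply: vgeW hy; lia.
rewrite vgeE // in h1; rewrite h1 andbT leNgt; apply/negP => h2.
have : vge v (v x + 1) (x + y - y).
  by apply: vgeB => //; rewrite vgeE //; lia.
by rewrite addrK vgeE //; lia.
Qed.

(** If v y > 0, a relation p(y) = 0 forces the constant coefficient of p to have positive value,
    hence to be 0; dividing p by X repeats the argument until p = 0. The inverse of x gives the
    other inequality. *)
Lemma val_algebraic x : algebraicOver iota x -> v x = 0.
Proof.
have pos y : y != 0 -> algebraicOver iota y -> v y <= 0.
  move=> y0 [p p0 py]; rewrite leNgt; apply/negP => hy.
  suff : forall n (q : {poly C}), (size q <= n)%N -> ev y q = 0 -> q = 0.
    move=> /(_ _ p (leqnn _)) h; move: p0; rewrite h ?eqxx //.
    exact/eqP.
  elim=> [q|n IH q hq q0]; first by rewrite leqn0 size_poly_eq0 => /eqP.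
  have hc : q`_0 = 0.
    apply: vge1_iota; rewrite -vgeN -[- _]add0r -q0 vge_ev_sub // vgeE //.
  have [q' e] : exists q', q = q' * 'X.
    have /factor_theorem[q' e] : root q 0 by rewrite /root horner_coef0 hc.
    by exists q'; rewrite e subr0.
  move: hq q0; rewrite e evM evX => hq /eqP.
  rewrite mulf_eq0 (negbTE y0) orbF => /eqP q0.
  have [->|q'0] := eqVneq q' 0; first by rewrite mul0r.
  by move: hq; rewrite size_mulX // => hq; rewrite (IH q') ?mul0r.
have [->|x0] := eqVneq x 0; first by rewrite val0.
move=> hx; apply/eqP; rewrite eq_le pos //= -oppr_le0 -valV.
by rewrite pos ?invr_neq0 //; apply: algebraic_inv.
Qed.

End OneValuation.
End Valuation.

(** * Independence of valuations and weak approximation *)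

Section Approximation.
Variables (C K : fieldType) (iota : {rmorphism C -> K}).

Lemma valXz (v : K -> int) (hv : valuation iota v) x n : v (x ^ n) = v x * n.
Proof.
case: n => n; first by rewrite -exprnP (valX hv) pmulrn mulrzz.
by rewrite NegzE -exprnN (valV hv) (valX hv) mulrN pmulrn mulrzz.
Qed.

(** If w were nonnegative wherever v is, it would vanish on the units of v, hence equal w(t) v for a
    uniformizer t of v; both being normalised, w(t) = 1. *)
Lemma val_sep1 (v w : K -> int) : valuation iota v -> valuation iota w ->
  v <> w -> exists x, [/\ x != 0, 0 <= v x & w x < 0].
Proof.
move=> hv hw vw; apply: contrapT => hn; apply: vw.
have h x : x != 0 -> 0 <= v x -> 0 <= w x.
  by move=> x0 vx; rewrite leNgt; apply/negP => wx; apply: hn; exists x.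
have [t t0 vt] := val_uniformizer hv; have [s s0 ws] := val_uniformizer hw.
have wE x : x != 0 -> w x = w t * v x.
  move=> x0; have tx0 : t ^ v x != 0 by rewrite expfz_neq0.
  have y0 : x / t ^ v x != 0 by rewrite mulf_neq0 ?invr_neq0.
  have vy : v (x / t ^ v x) = 0.
    by rewrite (valM hv) ?invr_neq0 // (valV hv) (valXz hv) vt mul1r subrr.
  have h1 : 0 <= w (x / t ^ v x) by apply: h; rewrite ?vy.
  have h2 : 0 <= w (x / t ^ v x)^-1.
    by apply: h; rewrite ?invr_neq0 ?(valV hv) ?vy.
  rewrite (valV hw) in h2; have e : w (x / t ^ v x) = 0 by lia.
  move: e; rewrite (valM hw) ?invr_neq0 // (valV hw) (valXz hw); lia.
have wt : w t = 1.
  have := wE _ s0; rewrite ws.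
  have : 0 <= w t by apply: h; rewrite ?vt.
  case: (w t) => // n _; case: (v s) => m; last by lia.
  by rewrite -PoszM => -[] /esym/eqP; rewrite muln_eq1 => /andP[/eqP->].
apply/funext => x; have [->|x0] := eqVneq x 0; first by rewrite (val0 hv) (val0 hw).
by rewrite wE // wt mul1r.
Qed.

Lemma val_sep (v w : K -> int) : valuation iota v -> valuation iota w ->
  v <> w -> exists x, [/\ x != 0, 0 < v x & w x < 0].
Proof.
move=> hv hw vw; have [x [x0 vx wx]] := val_sep1 hv hw vw.
have [y [y0 wy vy]] := val_sep1 hw hv (nesym vw).
exists (x / y); rewrite mulf_neq0 ?invr_neq0 //; split => //.
  by rewrite (valM hv) ?invr_neq0 // (valV hv); lia.
by rewrite (valM hw) ?invr_neq0 // (valV hw); lia.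
Qed.

Lemma seq_bound (T : eqType) (s : seq T) (f : T -> int) :
  exists N : nat, {in s, forall v, `|f v| <= N%:Z}.
Proof.
elim: s => [|a s [N hN]]; first by exists 0%N.
exists (N + `|f a|)%N => v; rewrite inE => /orP[/eqP->|/hN]; lia.
Qed.

Lemma val_sep_seq (v : K -> int) (s : seq (K -> int)) :
    valuation iota v -> {in s, forall w, valuation iota w} -> v \notin s ->
  exists x, [/\ x != 0, 0 < v x & {in s, forall w, w x < 0}].
Proof.
move=> hv; elim: s => [|w s IH] hs.
  by have [t t0 vt] := val_uniformizer hv; exists t; rewrite vt.
rewrite inE negb_or => /andP[/eqP vw vs].
have [|x [x0 vx sx]] := IH _ vs.
  by move=> u us; apply: hs; rewrite inE us orbT.
have hw : valuation iota w by apply: hs; rewrite inE eqxx.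
have [y [y0 vy wy]] := val_sep hv hw vw.
(* x^(N+1) + y works for N large: no cancellation can occur. *)
have [N hN] := seq_bound (w :: s) (fun u => u y).
have xa0 : x ^+ N.+1 != 0 by rewrite expf_neq0.
have big u : u \in w :: s -> u x < 0 ->
    x ^+ N.+1 + y != 0 /\ u (x ^+ N.+1 + y) < 0.
  move=> us ux; have hu := hs _ us; have := hN _ us => hy.
  have e : u (x ^+ N.+1) = u x * N.+1%:Z by rewrite (valX hu) pmulrn mulrzz.
  have hle : u x * N.+1%:Z <= - N.+1%:Z by nia.
  have [|-> ->] := val_dom hu xa0 (y := y); last by rewrite e; split=> //; lia.
  by rewrite (vgeE _ _ y0) e; lia.
have W : x ^+ N.+1 + y != 0 /\ w (x ^+ N.+1 + y) < 0.
  have [wx|wx] := ltP (w x) 0; first by apply: big; rewrite ?inE ?eqxx.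
  rewrite addrC; have [|-> ->] := val_dom hw y0 (y := x ^+ N.+1) => //.
  rewrite vgeE // (valX hw) pmulrn mulrzz; nia.
exists (x ^+ N.+1 + y); split; first by case: W.
  have : vge v 1 (x ^+ N.+1 + y).
    apply: (vgeD hv); rewrite vgeE // ?(valX hv) ?pmulrn ?mulrzz; nia.
  by rewrite vgeE //; case: W.
move=> u; rewrite inE => /orP[/eqP->|us]; first by case: W.
have us' : u \in w :: s by rewrite inE us orbT.
by case: (big u us' (sx _ us)).
Qed.

(** 1/(1 + x) has value 0 at v and the positive value - w(x) at each w in s: its powers leave v
    alone and raise the others, N factors to offset w(t^k) and [|E|] more to reach E. *)
Lemma val_approx (v : K -> int) (s : seq (K -> int)) (k E : int) :
    valuation iota v -> {in s, forall w, valuation iota w} -> v \notin s ->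
  exists y, [/\ y != 0, v y = k & {in s, forall w, E <= w y}].
Proof.
move=> hv hs vs; have [x [x0 vx sx]] := val_sep_seq hv hs vs.
have [t t0 vt] := val_uniformizer hv.
have [N hN] := seq_bound s (fun w => w (t ^ k)).
have [x10 vx1] : 1 + x != 0 /\ v (1 + x) = 0.
  have [|h1 h2] := val_dom hv (oner_neq0 K) (y := x); last first.
    by rewrite h2 (val1 hv).
  by rewrite (val1 hv) vgeE //; lia.
have tk0 : t ^ k != 0 by rewrite expfz_neq0.
have e0 m : (1 + x)^-1 ^+ m != 0 by rewrite expf_neq0 // invr_neq0.
exists ((1 + x)^-1 ^+ (N + `|E|) * t ^ k); split; first by rewrite mulf_neq0.
  by rewrite (valM hv) // (valX hv) (valV hv) vx1 oppr0 mul0rn (valXz hv) vt; lia.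
move=> w ws; have hw := hs _ ws.
rewrite (valM hw) // (valX hw) (valV hw).
have [|_] := val_dom hw x0 (y := 1).
  by rewrite vgeE ?oner_eq0 // (val1 hw); have := sx _ ws; lia.
rewrite [x + 1]addrC => ->.
have := hN _ ws; have := sx _ ws; rewrite pmulrn mulrzz => h1 h2.
have : - w x * (N + `|E|)%N%:Z >= (N + `|E|)%N%:Z by nia.
lia.
Qed.

Lemma divX_eq (F : fieldType) (p : {poly F}) : p`_0 = 0 -> p = (p %/ 'X) * 'X.
Proof.
move=> p0; rewrite divpK //.
by have := dvdp_XsubCl p 0; rewrite subr0 => ->; rewrite /root horner_coef0 p0.
Qed.

(** * Zeros of x counted against the degree of K over C(x) *)

Section Dependent.
Variable x : K.

(** For x transcendental this is linear dependence over C(x), with denominators cleared; [rank_le N]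
    then says [K : C(x)] <= N. *)
Definition dependent (T : finType) (y : T -> K) : Prop :=
  exists p : T -> {poly C}, (exists i, p i != 0) /\
    \sum_i ev iota x (p i) * y i = 0.

Definition rank_le (N : nat) : Prop :=
  forall (T : finType) (y : T -> K), (N < #|T|)%N -> dependent y.

(* After division by a power of x, some coefficient does not vanish at 0. *)
Lemma dependent_primitive (T : finType) (y : T -> K) : x != 0 -> dependent y ->
  exists p : T -> {poly C}, (exists i, (p i)`_0 != 0) /\
    \sum_i ev iota x (p i) * y i = 0.
Proof.
move=> x0 [p [[i pi0] sp]].
have [n] := ubnP (\sum_i size (p i))%N.
elim: n p i pi0 sp => // n IH p i pi0 sp hn.
have [[j hj]|hj] := pselect (exists j, (p j)`_0 != 0).
  by exists p; split=> //; exists j.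
have pE j : p j = (p j %/ 'X) * 'X.
  by apply: divX_eq; apply/eqP/negPn/negP => h; apply: hj; exists j.
apply: (IH (fun j => p j %/ 'X) i) => /=.
- by apply: contraNneq pi0 => h; rewrite pE h mul0r.
- apply: (mulfI x0); rewrite mulr0 -[RHS]sp mulr_sumr; apply: eq_bigr => j _.
  by rewrite [in RHS]pE evM evX; ring.
- apply: leq_trans (_ : \sum_j size (p j) <= n)%N; last by rewrite -ltnS.
  rewrite [X in (_ < X)%N](bigD1 i) //= (bigD1 i) //= -addSn leq_add //.
    rewrite [in X in (_ < X)%N](pE i) size_mulX //.
    by apply: contraNneq pi0 => h; rewrite pE h mul0r.
  apply: leq_sum => j _; rewrite [in X in (_ <= X)%N](pE j).
  have [->|h] := eqVneq (p j %/ 'X) 0; first by rewrite size_poly0.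
  by rewrite size_mulX.
Qed.

(* Elements with v_i = k < v_i x and value >= v_j x at the other v_j are
   independent over C[x]. *)
Lemma sum_val_le N (s : seq (K -> int)) : rank_le N -> uniq s ->
    {in s, forall v, valuation iota v} -> {in s, forall v, 0 < v x} ->
  \sum_(v <- s) v x <= N%:Z.
Proof.
move=> hN us hs hx; case: s us hs hx => [|v0 s'] us hs hx;
  first by rewrite big_nil lez_nat.
have x0 : x != 0.
  have v0s : v0 \in v0 :: s' by rewrite inE eqxx.
  by apply/negP => /eqP e; have := hx _ v0s; rewrite e (val0 (hs _ v0s)) ltxx.
move: (v0 :: s') us hs hx => {s'} s us hs hx; rewrite leNgt; apply/negP => hlt.
have mem (i : 'I_(size s)) : nth v0 s i \in s by rewrite mem_nth ?ltn_ord.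
pose v (i : 'I_(size s)) := nth v0 s i.
have hv i : valuation iota (v i) by exact: hs _ (mem i).
have vx i : 0 < v i x by exact: hx _ (mem i).
have [E hE] := seq_bound s (fun u => u x).
(* One element y for each place v_i and each k < v_i x: in all sum_i v_i x elements, more than N. *)
pose T := {i : 'I_(size s) & 'I_(`|v i x|)}.
pose mk i (k : 'I_(`|v i x|)) : T := existT (fun i => 'I_(`|v i x|)) i k.
have cT : (N < #|{: T}|)%N.
  rewrite card_tagged sumnE big_map big_enum /= -ltz_nat.
  apply: lt_le_trans hlt _.
  rewrite (big_nth v0) big_mkord (big_morph Posz PoszD (erefl _)) /=.
  apply: ler_sum => i _; rewrite card_ord; have := vx i; rewrite /v; lia.
have yP (t : T) : exists y, [/\ y != 0, v (tag t) y = (tagged t)%:Z &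
    forall j, j != tag t -> E%:Z <= v j y].
  have [||y [y0 y1 y2]] :=
    @val_approx (v (tag t)) (rem (v (tag t)) s) (tagged t)%:Z E%:Z (hv _).
  - by move=> w /mem_rem; exact: hs.
  - by rewrite mem_rem_uniq // inE eqxx.
  exists y; split=> // j hj; apply: y2; rewrite mem_rem_uniq // inE mem_nth // andbT.
  by rewrite /v (nth_uniq v0) ?ltn_ord.
pose y t := projT1 (cid (yP t)).
have yP' t : [/\ y t != 0, v (tag t) (y t) = (tagged t)%:Z &
    forall j, j != tag t -> E%:Z <= v j (y t)] by exact: projT2 (cid (yP t)).
have [p [[[i k0] hk0] sp]] := dependent_primitive x0 (hN T y cT).
(* Among the terms of place i whose coefficient does not vanish at x = 0, the one with least k has
   value exactly k. All other terms have larger value: those of other places by the choice of E,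
   those with coefficient divisible by x because k < v_i x, the rest by minimality. *)
pose k := [arg min_(k < k0 | ((p (mk i k))`_0 != 0)%R) k]%N.
have [hk kmin] : (p (mk i k))`_0 != 0 /\
    forall l : 'I_(`|v i x|), (p (mk i l))`_0 != 0 -> (k <= l)%N.
  by rewrite /k; case: arg_minnP.
have xge : vge (v i) 1 x by rewrite vgeE //; have := vx i; lia.
pose t0 : T := mk i k.
have [a0 av] : ev iota x (p t0) != 0 /\ v i (ev iota x (p t0)) = 0.
  have c0 : iota (p t0)`_0 != 0 by rewrite fmorph_eq0.
  have := vge_ev_sub (hv i) (p t0) xge.
  move=> h; have [|] := val_dom (hv i) c0 (y := ev iota x (p t0) - iota (p t0)`_0).
    by rewrite (val_iota (hv i)) add0r.
  by rewrite addrC subrK (val_iota (hv i)).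
have [y0 yv yo] := yP' t0.
have b0 : ev iota x (p t0) * y t0 != 0 by rewrite mulf_neq0.
have bv : v i (ev iota x (p t0) * y t0) = k%:Z.
  by rewrite (valM (hv i)) // av add0r yv.
have kx : k%:Z + 1 <= v i x.
  rewrite -PoszD addn1 -[leRHS](gtz0_abs (vx i)) lez_nat.
  exact: ltn_ord.
move: sp; rewrite (bigD1 t0) //= => sp.
suff : vge (v i) (k%:Z + 1) (\sum_(t | t != t0) ev iota x (p t) * y t).
  rewrite -bv => h; have [h' _] := val_dom (hv i) b0 h.
  by rewrite sp eqxx in h'.
apply: (vge_sum (hv i)) => -[j l] jl.
have ge0 q : vge (v i) 0 (ev iota x q) by apply: (vge_ev (hv i)); apply: (vgeW _ xge).
have [z0 zv zo] := yP' (mk _ l).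
have [e|ij] := eqVneq i j; last first.
  rewrite -[_ + 1]add0r; apply: (vgeM (hv i)) => //; rewrite vgeE //.
  apply: le_trans (zo i ij); apply: le_trans kx _.
  exact: le_trans (ler_norm _) (hE _ (mem i)).
move: l jl z0 zv zo; case: j / e => l jl z0 zv zo /=.
have lk : l != k by apply: contraNneq jl => ->.
have [pl|pl] := eqVneq (p (mk _ l))`_0 0.
  rewrite /= (divX_eq pl) evM evX -mulrA -[_ + 1]add0r; apply: (vgeM (hv i)) => //.
  rewrite vgeE ?mulf_neq0 // (valM (hv i)) // zv /=.
  by apply: le_trans kx _; rewrite lerDl.
rewrite -[_ + 1]add0r; apply: (vgeM (hv i)) => //.
rewrite vgeE // zv /= -PoszD addn1 lez_nat ltn_neqAle kmin // andbT.
by rewrite eq_sym.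
Qed.

End Dependent.
End Approximation.

(** * Existence of valuations *)

Section ValuationRing.
Variables (C K : fieldType) (iota : {rmorphism C -> K}) (x : K).

(* A subring of K maximal for this property is a valuation ring. *)
Definition local_at (O : set K) : Prop :=
  [/\ forall c, O (iota c), O x, forall a b, O a -> O b -> O (a - b),
      forall a b, O a -> O b -> O (a * b) & ~ O x^-1].

Section Local.
Variables (O : set K) (hO : local_at O).

Lemma local_iota c : O (iota c). Proof. by case: hO. Qed.
Lemma local_x : O x. Proof. by case: hO. Qed.
Lemma localB a b : O a -> O b -> O (a - b). Proof. by case: hO => _ _ h _ _;
  exact: h. Qed.
Lemma localM a b : O a -> O b -> O (a * b). Proof. by case: hO => _ _ _ h _;
  exact: h. Qed.
Lemma local_xV : ~ O x^-1. Proof. by case: hO. Qed.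
Lemma local1 : O 1. Proof. by rewrite -(rmorph1 iota); exact: local_iota. Qed.
Lemma local0 : O 0. Proof. by rewrite -(rmorph0 iota); exact: local_iota. Qed.
Lemma localN a : O a -> O (- a).
Proof. by move=> h; rewrite -sub0r; apply: localB => //; exact: local0. Qed.
Lemma localD a b : O a -> O b -> O (a + b).
Proof. by move=> ha hb; rewrite -[b]opprK; apply: localB => //; exact: localN. Qed.
Lemma localX a n : O a -> O (a ^+ n).
Proof.
move=> h; elim: n => [|n IH]; first by rewrite expr0; exact: local1.
by rewrite exprS; apply: localM.
Qed.
Lemma local_sum I (r : seq I) (P : pred I) F :
  (forall i, P i -> O (F i)) -> O (\sum_(i <- r | P i) F i).
Proof. by move=> h; apply: (big_ind O) => //; [exact: local0 | exact: localD]. Qed.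

Lemma local_x_neq0 : x != 0.
Proof. by apply/eqP => e; apply: local_xV; rewrite e invr0; exact: local0. Qed.

Definition coefs_in (P : {poly K}) := forall i, O P`_i.

Lemma coefs_inD P Q : coefs_in P -> coefs_in Q -> coefs_in (P + Q).
Proof. by move=> hP hQ i; rewrite coefD; apply: localD. Qed.

Lemma coefs_inN P : coefs_in P -> coefs_in (- P).
Proof. by move=> hP i; rewrite coefN; apply: localN. Qed.

Lemma coefs_inM P Q : coefs_in P -> coefs_in Q -> coefs_in (P * Q).
Proof. by move=> hP hQ i; rewrite coefM; apply: local_sum => j _; apply: localM. Qed.

Lemma coefs_inC a : O a -> coefs_in a%:P.
Proof. by move=> h i; rewrite coefC; case: eqP => // _; exact: local0. Qed.

Lemma coefs_inXn n : coefs_in 'X^n.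
Proof. by move=> i; rewrite coefXn; case: eqP => _; [exact: local1|exact: local0]. Qed.

Hypothesis Omax : forall B, (O `<` B)%classic -> ~ local_at B.

(** O[y] is strictly larger than O, and of the conditions of [local_at] only the absence of x^-1 can
    fail for it. *)
Lemma maximal_adjoin y : ~ O y -> exists2 P, coefs_in P & P.[y] = x^-1.
Proof.
move=> hy; apply: contrapT => hn.
pose B : set K := [set a | exists2 P, coefs_in P & P.[y] = a]%classic.
have OB a : O a -> B a by move=> h; exists a%:P; [exact: coefs_inC | rewrite hornerC].
apply: (Omax (B := B)).
  split; first exact: OB.
  move=> h; apply: hy; apply: h; exists 'X; last by rewrite hornerX.
  exact: (coefs_inXn 1).
split.
- by move=> c; apply/OB/local_iota.
- exact/OB/local_x.
- move=> a b [P hP <-] [Q hQ <-]; exists (P - Q); last by rewrite hornerD hornerN.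
  by apply: coefs_inD => //; exact: coefs_inN.
- move=> a b [P hP <-] [Q hQ <-]; exists (P * Q); last by rewrite hornerM.
  exact: coefs_inM.
- by move=> [P hP e]; apply: hn; exists P.
Qed.

(** Otherwise x^-1 is a polynomial in w^-1, where w = 1 - x b. Multiplying by a power of w, which is
    again of the form 1 - x b', puts x^-1 - b' into O. *)
Lemma maximal_unit b : O b -> O (1 - x * b)^-1.
Proof.
move=> hb; apply: contrapT => hw; have [P hP e] := maximal_adjoin hw.
set w := 1 - x * b in hw e.
have w0 : w != 0.
  apply/eqP => h; apply: hw; rewrite h invr0; exact: local0.
have hwO : O w by apply: localB; [exact: local1 | apply: localM => //; exact: local_x].
have [b' hb' eb'] : exists2 b', O b' & w ^+ size P = 1 - x * b'.
  elim: (size P) => [|n [b' hb' IH]].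
    by exists 0; [exact: local0 | rewrite mulr0 subr0].
  exists (b + b' - x * b * b').
    apply: localB; first exact: localD.
    by apply: localM => //; apply: localM => //; exact: local_x.
  by rewrite exprS IH /w; ring.
have : O (\sum_(i < size P) P`_i * w ^+ (size P - i)).
  by apply: local_sum => i _; apply: localM => //; exact: localX.
have -> : \sum_(i < size P) P`_i * w ^+ (size P - i) = w ^+ size P * x^-1.
  rewrite -e horner_coef mulr_sumr; apply: eq_bigr => i _.
  rewrite mulrCA exprVn; congr (_ * _).
  have -> : w ^+ size P = w ^+ (size P - i) * w ^+ i.
    by rewrite -exprD subnK // ltnW // ltn_ord.
  by rewrite mulfK // expf_neq0.
rewrite eb' => h; apply: local_xV.
have -> : x^-1 = (1 - x * b') * x^-1 + b'.
  by field; exact: local_x_neq0.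
exact: localD.
Qed.

(** As 1 - x Q_0 is a unit, the relation Q at y^-1, multiplied by y^(m+1), becomes a monic equation
    y^(m+1) = R(y) with R of degree at most m; rewriting the leading term of P with it lowers the
    degree. *)
Lemma maximal_reduce y P Q : coefs_in P -> coefs_in Q ->
    P.[y] = x^-1 -> Q.[y^-1] = x^-1 -> (size Q <= size P)%N ->
  exists P', [/\ coefs_in P', P'.[y] = x^-1 & (size P' < size P)%N].
Proof.
move=> hP hQ eP eQ sQP.
have xV0 : x^-1 != 0 by rewrite invr_eq0 local_x_neq0.
have y0 : y != 0.
  apply/eqP => y0; apply: local_xV; rewrite -eP y0 horner_coef0; exact: hP.
case sQ : (size Q) => [|[|m]].
- by move/eqP: sQ eQ; rewrite size_poly_eq0 => /eqP-> /esym/eqP;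
  rewrite horner0 (negbTE xV0).
- case: local_xV; rewrite -eQ; have /eqP/size_poly1P[c _ e] := sQ.
  by rewrite e hornerC; have := hQ 0%N; rewrite e coefC.
set w := 1 - x * Q`_0; have hw : O w^-1 by exact: maximal_unit.
have w0 : w != 0.
  rewrite subr_eq0; apply/eqP => h; apply: local_xV.
  have -> : x^-1 = Q`_0 by rewrite -[Q`_0](mulKf local_x_neq0) -h mulr1.
  exact: hQ.
pose R : {poly K} := \sum_(j < m.+1) (x / w * Q`_j.+1)%:P * 'X^(m - j).
have hR : coefs_in R.
  move=> i; rewrite coef_sum; apply: local_sum => j _; apply: coefs_inM => //.
    by apply: coefs_inC; do 2?apply: localM => //; exact: local_x.
  exact: coefs_inXn.
have sR : (size R <= m.+1)%N.
  apply: (leq_trans (size_sum _ _ _)); apply/bigmax_leqP => j _.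
  rewrite mul_polyC; apply: leq_trans (size_scale_leq _ _) _; rewrite size_polyXn.
  by rewrite ltnS leq_subr.
have eR : R.[y] = y ^+ m.+1.
  have : w = x * (\sum_(j < m.+1) Q`_j.+1 * y^-1 ^+ j.+1).
    move: eQ; rewrite horner_coef sQ big_ord_recl expr0 mulr1 => /(canRL (addKr _)) ->.
    rewrite /w; field; exact: local_x_neq0.
  move=> e; rewrite horner_sum.
  transitivity (y ^+ m.+1 / w * (x * (\sum_(j < m.+1) Q`_j.+1 * y^-1 ^+ j.+1))).
    rewrite mulrA mulr_sumr; apply: eq_bigr => j _.
    have jm : (j <= m)%N by rewrite -ltnS.
    rewrite hornerM hornerC hornerXn exprVn.
    have -> : y ^+ m.+1 = y ^+ (m - j) * y ^+ j.+1 by rewrite -exprD addnS subnK.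
    by field; rewrite w0 expf_neq0.
  by rewrite -e divfK.
have sP : (m.+1 < size P)%N by rewrite -sQ.
pose n := (size P).-1; have nP : size P = n.+1 by rewrite /n prednK // (leq_trans _ sP).
have mn : (m.+1 <= n)%N by rewrite -ltnS -nP.
exists ((\poly_(i < n) P`_i) + (P`_n)%:P * ('X^(n - m.+1) * R)); split.
- apply: coefs_inD; first by move=> i; rewrite coef_poly; case: ifP => // _;
  exact: local0.
  apply: coefs_inM; first exact: coefs_inC.
  by apply: coefs_inM => //; exact: coefs_inXn.
- rewrite -eP hornerD horner_poly !hornerM hornerC hornerXn eR -exprD subnK //.
  by rewrite [in RHS]horner_coef nP big_ord_recr.
- rewrite nP ltnS; apply: leq_trans (size_polyD _ _) _; rewrite geq_max size_poly /=.
  rewrite mul_polyC; apply: leq_trans (size_scale_leq _ _) _.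
  apply: leq_trans (size_polyMleq _ _) _; rewrite size_polyXn.
  by move: sR mn; lia.
Qed.

(** If neither y nor its inverse were in O, x^-1 would be a polynomial in each of them, and the
    longer of the two polynomials could be shortened forever. *)
Lemma maximal_total y : O y \/ O y^-1.
Proof.
apply: contrapT => /not_orP[h1 h2].
have [P hP eP] := maximal_adjoin h1; have [Q hQ eQ] := maximal_adjoin h2.
have [n] := ubnP (size P + size Q)%N.
elim: n y P Q hP hQ eP eQ {h1 h2} => // n IH y P Q hP hQ eP eQ hn.
have [le|/ltnW le] := leqP (size Q) (size P).
  have [P' [hP' eP' sP']] := maximal_reduce hP hQ eP eQ le.
  by apply: (IH y P' Q) => //; move: hn sP'; lia.
rewrite -[y]invrK in eP; have [Q' [hQ' eQ' sQ']] := maximal_reduce hQ hP eQ eP le.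
by rewrite invrK in eP; apply: (IH y P Q') => //; move: hn sQ'; lia.
Qed.

End Local.

Lemma maximal_local : ~ algebraicOver iota x ->
  exists2 O, local_at O & forall B, (O `<` B)%classic -> ~ local_at B.
Proof.
(* The property given to Zorn's lemma must also hold for the union of the empty chain, whence
   [set0]. *)
move=> hx; pose P (O : set K) := O = set0 \/ local_at O.
(* The polynomial ring C[x] is a starting point: x^-1 = p(x) would give X p = 1, which fails at
   0. *)
have g0 : local_at (range (ev iota x)).
  split.
  - by move=> c; exists c%:P; rewrite ?evC.
  - by exists 'X; rewrite ?evX.
  - move=> _ _ [p _ <-] [q _ <-]; exists (p - q) => //.
    by rewrite /ev rmorphB hornerD hornerN.
  - by move=> _ _ [p _ <-] [q _ <-]; exists (p * q); rewrite ?evM.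
  - move=> [p _ e]; have x0 : x != 0.
      apply/eqP => x0; apply: hx; exists 'X; first by rewrite polyX_eq0.
      by rewrite map_polyX x0 /root hornerX.
    have : ev iota x ('X * p - 1) == 0.
      by rewrite /ev rmorphB rmorph1 hornerD hornerN hornerC -/(ev _ _ _) evM evX e
        divff ?subrr.
    rewrite ev_eq0 // => /eqP/(congr1 (fun q => q.[0])).
    by rewrite hornerD hornerM hornerX mul0r hornerN hornerC add0r horner0 => /eqP;
      rewrite oppr_eq0 oner_eq0.
have [V [PV hmax]] : exists A, P A /\ forall B, (A `<` B)%classic -> ~ P B.
  apply: Zorn_bigcup => F FP Ftot.
  have [[A0 FA0 gA0]|hn] := pselect (exists2 A, F A & local_at A); last first.
    left; rewrite -subset0 => a [A FA Aa]; have [A0|gA] := FP _ FA;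
      first by rewrite A0 in Aa.
    by apply: hn; exists A.
  right; have glob a b : (\bigcup_(X in F) X)%classic a ->
      (\bigcup_(X in F) X)%classic b ->
      exists A, [/\ F A, local_at A, A a & A b].
    move=> [A FA Aa] [B FB Bb].
    have [h|h] := Ftot _ _ FA FB.
      exists B; split => //; last exact: h.
      by have [B0|//] := FP _ FB; rewrite B0 in Bb.
    exists A; split => //; last exact: h.
    by have [A1|//] := FP _ FA; rewrite A1 in Aa.
  split.
  + by move=> c; exists A0 => //; exact: local_iota gA0 c.
  + by exists A0 => //; exact: local_x gA0.
  + by move=> a b ha hb; have [A [FA gA Aa Ab]] := glob _ _ ha hb; exists A => //;
    exact: localB gA _ _ _ _.
  + by move=> a b ha hb; have [A [FA gA Aa Ab]] := glob _ _ ha hb; exists A => //;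
    exact: localM gA _ _ _ _.
  + by move=> h; have [A [FA gA Aa _]] := glob _ _ h h; exact: local_xV gA Aa.
case: PV => [V0|hV].
- exfalso; apply: (hmax (range (ev iota x))); last by right.
  rewrite V0; split; first exact: sub0set.
  by move=> h; apply: (h (ev iota x 0)); exists 0.
- by exists V => // B hB gB; apply: (hmax _ hB); right.
Qed.

End ValuationRing.

(** * Discreteness of the valuation ring when the rank is finite *)

Section Discrete.
Variables (C K : fieldType) (iota : {rmorphism C -> K}) (x : K).
Variables (O : set K) (hO : local_at iota x O).
Hypothesis Ototal : forall y, O y \/ O y^-1.

Let O1 : O 1 := local1 hO.
Let OM a b : O a -> O b -> O (a * b) := @localM _ _ _ _ _ hO a b.
Let OD a b : O a -> O b -> O (a + b) := @localD _ _ _ _ _ hO a b.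
Let x0 : x != 0 := local_x_neq0 hO.

Definition nonunit a : Prop := O a /\ (a != 0 -> ~ O a^-1).

Lemma nonunitM a b : O a -> nonunit b -> nonunit (a * b).
Proof.
move=> ha [hb nb]; split; first exact: OM.
rewrite mulf_eq0 => /norP[a0 b0] h; apply: nb => //.
have -> : b^-1 = a * (a * b)^-1 by field; rewrite ?a0 ?b0.
exact: OM.
Qed.

Lemma nonunitD a b : nonunit a -> nonunit b -> nonunit (a + b).
Proof.
wlog h : a b / O (a / b) => [hw|] ha hb.
  have [h|] := Ototal (a / b); first exact: hw.
  by rewrite invf_div addrC => h; apply: hw.
have [->|b0] := eqVneq b 0; first by rewrite addr0.
have -> : a + b = (a / b + 1) * b by rewrite mulrDl mul1r divfK.
by apply: nonunitM => //; exact: OD.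
Qed.

Lemma nonunit1 : ~ nonunit 1.
Proof. by case=> _; rewrite oner_eq0 invr1; apply. Qed.

Lemma nonunit_x : nonunit x.
Proof. by split=> [|_]; [exact: local_x hO | exact: local_xV hO]. Qed.

Lemma nonunit_sum I (r : seq I) (P : pred I) F :
  (forall i, P i -> nonunit (F i)) -> nonunit (\sum_(i <- r | P i) F i).
Proof.
move=> h; apply: (big_ind nonunit) => //; last exact: nonunitD.
by split=> [|/eqP//]; exact: local0 hO.
Qed.

(** Equality of the classes of a and b in the value group of O, which is not yet known to be Z. *)
Definition eqval a b : Prop := [/\ a != 0, b != 0, O (a / b) & O (b / a)].

Lemma eqval_refl a : a != 0 -> eqval a a.
Proof. by move=> h; split=> //; rewrite divff. Qed.

Lemma eqval_sym a b : eqval a b -> eqval b a.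
Proof. by case. Qed.

Lemma eqval_trans b a c : eqval a b -> eqval b c -> eqval a c.
Proof.
move=> [a0 b0 h1 h2] [_ c0 h3 h4]; split => //.
  by rewrite -[a](divfK b0) -mulrA; exact: OM.
by rewrite -[c](divfK b0) -mulrA; exact: OM.
Qed.

Lemma eqvalM a b c d : eqval a b -> eqval c d -> eqval (a * c) (b * d).
Proof.
move=> [a0 b0 h1 h2] [c0 d0 h3 h4]; split; rewrite ?mulf_neq0 //.
  by rewrite -mulf_div; exact: OM.
by rewrite -mulf_div; exact: OM.
Qed.

Lemma eqvalX a b n : eqval a b -> eqval (a ^+ n) (b ^+ n).
Proof.
move=> h; elim: n => [|n IH]; first by rewrite !expr0; apply: eqval_refl;
  exact: oner_neq0.
by rewrite !exprS; apply: eqvalM.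
Qed.

(** Divide by a nonzero term of least value. If no other term had that value, 1 would be minus a sum
    of nonunits, which form an ideal. *)
Lemma eqval_two_terms (T : finType) (f : T -> K) :
  \sum_i f i = 0 -> (exists i, f i != 0) -> exists i j, i != j /\ eqval (f i) (f j).
Proof.
move=> sf [i0 fi0].
have [i fi hi] : exists2 i, f i != 0 & forall j, O (f j / f i).
  suff [i fi hi] : exists2 i, f i != 0 & {in enum T, forall j, O (f j / f i)}.
    by exists i => // j; apply: hi; rewrite mem_enum.
  elim: (enum T) => [|j s [i fi hi]]; first by exists i0.
  have [h|] := pselect (O (f j / f i)).
    by exists i => // k; rewrite inE => /orP[/eqP->|/hi].
  move=> h; have := Ototal (f j / f i) => -[//|]; rewrite invf_div => h'.
  have fj : f j != 0.
    by apply: contra_notN h => /eqP->; rewrite mul0r; exact: local0 hO.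
  exists j => // k; rewrite inE => /orP[/eqP->|/hi hk]; first by rewrite divff.
  have -> : f k / f j = (f k / f i) * (f i / f j) by field; rewrite ?fi ?fj.
  exact: OM.
apply: contrapT => hn; apply: nonunit1.
have -> : 1 = - 1 * \sum_(j | j != i) f j / f i.
  have e : \sum_(j | j != i) f j = - f i.
    by move: sf; rewrite (bigD1 i) //= => /eqP; rewrite addrC addr_eq0 => /eqP.
  by rewrite -mulr_suml e mulN1r mulNr opprK divff.
apply: nonunitM; first exact: localN hO _ O1.
apply: nonunit_sum => j ji; split => //.
rewrite mulf_eq0 invr_eq0 => /norP[fj _]; rewrite invf_div => h.
by apply: hn; exists i, j; rewrite eq_sym.
Qed.

(** After division by a power of X the constant coefficient c is nonzero, and c + x q(x) is a unit
    because x q(x) is not. *)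
Lemma eqval_ev p : p != 0 -> exists k : nat, eqval (ev iota x p) (x ^+ k).
Proof.
have [n] := ubnP (size p); elim: n p => // n IH p hn p0.
have Oev q : O (ev iota x q).
  rewrite evE; apply: (local_sum hO) => i _; apply: OM; first exact: local_iota hO _.
  by apply: (localX hO); exact: local_x hO.
have [c0|c0] := eqVneq p`_0 0.
  have pE := divX_eq c0; have q0 : p %/ 'X != 0.
    by apply: contraNneq p0 => q0; rewrite pE q0 mul0r.
  have [|//|k hk] := IH (p %/ 'X).
    by move: hn; rewrite [in size p]pE size_mulX.
  exists k.+1; rewrite pE evM evX exprSr; apply: eqvalM => //; exact: eqval_refl.
exists 0%N; rewrite expr0.
have pE : p = (p - (p`_0)%:P) %/ 'X * 'X + (p`_0)%:P.
  by rewrite -divX_eq ?subrK // coefB coefC eqxx subrr.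
set q := _ %/ 'X in pE.
have u : ev iota x p = ev iota x q * x + iota p`_0 by rewrite {1}pE evD evM evX evC.
have hnu : ~ nonunit (ev iota x p).
  move=> h; have : nonunit (ev iota x p - ev iota x q * x).
    apply: nonunitD => //; rewrite -mulN1r; apply: nonunitM.
      exact: localN hO _ O1.
    by apply: nonunitM => //; exact: nonunit_x.
  rewrite u addrC addKr => -[_]; rewrite fmorph_eq0 => /(_ c0); apply.
  by rewrite -fmorphV; exact: local_iota hO _.
have e0 : ev iota x p != 0.
  by apply: contra_notN hnu => /eqP->; split=> [|/eqP//]; exact: local0 hO.
split; rewrite ?oner_eq0 // ?divr1 // ?div1r.
by apply: contrapT => h; apply: hnu.
Qed.

Variable N : nat.
Hypothesis hN : rank_le iota x N.

Lemma eqval_exp y : y != 0 ->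
  exists d (k : int), [/\ (0 < d)%N, (d <= N)%N & eqval (y ^+ d) (x ^ k)].
Proof.
move=> y0; have [|p [[i0 pi0] sp]] := @hN _ (fun i : 'I_N.+1 => y ^+ i).
  by rewrite card_ord.
have [|i [j [ij hij]]] := @eqval_two_terms _ (fun i => ev iota x (p i) * y ^+ i) sp.
  exists i0; have [k [h _ _ _]] := eqval_ev pi0.
  by rewrite mulf_neq0 // expf_neq0.
wlog lt : i j ij hij / (j < i)%N => [hw|].
  have [lt|lt|/val_inj e] := ltngtP i j; last by rewrite e eqxx in ij.
  - by apply: (hw j i) => //; [rewrite eq_sym | exact: eqval_sym].
  - exact: (hw i j).
have pn (k : 'I_N.+1) : ev iota x (p k) * y ^+ k != 0 -> p k != 0.
  by apply: contraNneq => ->; rewrite /ev rmorph0 horner0 mul0r.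
case: (hij) => /pn /eqval_ev[a ha] /pn /eqval_ev[b hb] _ _.
exists (i - j)%N, (b%:Z - a%:Z); rewrite subn_gt0 lt leq_subLR; split=> //.
  by apply: leq_trans (leq_addl _ _); rewrite -ltnS.
have h1 : eqval (x ^+ a * y ^+ i) (x ^+ b * y ^+ j).
  have r k : eqval (y ^+ k) (y ^+ k) by apply: eqval_refl; rewrite expf_neq0.
  apply: eqval_trans (eqval_sym (eqvalM ha (r i))) _.
  by apply: eqval_trans hij _; apply: eqvalM.
have h2 : eqval (x ^+ a * y ^+ j)^-1 (x ^+ a * y ^+ j)^-1.
  by apply: eqval_refl; rewrite invr_neq0 // mulf_neq0 // expf_neq0.
have := eqvalM h1 h2.
have -> : x ^+ a * y ^+ i / (x ^+ a * y ^+ j) = y ^+ (i - j).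
  rewrite -[in y ^+ i](subnK (ltnW lt)) exprD; field.
  by rewrite !expf_neq0.
have -> : x ^+ b * y ^+ j / (x ^+ a * y ^+ j) = x ^ (b%:Z - a%:Z).
  rewrite expfzDr // -invr_expz -!exprnP; field; by rewrite !expf_neq0.
by [].
Qed.

(** If k and l differed, a negative power of x would lie in O, and with it x^-1. *)
Lemma eqval_exprz_inj (k l : int) : eqval (x ^ k) (x ^ l) -> k = l.
Proof.
have pos (m : int) : 0 < m -> ~ O (x ^ (- m)).
  case: m => [[|m]|//] // _ h; apply: (local_xV hO).
  have -> : x^-1 = x ^ (- m.+1%:Z) * x ^+ m.
    by rewrite -invr_expz -exprnP exprS; field; rewrite expf_neq0.
  by apply: OM => //; apply: (localX hO); exact: local_x hO.
move=> [_ _ h1 h2]; have [lt|lt|//] := ltgtP k l.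
  case: (@pos (l - k) _); rewrite ?subr_gt0 //.
  by rewrite opprB expfzDr // -invr_expz.
case: (@pos (k - l) _); rewrite ?subr_gt0 //.
by rewrite opprB expfzDr // -invr_expz.
Qed.

(* An equation of degree <= N of y over C[x] makes two of its terms have the same
   value, so y^d ~ x^k with 0 < d <= N; this gives a value in Z to y^(N!). *)
Definition scaled_val (y : K) : int :=
  if y == 0 then 0 else xget 0 [set k | eqval (y ^+ N`!) (x ^ k)]%classic.

Local Notation w := scaled_val.

Let wP y : y != 0 -> eqval (y ^+ N`!) (x ^ w y).
Proof.
move=> y0; rewrite /scaled_val (negbTE y0); have [d [k [d0 dN h]]] := eqval_exp y0.
case: xgetP => [m _ //|/(_ (k * (N`! %/ d)%N%:Z)) []] /=.
have dE : (d %| N`!)%N by apply: dvdn_fact; rewrite d0.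
rewrite -[X in y ^+ X](divnK dE) mulnC exprM -exprz_exp -exprnP.
exact: eqvalX.
Qed.

Let wE y k : y != 0 -> eqval (y ^+ N`!) (x ^ k) -> w y = k.
Proof.
by move=> y0 h; apply: eqval_exprz_inj; exact: eqval_trans (eqval_sym (wP y0)) h.
Qed.

Let wM a b : a != 0 -> b != 0 -> w (a * b) = w a + w b.
Proof.
move=> a0 b0; apply: wE; first by rewrite mulf_neq0.
by rewrite exprMn expfzDr //; apply: eqvalM; exact: wP.
Qed.

Let wx : w x = N`!.
Proof. by apply: wE => //; apply: eqval_refl; rewrite expf_neq0. Qed.

Let w1 : w 1 = 0.
Proof. by apply: (addrI (w 1)); rewrite addr0 -wM ?oner_neq0 // mulr1. Qed.

Let wV a : a != 0 -> w a^-1 = - w a.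
Proof.
by move=> a0; have := wM a0 (invr_neq0 a0); rewrite divff // w1; lia.
Qed.

Let wXz a (n : int) : a != 0 -> w (a ^ n) = w a * n.
Proof.
move=> a0; have h (m : nat) : w (a ^+ m) = w a * m.
  elim: m => [|m IH]; first by rewrite expr0 w1 mulr0.
  by rewrite exprS wM ?expf_neq0 // IH; lia.
case: n => n; first by rewrite -exprnP h.
by rewrite NegzE -invr_expz wV ?expf_neq0 // h mulrN.
Qed.

Let w_ge0 a : a != 0 -> O a -> 0 <= w a.
Proof.
move=> a0 Oa; rewrite leNgt; apply/negP => h.
have [_ _ _ h1] := wP a0; apply: (local_xV hO).
have : O (x ^ w a) by rewrite -[x ^ _](divfK (expf_neq0 N`! a0)); apply: OM => //;
  exact: localX hO _ _ Oa.
case: (w a) h => [//|n] _; rewrite NegzE -invr_expz => h'.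
have -> : x^-1 = (x ^ n.+1%:Z)^-1 * x ^+ n.
  by rewrite -exprnP exprS; field; rewrite expf_neq0.
by apply: OM => //; apply: (localX hO); exact: local_x hO.
Qed.

Let w_ge0P a : a != 0 -> 0 <= w a -> O a.
Proof.
move=> a0 h; have [//|Ov] := Ototal a.
have := w_ge0 (invr_neq0 a0) Ov; rewrite wV // => h'.
have e : w a = 0 by lia.
have [_ _ + _] := wP a0; rewrite e expr0z divr1 => h2.
have -> : a = a ^+ N`! * a^-1 ^+ (N`!).-1.
  by rewrite -[in a ^+ _](prednK (fact_gt0 N)) exprS exprVn mulfK // expf_neq0.
by apply: OM => //; exact: localX hO _ _ Ov.
Qed.

(** [scaled_val] is additive on products and its values on nonzero elements form a subgroup gZ,
    nonzero because x has value N!; division by g normalises it. *)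
Lemma discrete_valuation : exists2 v, valuation iota v & 0 < v x.
Proof.
pose P (n : nat) := `[< (0 < n)%N /\ exists2 y, y != 0 & w y = n >].
have exP : exists n, P n.
  by exists N`!; apply/asboolP; split; [exact: fact_gt0 | exists x].
case: (ex_minnP exP) => g /asboolP[g0 [t t0 wt]] gmin.
have gz : (g%:Z != 0) by move: g0; lia.
have dvd y : y != 0 -> (g %| w y)%Z.
  move=> y0; apply/dvdz_mod0P/eqP/negPn/negP => r0.
  have r1 : 0 <= (w y %% g)%Z < g by rewrite modz_ge0 //= ltz_pmod //; lia.
  have e : w (y / t ^ (w y %/ g)%Z) = (w y %% g)%Z.
    rewrite wM ?invr_neq0 ?expfz_neq0 // wV ?expfz_neq0 // wXz // wt.
    by rewrite {1}(divz_eq (w y) g); lia.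
  have : P `|(w y %% g)%Z|%N.
    apply/asboolP; split; first by move: r0 r1; lia.
    exists (y / t ^ (w y %/ g)%Z); first by rewrite mulf_neq0 ?invr_neq0 ?expfz_neq0.
    by rewrite e; move: r1; lia.
  by move=> /gmin; move: r1; lia.
pose v y := (w y %/ g)%Z.
have vE y : y != 0 -> w y = v y * g by move=> y0; rewrite divzK // dvd.
have vM a b : a != 0 -> b != 0 -> v (a * b) = v a + v b.
  move=> a0 b0; apply: (mulIf gz); rewrite mulrDl -!vE ?mulf_neq0 //; exact: wM.
have v_ge0 a : a != 0 -> (0 <= v a) <-> O a.
  move=> a0; have e := vE a a0; split=> [h|/(w_ge0 a0)];
    last by rewrite e pmulr_lge0 //; lia.
  by apply: w_ge0P => //; rewrite e; lia.
have vV a : a != 0 -> v a^-1 = - v a.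
  move=> a0; have := vE _ (invr_neq0 a0); rewrite wV // (vE a a0) -mulNr.
  by move/(mulIf gz).
exists v; last by have := vE x x0; rewrite wx; have := fact_gt0 N; nia.
split=> //.
- by rewrite /v /scaled_val eqxx div0z.
- move=> a b; wlog le : a b / v a <= v b => [hw|] a0 b0 ab0.
    case/orP: (le_total (v a) (v b)) => h; first exact: hw.
    by rewrite minC addrC; apply: hw => //; rewrite addrC.
  rewrite ge_min; apply/orP; left.
  have -> : a + b = a * (1 + b / a) by field.
  have c0 : 1 + b / a != 0.
    by apply: contraNneq ab0 => e; have -> : a + b = a * (1 + b / a) by [field];
      rewrite e mulr0.
  rewrite vM // lerDl; apply/v_ge0 => //; apply: OD => //.
  apply/v_ge0; first by rewrite mulf_neq0 ?invr_neq0.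
  by rewrite vM ?invr_neq0 // vV // subr_ge0.
- move=> c c0; have i0 : iota c != 0 by rewrite fmorph_eq0.
  have h1 : 0 <= v (iota c) by apply/v_ge0 => //; exact: local_iota hO _.
  have : 0 <= v (iota c)^-1.
    by apply/v_ge0; rewrite ?invr_neq0 // -fmorphV; exact: local_iota hO _.
  by rewrite vV //; lia.
- by exists t => //; have := vE t t0; rewrite wt; nia.
Qed.

End Discrete.

Lemma exists_zero (C K : fieldType) (iota : {rmorphism C -> K}) x N :
  ~ algebraicOver iota x -> rank_le iota x N ->
  exists2 v, valuation iota v & 0 < v x.
Proof.
move=> hx hN; have [V hV Vmax] := maximal_local hx.
exact: (@discrete_valuation _ _ _ _ V hV (maximal_total hV Vmax) N hN).
Qed.

(** * The degree of a principal divisor *)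

Lemma infinite_set_seq (T : choiceType) (A : set T) n : infinite_set A ->
  exists r : seq T, [/\ uniq r, (n <= size r)%N & {in r, forall v, A v}].
Proof.
move=> hA; have [B sB cB] := infinite_set_fset n hA; exists (finmap.enum_fset B).
by split=> // v; exact: sB.
Qed.

Lemma finite_set_seq (T : choiceType) (A : set T) : finite_set A ->
  exists2 r : seq T, uniq r & forall v, (v \in r) <-> A v.
Proof.
move=> /finite_seqP[r ->]; exists (undup r); first exact: undup_uniq.
by move=> v; rewrite mem_undup.
Qed.

Section FunctionField.
Variables (C : closedFieldType) (K : fieldType) (iota : {rmorphism C -> K}).

(** p splits into linear factors; if y - z had value 0 for all its roots z, so would p(y). *)
Lemma root_residue v y (p : {poly C}) : valuation iota v -> vge v 0 y ->
  p != 0 -> vge v 1 (ev iota y p) -> exists c, vge v 1 (y - iota c).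
Proof.
move=> hv hy p0; have [r pE] := closed_field_poly_normal p.
rewrite pE -mul_polyC evM evC => h.
have l0 : lead_coef p != 0 by rewrite lead_coef_eq0.
have {h} : vge v 1 (ev iota y (\prod_(z <- r) ('X - z%:P))).
  have := vge_iotaM hv (lead_coef p)^-1 h.
  by rewrite mulrA fmorphV mulVf ?mul1r // fmorph_eq0.
elim: r {pE} => [|z r IH].
  by rewrite big_nil /ev rmorph1 hornerC -(rmorph1 iota) => /(vge1_iota hv)/eqP;
    rewrite oner_eq0.
rewrite big_cons evM => h.
have [h1|h1] := pselect (vge v 1 (y - iota z)); first by exists z.
have e : ev iota y ('X - z%:P) = y - iota z.
  by rewrite -polyCN evD evX evC rmorphN.
apply: IH; have yz0 : y - iota z != 0.
  by apply: contra_notN h1 => /eqP->; exact: vge0.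
have yz : v (y - iota z) = 0.
  have := vgeB hv hy (vge_iota hv z); move: h1 => /negP; rewrite !vgeE // => a b.
  by apply/eqP; rewrite eq_le b andbT -ltzD1 add0r ltNge.
have : vge v (0 + 1) ((y - iota z)^-1 * (ev iota y ('X - z%:P) * ev iota y (\prod_(j
  <- r) ('X - j%:P)))).
  by apply: (vgeM hv) => //; rewrite vgeE ?invr_neq0 // (valV hv) yz.
by rewrite e mulKf // add0r.
Qed.

Hypothesis rankP : forall x, ~ algebraicOver iota x -> exists N, rank_le iota x N.

(** The residue of a transcendental y is algebraic over C: in a relation over C[y] between 1, t,
    ..., t^N, with t a uniformizer, the first nonzero coefficient has positive value, as is seen
    after division by its power of t. *)
Lemma residue v y : valuation iota v -> vge v 0 y -> exists c, vge v 1 (y - iota c).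
Proof.
move=> hv hy; have [[p p0 /eqP py]|hn] := pselect (algebraicOver iota y).
  by apply: (root_residue (p := p)) => //; rewrite /ev py; exact: vge0.
have [N hN] := rankP hn; have [t t0 vt] := val_uniformizer hv.
have [|p [[i0 pi0] sp]] := @hN _ (fun i : 'I_N.+1 => t ^+ i); first by rewrite card_ord.
case: (arg_minnP (P := fun i => p i != 0) (fun i : 'I_N.+1 => nat_of_ord i) pi0) => i
  pi imin.
apply: (root_residue (p := p i)) => //.
have ti0 : t ^+ i != 0 by rewrite expf_neq0.
have tv (j : nat) : v (t ^+ j) = j by rewrite (valX hv) vt pmulrn mulrzz mul1r.
have h : vge v (i%:Z + 1) (ev iota y (p i) * t ^+ i).
  rewrite -(vgeN hv); have -> : - (ev iota y (p i) * t ^+ i) =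
      \sum_(j | j != i) ev iota y (p j) * t ^+ j.
    by move: sp; rewrite (bigD1 i) //= => /eqP; rewrite addr_eq0 => /eqP ->;
      rewrite opprK.
  apply: (vge_sum hv) => j ji.
  have [->|pj] := eqVneq (p j) 0; first by rewrite /ev rmorph0 horner0 mul0r vge0.
  rewrite -[_ + 1]add0r; apply: (vgeM hv); first exact: vge_ev.
  rewrite vgeE ?expf_neq0 // tv; have := imin j pj.
  by move: ji; rewrite -val_eqE /=; lia.
have : vge v ((i%:Z + 1) + (- i%:Z)) (ev iota y (p i) * t ^+ i * (t ^+ i)^-1).
  by apply: (vgeM hv) => //; rewrite vgeE ?invr_neq0 // (valV hv) tv.
by rewrite mulfK // addrC addKr.
Qed.

(** Families are indexed by a subset [A] so that a member can be removed in an induction. *)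
Definition dim_le (W : K -> Prop) (d : nat) : Prop :=
  forall (T : finType) (A : {set T}) (w : T -> K), (d < #|A|)%N ->
    (forall i, i \in A -> W (w i)) ->
  exists c : T -> C, (exists2 i, i \in A & c i != 0) /\
    \sum_(i in A) iota (c i) * w i = 0.

Lemma dim_le0 : dim_le (eq^~ 0) 0.
Proof.
move=> T A w /card_gt0P[i iA] hw; exists (fun=> 1); split.
  by exists i => //; rewrite oner_eq0.
by apply: big1 => j jA; rewrite hw // mulr0.
Qed.

(** The last hypothesis bounds the codimension of W' in W by one: a member of the family outside W'
    serves as pivot to move the others into W'. *)
Lemma dim_leS (W W' : K -> Prop) d : dim_le W' d ->
    (forall a b, W a -> W b -> W' a \/ exists c, W' (b - iota c * a)) ->
  dim_le W d.+1.
Proof.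
move=> hd hW T A w cA hw.
have [h|] := pselect (forall i, i \in A -> W' (w i)).
  by apply: hd => //; apply: ltnW.
move=> /existsNP[i0 /not_implyP[i0A hi0]].
have cP j : exists c, j \in A -> W' (w j - iota c * w i0).
  have [jA|jA] := boolP (j \in A); last by exists 0.
  by have [//|[c hc]] := hW _ _ (hw _ i0A) (hw _ jA); exists c.
pose c j := projT1 (cid (cP j)).
have hc j : j \in A -> W' (w j - iota (c j) * w i0) := projT2 (cid (cP j)).
have [||c' [[i1 i1A c'0] sc']] := hd T (A :\ i0) (fun j => w j - iota (c j) * w i0).
- by rewrite (cardsD1 i0) i0A in cA.
- by move=> i; rewrite !inE => /andP[_ iA]; exact: hc.
exists (fun i => if i == i0 then - \sum_(j in A :\ i0) c' j * c j else c' i).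
move: (i1A); rewrite !inE => /andP[i10 i1A']; split.
  by exists i1 => //; rewrite (negbTE i10).
rewrite (big_setD1 i0) //= eqxx rmorphN rmorph_sum mulNr mulr_suml -sumrN -big_split /=.
rewrite -[RHS]sc'; apply: eq_bigr => j; rewrite !inE => /andP[/negbTE-> _].
by rewrite rmorphM; ring.
Qed.

(** The Riemann-Roch space L(D) of an effective divisor D. *)
Definition rr_space (D : (K -> int) -> nat) (f : K) : Prop :=
  forall v, valuation iota v -> vge v (- (D v)%:Z) f.

Lemma algebraic_const y : algebraicOver iota y -> exists c, y = iota c.
Proof.
move=> [p p0]; have [r pE] := closed_field_poly_normal p.
rewrite pE /root -/(ev _ _ _) -mul_polyC evM evC mulf_eq0 fmorph_eq0 lead_coef_eq0
  (negbTE p0) /=.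
elim: r {pE} => [|z r IH]; first by rewrite big_nil /ev rmorph1 hornerC oner_eq0.
rewrite big_cons evM mulf_eq0 => /orP[|//].
by rewrite -polyCN evD evX evC rmorphN subr_eq0 => /eqP; exists z.
Qed.

(** A nonconstant f is transcendental, so its inverse has a zero, which is a pole of f. *)
Lemma no_poles f : (forall v, valuation iota v -> vge v 0 f) -> exists c, f = iota c.
Proof.
move=> h; have [/algebraic_const//|hn] := pselect (algebraicOver iota f).
have hn' : ~ algebraicOver iota f^-1.
  by move=> h'; apply: hn; rewrite -[f]invrK; exact: algebraic_inv.
have [N hN] := rankP hn'; have [v hv] := exists_zero hn' hN.
have f0 : f != 0.
  by apply: contra_notN hn => /eqP ->; exists 'X;
    rewrite ?polyX_eq0 // map_polyX /root hornerX.
by have := h v hv; rewrite vgeE // (valV hv); lia.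
Qed.

(** Lowering D by one at a single place costs at most one dimension because the residue field is C;
    for D = 0 only the constants are left. *)
Lemma dim_rr_space (s : seq (K -> int)) (D : (K -> int) -> nat) :
    uniq s -> {in s, forall v, valuation iota v} ->
    (forall v, v \notin s -> D v = 0%N) ->
  dim_le (rr_space D) (\sum_(v <- s) D v).+1.
Proof.
move=> us hs; have [n] := ubnP (\sum_(v <- s) D v)%N.
elim: n D => // n IH D hn Ds.
have [h0|] := pselect (forall v, v \in s -> D v = 0%N).
  rewrite big_seq_cond big1 => [|v /andP[/h0]//].
  apply: (dim_leS dim_le0) => a b ha hb.
  have D0 v : D v = 0%N by have [/h0|/Ds] := boolP (v \in s).
  have [|c ->] := no_poles (f := a).
    by move=> v hv; have := ha v hv; rewrite D0.
  have [|c' ->] := no_poles (f := b).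
    by move=> v hv; have := hb v hv; rewrite D0.
  have [->|c0] := eqVneq c 0; first by left; rewrite rmorph0.
  by right; exists (c' / c); rewrite -rmorphM divfK // subrr.
move=> /existsNP[v0 /not_implyP[v0s /eqP Dv0]].
pose D' v := if v == v0 then (D v0).-1 else D v.
have sE : (\sum_(v <- s) D v = (\sum_(v <- s) D' v).+1)%N.
  have D'0 : D' v0 = (D v0).-1 by rewrite /D' eqxx.
  rewrite (bigD1_seq v0) //= [in RHS](bigD1_seq v0) //= D'0.
  rewrite -addSn prednK ?lt0n //; congr (_ + _)%N; apply: eq_bigr => v /negbTE h.
  by rewrite /D' h.
rewrite sE; apply: (@dim_leS _ (rr_space D')).
  apply: IH; first by rewrite sE in hn.
  move=> v vs; rewrite /D'; case: eqP => [e|_]; last exact: Ds.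
  by rewrite e v0s in vs.
move=> a b ha hb; have hv0 := hs _ v0s.
have [h|h] := pselect (vge v0 (- (D' v0)%:Z) a).
  left=> v hv; have [->//|ne] := eqVneq v v0.
  by rewrite /D' (negbTE ne); exact: ha.
right; have a0 : a != 0 by apply: contra_notN h => /eqP ->; exact: vge0.
have va : v0 a = - (D v0)%:Z.
  have := ha _ hv0; move: h => /negP; rewrite !vgeE // /D' eqxx.
  by move: Dv0; rewrite -lt0n; lia.
have aV : vge v0 (D v0)%:Z a^-1 by rewrite vgeE ?invr_neq0 // (valV hv0) va opprK.
have := vgeM hv0 (hb _ hv0) aV; rewrite addNr => /(residue hv0)[c hc].
exists c => v hv; have [->|ne] := eqVneq v v0; last first.
  by rewrite /D' (negbTE ne); apply: (vgeB hv); [exact: hb | apply: (vge_iotaM hv);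
    exact: ha].
have -> : b - iota c * a = (b / a - iota c) * a by field.
apply: (@vgeW _ _ (1 + - (D v0)%:Z)); first by rewrite /D' eqxx; lia.
by apply: (vgeM hv0) => //; rewrite vgeE // va.
Qed.

Lemma finite_zeros x : ~ algebraicOver iota x ->
  finite_set [set v | valuation iota v /\ 0 < v x]%classic.
Proof.
move=> hx; have [N hN] := rankP hx; apply: contrapT => hinf.
have [B [uB cB sB]] := infinite_set_seq N.+1 hinf.
have := sum_val_le hN uB.
suff h : (\sum_(v <- B) 1 <= \sum_(v <- B) v x :> int).
  move=> h'; have {h'} : \sum_(v <- B) v x <= N%:Z.
    by apply: h' => v vB; have [] := sB v vB.
  apply/negP; rewrite -ltNge; apply: lt_le_trans h.
  by rewrite big_const_seq count_predT iter_addr_0 natz; lia.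
by rewrite big_seq [X in _ <= X]big_seq; apply: ler_sum => v vB; have [_] := sB v vB;
  lia.
Qed.

Lemma finite_val x : finite_set [set v | valuation iota v /\ v x != 0]%classic.
Proof.
have [ha|ha] := pselect (algebraicOver iota x).
  suff -> : [set v | valuation iota v /\ v x != 0]%classic = set0 by exact: finite_set0.
  by rewrite -subset0 => v [hv]; rewrite (val_algebraic hv ha) eqxx.
have hb : ~ algebraicOver iota x^-1.
  by move=> h'; apply: ha; rewrite -[x]invrK; exact: algebraic_inv.
apply: sub_finite_set (_ : finite_set ([set v | valuation iota v /\ 0 < v x] `|` [set
  v | valuation iota v /\ 0 < v x^-1])%classic).
  move=> v [hv h]; have [|] := ltP 0 (v x); first by left.
  by right; split=> //; rewrite (valV hv); lia.
by rewrite finite_setU; split; exact: finite_zeros.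
Qed.

(** A largest family independent over C(x) gives n = [K : C(x)] and a basis u. *)
Lemma max_rank x : ~ algebraicOver iota x -> exists n (u : 'I_n -> K),
  rank_le iota x n /\ ~ dependent iota x u.
Proof.
move=> hx; have [N hN] := rankP hx.
pose P n := `[< exists u : 'I_n -> K, ~ dependent iota x u >].
have exP : exists n, P n by exists 0%N; apply/asboolP; exists (fun=> 0) => -[p [[[]]]].
have ubP n : P n -> (n <= N)%N.
  move=> /asboolP[u hu]; rewrite leqNgt; apply/negP => h; apply: hu; apply: hN.
  by rewrite card_ord.
case: (ex_maxnP exP ubP) => n /asboolP[u hu] nmax; exists n, u; split=> // T y hT.
apply: contrapT => hy.
have : P #|T|.
  apply/asboolP; exists (fun i => y (enum_val i)) => -[p [[i pi] sp]]; apply: hy.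
  exists (fun t => p (enum_rank t)); split; first by exists (enum_val i);
    rewrite enum_valK.
  rewrite -[RHS]sp (reindex (@enum_val T predT)) /=; last first.
    by exists enum_rank => t _; [exact: enum_valK | exact: enum_rankK].
  by apply: eq_bigr => j _; rewrite enum_valK.
by move=> /nmax; rewrite leqNgt hT.
Qed.

Lemma degree_le0 x : ~ algebraicOver iota x ->
  \sum_(v \in [set v | valuation iota v]%classic) v x <= 0.
Proof.
move=> hx; have [n [u [hn hu]]] := max_rank hx.
have x0 : x != 0.
  by apply: contra_notN hx => /eqP ->; exists 'X;
    rewrite ?polyX_eq0 // map_polyX /root hornerX.
(* Outside B both x and all the u_i have value 0, so the divisor D below can be supported on B. *)
have [B uB BE] : exists2 B : seq (K -> int), uniq B & forall v, (v \in B) <->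
    ([set v | valuation iota v /\ v x != 0] `|`
    \bigcup_(i in [set: 'I_n]) [set v | valuation iota v /\ v (u i) != 0])%classic v.
  apply: finite_set_seq; rewrite finite_setU; split; first exact: finite_val.
  by apply: bigcup_finite => // i _; exact: finite_val.
have BP v : (v \in B) <-> valuation iota v /\ (v x != 0 \/ exists i, v (u i) != 0).
  rewrite BE; split=> [[[hv h]|[i _ [hv h]]]|[hv [h|[i h]]]].
  - by split=> //; left.
  - by split=> //; right; exists i.
  - by left.
  - by right; exists i.
have hB : {in B, forall v, valuation iota v} by move=> v /BP[].
rewrite (fsbigE B) //=; last first.
- by move=> v hv vB; apply/eqP/negPn/negP => h; move/negP: vB; apply; apply/BP;
  split=> //; left.
have -> : \sum_(i <- B | i \in [set v | valuation iota v]%classic) i x = \sum_(i <-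
  B) i x.
  rewrite [LHS]big_seq_cond [RHS]big_seq_cond; apply: eq_bigl => v.
  by case: (boolP (v \in B)) => //= /hB hv; rewrite mem_set.
pose pos (v : K -> int) : nat := if 0 < v x then `|v x|%N else 0%N.
pose neg (v : K -> int) : nat := if v x < 0 then `|v x|%N else 0%N.
have -> : \sum_(v <- B) v x = (\sum_(v <- B) pos v)%N%:Z - (\sum_(v <- B) neg v)%N%:Z.
  rewrite !(big_morph Posz PoszD (erefl _)) -sumrB; apply: eq_bigr => v _.
  by rewrite /pos /neg; case: ltgtP; lia.
rewrite subr_le0 lez_nat.
apply: leq_trans (_ : n <= _)%N.
  have := sum_val_le hn (filter_uniq (fun v : K -> int => 0 < v x) uB).
  rewrite big_filter big_mkcond /= -lez_nat => h.
  have -> : (\sum_(v <- B) pos v)%N%:Z = \sum_(v <- B) (if 0 < v x then v x else 0).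
    rewrite (big_morph Posz PoszD (erefl _)); apply: eq_bigr => v _.
    by rewrite /pos; case: ltP => //; lia.
  by apply: h => v; rewrite mem_filter => /andP[] // _; exact: hB.
pose c (v : K -> int) := (\sum_i `|v (u i)|)%N.
set b := (\sum_(v <- B) neg v)%N; pose cc := (\sum_(v <- B) c v)%N.
(* With this k the bound n (k+1) <= b k + cc + 1 fails as soon as n > b: the left side would be at
   least b k + b + cc + 2. *)
pose k := cc.+1.
have bound : (n * k.+1 <= (b * k + cc).+1)%N.
  rewrite leqNgt; apply/negP => hlt.
  (* Enough poles for all u_i x^j with j <= k: k times those of x, plus those of the u_i. *)
  pose D v := if v \in B then (neg v * k + c v)%N else 0%N.
  have DE : (\sum_(v <- B) D v = b * k + cc)%N.
    rewrite big_distrl -big_split /= big_seq [RHS]big_seq; apply: eq_bigr => v vB.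
    by rewrite /D vB.
  have hD : dim_le (rr_space D) (b * k + cc).+1.
    by rewrite -DE; apply: dim_rr_space => // v /negbTE h; rewrite /D h.
  have [||f [[[i j] _ fij] sf]] := hD _ [set: 'I_n * 'I_k.+1] (fun t => u t.1 * x ^+
    t.2).
  - by rewrite cardsT card_prod !card_ord.
  - move=> [i j] _ v hv /=; have [ui0|ui0] := eqVneq (u i) 0;
    first by rewrite ui0 mul0r vge0.
    rewrite vgeE ?mulf_neq0 ?expf_neq0 // (valM hv) ?expf_neq0 // (valX hv) pmulrn
      mulrzz.
    have jk : (j <= k)%N by rewrite -ltnS.
    rewrite /D; case: (boolP (v \in B)) => vB.
      have : (`|v (u i)| <= c v)%N by rewrite /c (bigD1 i) //= leq_addr.
      by rewrite /neg; case: ltP => h; nia.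
    have h0 : v x = 0 by apply/eqP/negPn/negP => h; move/negP: vB; apply; apply/BP;
      split=> //; left.
    have h1 : v (u i) = 0 by apply/eqP/negPn/negP => h; move/negP: vB; apply;
      apply/BP; split=> //; right; exists i.
    by rewrite h0 h1 mul0r.
  apply: hu; exists (fun i => \poly_(j < k.+1) f (i, inord j)); split.
    exists i; apply: contraNneq fij => e.
    have := congr1 (fun p : {poly C} => p`_j) e;
      rewrite coef_poly ltn_ord coef0 inord_val.
    by move->.
  rewrite -[RHS]sf [RHS](eq_bigl xpredT) => [|t]; last by rewrite inE.
  rewrite [RHS](eq_bigr (fun t => iota (f (t.1, t.2)) * (u t.1 * x ^+ t.2))) => [|[]]
    //.
  rewrite -(pair_bigA _ (fun i j => iota (f (i, j)) * (u i * x ^+ j))) /=.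
  apply: eq_bigr => i' _; rewrite poly_def ev_sum mulr_suml; apply: eq_bigr => j' _.
  by rewrite -mul_polyC evM evC evXn inord_val; ring.
rewrite /k in bound; nia.
Qed.

Theorem degree_eq0 x : \sum_(v \in [set v | valuation iota v]%classic) v x = 0.
Proof.
have [ha|ha] := pselect (algebraicOver iota x).
  by apply: fsbig1 => v /= hv; apply: (@val_algebraic _ _ iota).
have hb : ~ algebraicOver iota x^-1.
  by move=> h'; apply: ha; rewrite -[x]invrK; exact: algebraic_inv.
apply/eqP; rewrite eq_le degree_le0 //=.
have := degree_le0 hb.
have [B uB BE] := finite_set_seq (finite_val x).
have BP v : valuation iota v -> v \notin B -> v x = 0.
  by move=> hv vB; apply/eqP/negPn/negP => h; move/negP: vB; apply; apply/BE.
have sB : ([set` B] `<=` [set v | valuation iota v])%classic by move=> v /BE[].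
rewrite !(fsbigE B) ?uB //; last first.
  by move=> v hv vB; rewrite (valV hv) BP // oppr0.
rewrite -oppr_ge0 -sumrN.
rewrite (eq_bigr (fun v : K -> int => v x)) // => v; rewrite inE => hv.
by rewrite (valV hv) opprK.
Qed.

End FunctionField.

(** * Finitely generated fields of transcendence degree one *)

Section RationalSubfield.
Variables (C K : fieldType) (iota : {rmorphism C -> K}) (x : K).

(** C(x) is carved out of K as a set of fractions, to become a field over which the primitive
    element theorem can be applied. *)
Definition ratl : {pred K} := [pred a | `[< exists p q : {poly C},
  ev iota x q != 0 /\ a = ev iota x p / ev iota x q >]].

Lemma ratl_ev p : ev iota x p \in ratl.
Proof.
apply/asboolP; exists p, 1; rewrite /ev rmorph1 hornerC oner_eq0; split=> //.
by rewrite divr1.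
Qed.

Lemma ratl_divring_closed : divring_closed ratl.
Proof.
split.
- by have := ratl_ev 1; rewrite /ev rmorph1 hornerC.
- move=> a b /asboolP[p [q [q0 ->]]] /asboolP[p' [q' [q'0 ->]]].
  apply/asboolP; exists (p * q' - p' * q), (q * q').
  rewrite evB !evM mulf_neq0 //; split=> //.
  by field; rewrite q0 q'0.
- move=> a b /asboolP[p [q [q0 ->]]] /asboolP[p' [q' [q'0 ->]]].
  have [e|p'0] := eqVneq (ev iota x p') 0.
    by rewrite e mul0r invr0 mulr0; have := ratl_ev 0; rewrite /ev rmorph0 horner0.
  apply/asboolP; exists (p * q'), (q * p').
  by rewrite !evM mulf_neq0 //; split=> //; field; rewrite q0 q'0 p'0.
Qed.

HB.instance Definition _ := GRing.isDivringClosed.Build K ratl ratl_divring_closed.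

Definition rat_subfield : Type := {a : K | a \in ratl}.
HB.instance Definition _ := SubChoice.on rat_subfield.
HB.instance Definition _ := [SubChoice_isSubComUnitRing of rat_subfield by <:].
HB.instance Definition _ := [SubComUnitRing_isSubIntegralDomain of rat_subfield by <:].
HB.instance Definition _ := [SubIntegralDomain_isSubField of rat_subfield by <:].

Definition rat_val : {rmorphism rat_subfield -> K} := \val.

Lemma rat_valE (a : rat_subfield) : exists p q : {poly C},
  ev iota x q != 0 /\ rat_val a = ev iota x p / ev iota x q.
Proof. by case: a => a ha; exact/asboolP. Qed.

Lemma rat_val_ev p : exists a : rat_subfield, rat_val a = ev iota x p.
Proof. by exists (exist _ (ev iota x p) (ratl_ev p)). Qed.

Lemma ratl_const c : iota c \in ratl.
Proof. by rewrite -(evC iota x); exact: ratl_ev. Qed.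

Definition rat_const (c : C) : rat_subfield := exist _ (iota c) (ratl_const c).

Lemma rat_const_is_zmod_morphism : zmod_morphism rat_const.
Proof. by move=> a b; apply: val_inj; rewrite /= rmorphB. Qed.

Lemma rat_const_is_monoid_morphism : monoid_morphism rat_const.
Proof.
by split=> [|a b]; apply: val_inj; rewrite /= ?rmorph1 ?rmorphM.
Qed.

HB.instance Definition _ := GRing.isZmodMorphism.Build C rat_subfield rat_const
  rat_const_is_zmod_morphism.
HB.instance Definition _ := GRing.isMonoidMorphism.Build C rat_subfield rat_const
  rat_const_is_monoid_morphism.

Lemma pchar_rat_subfield : [pchar C] =i pred0 -> [pchar rat_subfield] =i pred0.
Proof. by move=> h p; rewrite (fmorph_pchar rat_const) h. Qed.

End RationalSubfield.

(** * Simple algebraic extensions F[t] *)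

Section SimpleExtension.
Variables (F K : fieldType) (j : {rmorphism F -> K}).
Hypothesis charF : [pchar F] =i pred0.

Definition adjoin (t : K) : set K := [set a | exists p, a = (map_poly j p).[t]]%classic.

Lemma adjoin_poly t a p : adjoin t a -> adjoin t (map_poly j p).[a].
Proof.
by move=> [q ->]; exists (p \Po q); rewrite map_comp_poly horner_comp.
Qed.

Lemma finite_primitive_element (s : seq K) : {in s, forall a, algebraicOver j a} ->
  exists2 t, algebraicOver j t & {in s, forall a, adjoin t a}.
Proof.
elim: s => [|a s IH] hs.
  by exists 0 => //; exists 'X; rewrite ?polyX_eq0 // map_polyX /root hornerX.
have [|t [q q0 qt] ht] := IH; first by move=> b bs; apply: hs; rewrite inE bs orbT.
have ha : algebraicOver j a by apply: hs; rewrite inE eqxx.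
have [p p0 pa] := ha.
have [n [[pt et] [pa' ea]]] := pchar0_PET q0 qt p0 pa charF.
exists (a *+ n - t).
  apply: algebraic_sub; last by exists q.
  elim: n {et ea} => [|n IHn]; first by rewrite mulr0n -(rmorph0 j);
    exact: algebraic_id.
  by rewrite mulrS; apply: algebraic_add.
move=> b; rewrite inE => /orP[/eqP->|/ht[r ->]]; first by exists pa'.
by apply: adjoin_poly; exists pt.
Qed.

(** For t algebraic, F[t] is a field: a relation r(a) a + c = 0 with c nonzero gives - c^-1 r(a) as
    the inverse of a. *)
Lemma adjoinV t a : algebraicOver j t -> adjoin t a -> adjoin t a^-1.
Proof.
move=> ht ha; have [->|a0] := eqVneq a 0.
  by rewrite invr0; exists 0; rewrite rmorph0 horner0.
have : algebraicOver j a.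
  case: ha => p ->; elim/poly_ind: p => [|p c IH].
    by rewrite rmorph0 horner0 -(rmorph0 j); exact: algebraic_id.
  rewrite rmorphD rmorphM /= map_polyX map_polyC hornerD hornerM hornerX hornerC.
  by apply: algebraic_add; [exact: algebraic_mul | exact: algebraic_id].
move=> [q]; have [n] := ubnP (size q); elim: n q => // n IH q hn q0 qa.
have [c0|c0] := eqVneq q`_0 0.
  have qE := divX_eq c0; have r0 : q %/ 'X != 0.
    by apply: contraNneq q0 => r0; rewrite qE r0 mul0r.
  apply: (IH (q %/ 'X)) => //; first by move: hn; rewrite [in size q]qE size_mulX.
  by move: qa; rewrite {1}qE rmorphM /= map_polyX rootM [X in _ || X]/root hornerX
    (negbTE a0) orbF.
have qE : q = (q - (q`_0)%:P) %/ 'X * 'X + (q`_0)%:P.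
  by rewrite -divX_eq ?subrK // coefB coefC eqxx subrr.
set r := _ %/ 'X in qE.
have -> : a^-1 = (map_poly j (- (q`_0)^-1 *: r)).[a].
  rewrite linearZ /= hornerZ; apply: (mulfI a0); rewrite divff //.
  move: qa; rewrite /root {1}qE rmorphD rmorphM /= map_polyX map_polyC hornerD
    hornerM hornerX hornerC.
  rewrite addr_eq0 => /eqP e; rewrite mulrCA [a * _]mulrC e rmorphN fmorphV mulrNN
    mulVf //.
  by rewrite fmorph_eq0.
exact: adjoin_poly.
Qed.

(** Reduced modulo q, the y i have coordinates in a space of dimension [(size q).-1], less than
    their number: a row killed by the coordinate matrix is a relation. *)
Lemma adjoin_dependent t (T : finType) (y : T -> K) q : q != 0 ->
    root (map_poly j q) t -> (forall i, adjoin t (y i)) -> (size q <= #|T|)%N ->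
  exists2 u : T -> F, exists i, u i != 0 & \sum_i j (u i) * y i = 0.
Proof.
move=> q0 qt hy hT.
have yP i : exists p, y i = (map_poly j p).[t] /\ (size p < size q)%N.
  have [p ->] := hy i; exists (p %% q); rewrite ltn_modp q0; split=> //.
  rewrite [in LHS](divp_eq p q) rmorphD rmorphM /= hornerD hornerM.
  by rewrite (eqP qt) mulr0 add0r.
pose p i := projT1 (cid (yP i)).
have pP i : y i = (map_poly j (p i)).[t] /\ (size (p i) < size q)%N := projT2 (cid
  (yP i)).
pose M : 'M[F]_(#|T|, (size q).-1) := \matrix_(i, k) (p (enum_val i))`_k.
have sq : (0 < size q)%N by rewrite size_poly_gt0.
have : kermx M != 0.
  rewrite kermx_eq0 -row_leq_rank -ltnNge; apply: leq_ltn_trans (rank_leq_col _) _.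
  by rewrite prednK.
move=> /eqP/eqP/rowV0Pn[u /sub_kermxP uM u0].
exists (fun i => u 0 (enum_rank i)).
  have /rV0Pn[i ui] : u != 0 by [].
  by exists (enum_val i); rewrite enum_valK.
rewrite (reindex (@enum_val T predT)) /=; last first.
  by exists enum_rank => i _; [exact: enum_valK | exact: enum_rankK].
transitivity (\sum_(k < (size q).-1) j ((u *m M) 0 k) * t ^+ k); last first.
  by apply: big1 => k _; rewrite uM mxE rmorph0 mul0r.
under [RHS]eq_bigr do rewrite mxE rmorph_sum mulr_suml.
rewrite exchange_big /=; apply: eq_bigr => i _; rewrite enum_valK.
have [-> sp] := pP (enum_val i).
rewrite (@horner_coef_wide _ (size q).-1); last by rewrite size_map_poly -ltnS prednK.
rewrite mulr_sumr; apply: eq_bigr => k _.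
by rewrite coef_map mxE rmorphM mulrA.
Qed.

End SimpleExtension.

(** * Finiteness of K over C(x) *)

Section FunctionFieldRank.
Variables (C K : fieldType) (iota : {rmorphism C -> K}).
Hypothesis charC : [pchar C] =i pred0.

(* K is the smallest subfield containing C and s, as an induction principle. *)
Definition field_generated_by (s : seq K) : Prop := forall S : set K,
  (forall c, S (iota c)) -> {in s, forall a, S a} ->
  (forall a b, S a -> S b -> S (a + b)) -> (forall a b, S a -> S b -> S (a * b)) ->
  (forall a, S a -> S a^-1) -> forall a, S a.

Hypothesis fg : exists s, field_generated_by s.
Hypothesis trdeg1 : exists z : K, ~ algebraicOver iota z /\
    forall a : K, exists2 P : {poly {poly C}}, P != 0 &
      root (map_poly (fun p => (map_poly iota p).[z]) P) a.

Lemma map_ev x (P : {poly {poly C}}) :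
  map_poly (ev iota x) P = (swapXY (map_poly (map_poly iota) P)).[x%:P].
Proof. by rewrite horner_swapXY -map_poly_comp. Qed.

Lemma map_ev_swap x y (P : {poly {poly C}}) :
  (map_poly (ev iota x) P).[y] = (map_poly (ev iota y) (swapXY P)).[x].
Proof. by rewrite !map_ev horner2_swapXY swapXY_map swapXYK. Qed.

Section AlgebraicOverRat.
Variables (x : K) (hx : ~ algebraicOver iota x).
Let j : {rmorphism rat_subfield iota x -> K} := rat_val iota x.

Lemma rat_coefs (P : {poly {poly C}}) :
  exists Q : {poly rat_subfield iota x}, map_poly j Q = map_poly (ev iota x) P.
Proof.
have inF (p : {poly C}) : {b | j b = ev iota x p} by exact/cid/rat_val_ev.
exists (\poly_(i < size P) (projT1 (inF P`_i))); apply/polyP => i.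
have ev0 : ev iota x 0 = 0 by rewrite /ev rmorph0 horner0.
rewrite coef_map coef_map_id0 // coef_poly; case: ltnP => h;
  first exact: projT2 (inF _).
by rewrite nth_default // rmorph0 ev0.
Qed.

(** Exchange: the relation of x over C(z), read as a polynomial in z, is nonzero since x is
    transcendental over C; so z is algebraic over C(x), and a is algebraic over C(x, z). *)
Lemma algebraic_over_rat a : algebraicOver j a.
Proof.
have [z [hz zP]] := trdeg1.
have [P P0 Px] := zP x; have [Q eQ] := rat_coefs (swapXY P).
have hzj : algebraicOver j z.
  exists Q; last by rewrite eQ /root -map_ev_swap.
  apply: contraNneq P0 => Q0; rewrite -(swapXY_eq0 P).
  move: eQ; rewrite Q0 rmorph0 => /esym/polyP e; apply/eqP/polyP => i; apply/eqP.
  have := e i; rewrite coef_map_id0 ?coef0; last by rewrite /ev rmorph0 horner0.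
  by move/eqP; rewrite ev_eq0.
have [R R0 Ra] := zP a.
have e : map_poly (map_poly j) (map_poly (map_poly (rat_const iota x)) (swapXY R)) =
    swapXY (map_poly (map_poly iota) R).
  by rewrite swapXY_map -map_poly_comp; apply: eq_map_poly => p;
    exact: (esym (map_poly_comp j (rat_const iota x) p)).
apply: (algebraic_root_polyXY _ hzj).
exists (map_poly (map_poly (rat_const iota x)) (swapXY R)); rewrite e -map_ev //.
apply: contraNneq R0 => /polyP R0; apply/eqP/polyP => i; apply/eqP.
have := R0 i; rewrite coef_map_id0 ?coef0; last by rewrite /ev rmorph0 horner0.
by move/eqP; rewrite ev_eq0.
Qed.

End AlgebraicOverRat.

Lemma function_field_rank x : ~ algebraicOver iota x -> exists N, rank_le iota x N.
Proof.
move=> hx; have [s hs] := fg; pose j := rat_val iota x.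
have [t ht st] : exists2 t, algebraicOver j t & {in s, forall a, adjoin j t a}.
  apply: finite_primitive_element; first exact: pchar_rat_subfield.
  by move=> a _; exact: algebraic_over_rat.
have all a : adjoin j t a.
  apply: (hs (adjoin j t)) => //.
  - by move=> c; exists (rat_const iota x c)%:P; rewrite map_polyC hornerC.
  - by move=> b c [p ->] [q ->]; exists (p + q); rewrite rmorphD hornerD.
  - by move=> b c [p ->] [q ->]; exists (p * q); rewrite rmorphM hornerM.
  - by move=> b; exact: adjoinV.
have [q q0 qt] := ht; exists (size q) => T y hT.
have [u [i0 ui0] su] := adjoin_dependent q0 qt (fun i => all (y i)) (ltnW hT).
have nd i : exists pq : {poly C} * {poly C},
    ev iota x pq.2 != 0 /\ j (u i) = ev iota x pq.1 / ev iota x pq.2.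
  by have [p [r h]] := rat_valE (u i); exists (p, r).
pose n i := (projT1 (cid (nd i))).1; pose d i := (projT1 (cid (nd i))).2.
have ndE i : ev iota x (d i) != 0 /\ j (u i) = ev iota x (n i) / ev iota x (d i).
  exact: projT2 (cid (nd i)).
(* Multiplication by the product of all denominators turns coefficients in C(x) into elements of
   C[x]. *)
exists (fun i => n i * \prod_(k | k != i) d k); split.
  exists i0; have ev0 : ev iota x 0 = 0 by rewrite /ev rmorph0 horner0.
  have [_ e] := ndE i0; rewrite mulf_neq0 //.
    by apply: contraNneq ui0 => n0; move: e; rewrite n0 ev0 mul0r => /eqP;
      rewrite fmorph_eq0.
  apply/prodf_neq0 => k _; have [+ _] := ndE k.
  by apply: contraNneq => ->; rewrite ev0.
transitivity ((\prod_k ev iota x (d k)) * \sum_i j (u i) * y i);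
  last by rewrite su mulr0.
rewrite mulr_sumr; apply: eq_bigr => i _; have [di ->] := ndE i.
have evp (P : pred T) : ev iota x (\prod_(k | P k) d k) = \prod_(k | P k) ev iota x
  (d k).
  by rewrite /ev rmorph_prod horner_prod.
by rewrite evM evp [in RHS](bigD1 i) //=; field.
Qed.

End FunctionFieldRank.

(** * The fan and its charts *)

Section Dot.
Variable n : nat.
Implicit Types m u : 'rV[int]_n.

Lemma dot0l u : dot 0 u = 0.
Proof. by apply: big1 => i _; rewrite mxE mul0r. Qed.

Lemma dotDl m m' u : dot (m + m') u = dot m u + dot m' u.
Proof. by rewrite -big_split; apply: eq_bigr => i _; rewrite mxE mulrDl. Qed.

Lemma dotNl m u : dot (- m) u = - dot m u.
Proof. by rewrite -sumrN; apply: eq_bigr => i _; rewrite mxE mulNr. Qed.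

Lemma dotBl m m' u : dot (m - m') u = dot m u - dot m' u.
Proof. by rewrite dotDl dotNl. Qed.

Lemma dotMnl m u k : dot (m *+ k) u = dot m u *+ k.
Proof. by elim: k => [|k IH]; rewrite ?mulr0n ?dot0l // !mulrS dotDl IH. Qed.

Lemma dot_suml I (r : seq I) (P : pred I) F u :
  dot (\sum_(i <- r | P i) F i) u = \sum_(i <- r | P i) dot (F i) u.
Proof. by elim/big_rec2: _ => [|i y1 y2 _ IH]; rewrite ?dot0l // dotDl IH. Qed.

Lemma dotZl a m u : dot (a *: m) u = a * dot m u.
Proof. by rewrite mulr_sumr; apply: eq_bigr => i _; rewrite mxE mulrA. Qed.

Lemma dotC m u : dot m u = dot u m.
Proof. by apply: eq_bigr => i _; rewrite mulrC. Qed.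

Lemma dot_delta m (i : 'I_n) : dot m (delta_mx 0 i) = m 0 i.
Proof.
rewrite /dot (bigD1 i) //= mxE !eqxx mulr1 big1 ?addr0 // => j /negbTE ji.
by rewrite mxE ji andbF mulr0.
Qed.

End Dot.

Section Fan.
Variables (beta : nat -> nat -> int) (n : nat).
Local Notation Y := (toric_limit beta n).
Local Notation g := (limit_gen beta (n := n)).

Lemma dot_gen_true m i : dot m (g (i, true)) = m 0 i.
Proof. by rewrite /limit_gen /= dot_delta. Qed.

Lemma dot_gen_false m i : dot m (g (i, false)) =
  - m 0 i - \sum_(j < n | (i < j)%N) beta i j * m 0 j.
Proof.
rewrite /limit_gen /= dotC dotBl dotNl dotC dot_delta dot_suml; congr (_ - _).
by apply: eq_bigr => j _; rewrite dotZl dotC dot_delta.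
Qed.

(* The pairing with e_i^- involves only the coordinates j >= i, so m is found
   coordinate by coordinate from the last one to the first. *)
Lemma triangular_solve (P : 'I_n -> int -> int -> Prop) :
    (forall i t, exists x, P i x (- x - t)) ->
  exists m, forall i, P i (dot m (g (i, true))) (dot m (g (i, false))).
Proof.
move=> hP.
suff h k : (k <= n)%N -> exists m, forall i : 'I_n, (k <= i)%N ->
    P i (dot m (g (i, true))) (dot m (g (i, false))).
  by have [//|m hm] := h 0%N; exists m => i; apply: hm.
move=> kn; rewrite -(subKn kn); elim: (n - k)%N (leq_subr k n) => [_|l IH ln].
  by exists 0 => i; rewrite subn0 leqNgt ltn_ord.
have [m hm] := IH (ltnW ln); have kn' : (n - l.+1 < n)%N by move: ln; lia.
pose i0 := Ordinal kn'.
have [x hx] := hP i0 (\sum_(j < n | (i0 < j)%N) beta i0 j * m 0 j).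
exists (\row_j if j == i0 then x else m 0 j) => i hi.
have e (i' : 'I_n) : (i0 <= i')%N -> \sum_(j < n | (i' < j)%N) beta i' j * (\row_j if
  j == i0 then x else m 0 j) 0 j =
    \sum_(j < n | (i' < j)%N) beta i' j * m 0 j.
  move=> h; apply: eq_bigr => j hj; rewrite mxE; case: eqP => // je.
  by move: hj; rewrite je ltnNge h.
rewrite dot_gen_true dot_gen_false e // mxE; case: eqP => [->//|ne].
rewrite -dot_gen_false -dot_gen_true; apply: hm.
move: hi ne => /= hi /eqP; rewrite -val_eqE /=; lia.
Qed.

Lemma in_cones (A : {set ray Y}) : (A \in cones Y) =
  [forall i, ~~ (((i, true) \in A) && ((i, false) \in A))].
Proof. by rewrite inE. Qed.

Lemma conesP (A : {set ray Y}) i : A \in cones Y -> (i, true) \in A -> (i, false) \in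
  A -> False.
Proof. by rewrite in_cones => /forallP/(_ i) + h1 h2; rewrite h1 h2. Qed.

Lemma cones_sub (A B : {set ray Y}) : A \subset B -> B \in cones Y -> A \in cones Y.
Proof.
move=> /fintype.subsetP AB hB; rewrite in_cones; apply/forallP => i;
  apply/negP => /andP[h1 h2].
by apply: (conesP hB (i := i)); exact: AB.
Qed.

(** This character makes the variety separated: it cuts A and B apart along their common face. By
    [triangular_solve] the conditions can be met index by index. *)
Lemma cone_separation (A B : {set ray Y}) : A \in cones Y -> B \in cones Y ->
  exists m, forall p, [/\ p \in A -> p \in B -> dot m (g p) = 0,
    p \in A -> p \notin B -> 0 < dot m (g p) & p \notin A -> p \in B -> dot m (g p) <
      0].
Proof.
move=> hA hB.
pose Q p x := [/\ p \in A -> p \in B -> x = 0,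
    p \in A -> p \notin B -> 0 < x & p \notin A -> p \in B -> x < 0 :> int].
have [|m hm] := @triangular_solve (fun i x y => Q (i, true) x /\ Q (i, false) y).
  move=> i t; rewrite /Q.
  move: (@conesP A i hA) (@conesP B i hB).
  move: ((i, true) \in A) ((i, false) \in A) ((i, true) \in B) ((i, false) \in B).
  move=> [] [] [] [] h1 h2; try by case: (h1 isT isT).
  all: try by case: (h2 isT isT).
  (* At index i the pairings are x and - x - t: the values 0 and - t annul one of them, |t| + 1
     makes the first positive and the second negative, and - |t| - 1 does the reverse. *)
  all: try by [exists 0; split; split => // _ _; lia].
  all: try by [exists (- t); split; split => // _ _; lia].
  all: try by [exists (`|t| + 1); split; split => // _ _; lia].
  all: try by [exists (- `|t| - 1); split; split => // _ _; lia].
exists m => -[i b]; have [h1 h2] := hm i; by case: b.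
Qed.

End Fan.

Lemma shift_ge0 (d x : int) (k : nat) : 0 < x -> 0 <= d + x *+ (`|d| + k)%N.
Proof.
move=> x0; have : (`|d| + k)%N%:Z <= x *+ (`|d| + k)%N.
  by rewrite pmulrn mulrzz ler_peMl // gtz0_ge1.
lia.
Qed.

(** * Torus orbits of points *)

Section TorusPart.
Variables (beta : nat -> nat -> int) (n : nat).
Local Notation Y := (toric_limit beta n).
Local Notation g := (limit_gen beta (n := n)).
Implicit Types (A B t : {set ray Y}) (m : 'rV[int]_n).

Definition perp t m : bool := [forall p in t, dot m (g p) == 0].

Lemma perpP t m : reflect (forall p, p \in t -> dot m (g p) = 0) (perp t m).
Proof.
by apply: (iffP forallP) => h p; have := h p;
  [move/implyP => + pt => /(_ pt)/eqP | move=> h'; apply/implyP => /h' ->].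
Qed.

Lemma dualP A m : reflect (forall p, p \in A -> 0 <= dot m (g p)) (dual A m).
Proof.
by apply: (iffP forallP) => h p; have := h p; [move/implyP | move=> h'; apply/implyP].
Qed.

Lemma perp0 t : perp t 0.
Proof. by apply/perpP => p _; rewrite dot0l. Qed.

Lemma perpD t m m' : perp t m -> perp t m' -> perp t (m + m').
Proof. by move=> /perpP h /perpP h'; apply/perpP => p pt;
  rewrite dotDl h // h' // addr0. Qed.

Lemma perpN t m : perp t m -> perp t (- m).
Proof. by move=> /perpP h; apply/perpP => p pt; rewrite dotNl h // oppr0. Qed.

Lemma perpB t m m' : perp t m -> perp t m' -> perp t (m - m').
Proof. by move=> h h'; apply: perpD => //; exact: perpN. Qed.

Lemma perpMn t m k : perp t m -> perp t (m *+ k).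
Proof. by move=> /perpP h; apply/perpP => p pt; rewrite dotMnl h // mul0rn. Qed.

Lemma perpS t A m : t \subset A -> perp A m -> perp t m.
Proof. by move=> /fintype.subsetP tA /perpP h; apply/perpP => p pt; apply: h;
  exact: tA. Qed.

Lemma dual0 A : dual A (0 : 'rV_n).
Proof. by apply/dualP => p _; rewrite dot0l. Qed.

Lemma dualD A m m' : dual A m -> dual A m' -> dual A (m + m').
Proof. by move=> /dualP h /dualP h'; apply/dualP => p pA;
  rewrite dotDl addr_ge0 ?h ?h'. Qed.

Lemma dualMn A m k : dual A m -> dual A (m *+ k).
Proof. by move=> /dualP h; apply/dualP => p pA; rewrite dotMnl mulrn_wge0 ?h. Qed.

Lemma dualS A B m : A \subset B -> dual B m -> dual A m.
Proof. by move=> /fintype.subsetP AB /dualP h; apply/dualP => p pA; apply: h;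
  exact: AB. Qed.

Lemma perp_dual A m : perp A m -> dual A m.
Proof. by move=> /perpP h; apply/dualP => p pA; rewrite h. Qed.

Lemma dual_perpD t A m m' : t \subset A -> dual A m -> dual A m' ->
  perp t (m + m') = perp t m && perp t m'.
Proof.
move=> /fintype.subsetP tA /dualP h /dualP h'.
apply/idP/andP => [/perpP e|[? ?]]; last exact: perpD.
split; apply/perpP => p pt; have := e _ pt; rewrite dotDl;
  have := h _ (tA _ pt); have := h' _ (tA _ pt); lia.
Qed.

(** A large multiple of M brings any character of t^perp into the dual of A; so the characters of
    t^perp are differences of regular ones. *)
Lemma dual_shift A t m M : t \subset A -> perp t m -> dual A M ->
    (forall p, p \in A -> p \notin t -> 0 < dot M (g p)) ->
  dual A (m + M *+ (\sum_p `|dot m (g p)|)%N).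
Proof.
move=> tA /perpP hm /dualP hM hpos; apply/dualP => p pA.
rewrite dotDl dotMnl; have [pt|pt] := boolP (p \in t).
  by rewrite hm // add0r mulrn_wge0 ?hM.
by rewrite (bigD1 p) //= shift_ge0 // hpos.
Qed.

Section Points.
Variable K : fieldType.
Implicit Types (x y : tpoint Y K) (e : 'rV[int]_n -> K).

Definition torus_hom t e : Prop :=
  e 0 = 1 /\ forall m m', perp t m -> perp t m' -> e (m + m') = e m * e m'.

(* The extension by 0 is a monoid morphism on the dual of any cone containing t:
   t^perp is a face of it. *)
Definition extend0 t e : 'rV[int]_n -> K := fun m => if perp t m then e m else 0.

(* x lies in the torus orbit of the cone t; e is the corresponding point of
   that torus, seen as a morphism on its group of characters. *)
Definition torus_part x t e : Prop :=
  [/\ t \subset x.1, torus_hom t e & forall m, dual x.1 m -> x.2 m = extend0 t e m].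

Lemma torus_hom_neq0 t e m : torus_hom t e -> perp t m -> e m != 0.
Proof.
move=> [e0 eD] hm; apply/negP => /eqP h; have := eD m (- m) hm (perpN hm).
by rewrite subrr e0 h mul0r => /eqP; rewrite oner_eq0.
Qed.

Lemma torus_homN t e m : torus_hom t e -> perp t m -> e (- m) = (e m)^-1.
Proof.
move=> he hm; apply: (mulfI (torus_hom_neq0 he hm)).
by rewrite divff ?(torus_hom_neq0 he) // -(proj2 he) ?perpN // subrr (proj1 he).
Qed.

Lemma torus_homMn t e m k : torus_hom t e -> perp t m -> e (m *+ k) = e m ^+ k.
Proof.
move=> [e0 eD] hm; elim: k => [|k IH]; first by rewrite mulr0n e0 expr0.
by rewrite mulrS eD ?perpMn // IH exprS.
Qed.

Lemma extend0_chart t e B : torus_hom t e -> t \subset B -> chart_point (F := Y) B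
  (extend0 t e).
Proof.
move=> [e0 eD] tB; split; first by rewrite /extend0 perp0.
move=> m m' hm hm'; rewrite /extend0 (dual_perpD tB) //.
by case: ifPn => [/andP[h h']|]; [rewrite h h' eD | case: (perp t m);
  case: (perp t m'); rewrite ?mulr0 ?mul0r].
Qed.

(** t consists of the rays whose divisor contains the point: every regular character positive on
    such a ray vanishes there. On t^perp, e is recovered from quotients of values of phi. *)
Lemma torus_part_exists x : is_point x -> exists t e, torus_part x t e.
Proof.
case: x => A phi [/= Acone [phi0 phiD]].
pose t : {set ray Y} := [set p in A | `[< forall m, dual A m -> dot m (g p) != 0 ->
  phi m = 0 >]].
have tA : t \subset A by apply/fintype.subsetP => p; rewrite inE => /andP[].
have tP m : dual A m -> phi m != 0 -> perp t m.
  move=> hm phim; apply/perpP => p; rewrite inE => /andP[pA /asboolP h].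
  by apply/eqP; apply: contraNT phim => /(h _ hm) ->.
have phiX m k : dual A m -> phi (m *+ k) = phi m ^+ k.
  move=> hm; elim: k => [|k IH]; first by rewrite mulr0n.
  by rewrite mulrS phiD ?dualMn // IH exprS.
(* Each ray of A outside t has a regular character positive on it and nonzero at the point; the sum
   M of these serves for all of them at once. *)
have [M hM [phiM posM]] : exists2 M, dual A M & phi M != 0 /\
    forall p, p \in A -> p \notin t -> 0 < dot M (g p).
  have mP p : exists m, p \in A -> p \notin t -> [/\ dual A m, dot m (g p) != 0 & phi
    m != 0].
    have [pA|] := boolP (p \in A); last by exists 0.
    have [pt|pt] := boolP (p \in t); first by exists 0.
    move: pt; rewrite inE pA /= => /asboolPn/existsNP[m /not_implyP[h1 /not_implyP[h2
      /eqP h3]]].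
    by exists m.
  pose f p := projT1 (cid (mP p)).
  have fP p : p \in A -> p \notin t -> [/\ dual A (f p), dot (f p) (g p) != 0 & phi
    (f p) != 0].
    exact: projT2 (cid (mP p)).
  have [d1 d2] : dual A (\sum_(p in A | p \notin t) f p) /\ phi (\sum_(p in A | p
    \notin t) f p) != 0.
    elim/big_rec: _ => [|p m /andP[pA pt] [h1 h2]].
      by rewrite phi0 oner_eq0 dual0.
    by have [h3 _ h5] := fP _ pA pt; rewrite dualD // phiD // mulf_neq0.
  exists (\sum_(p in A | p \notin t) f p) => //; split => // p pA pt.
  rewrite (bigD1 p) ?pA //= dotDl ltr_wpDr //.
    rewrite dot_suml sumr_ge0 // => q /andP[/andP[qA qt] _].
    by have [/dualP h _ _] := fP _ qA qt; exact: h.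
  by have [/dualP h h' _] := fP _ pA pt; rewrite lt_neqAle eq_sym h' h.
have Mperp : perp t M by apply: tP.
pose N m := (\sum_(p : ray Y) `|dot m (g p)|)%N.
pose e m := phi (m + M *+ N m) / phi M ^+ N m.
have eE m k : perp t m -> dual A (m + M *+ k) -> e m = phi (m + M *+ k) / phi M ^+ k.
  move=> hm hk; rewrite /e; have hN := dual_shift tA hm hM posM; rewrite -/(N m) in hN.
  have h : phi (m + M *+ N m) * phi M ^+ k = phi (m + M *+ k) * phi M ^+ N m.
    by rewrite -!phiX // -!phiD ?dualMn //; congr phi; rewrite addrAC.
  apply: (mulIf (expf_neq0 (N m) phiM)); rewrite divfK ?expf_neq0 //.
  by apply: (mulIf (expf_neq0 k phiM)); rewrite h mulrAC divfK ?expf_neq0 // mulrC.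
exists t, e; split=> //=.
  split; first by rewrite (eE 0 0%N) ?perp0 //= ?addr0 ?dual0 // phi0 expr0 divr1.
  move=> m m' hm hm'.
  have hN := dual_shift tA hm hM posM; have hN' := dual_shift tA hm' hM posM.
  have E : m + m' + M *+ (N m + N m') = (m + M *+ N m) + (m' + M *+ N m').
    by rewrite mulrnDr addrACA.
  rewrite (eE (m + m') (N m + N m')%N) ?perpD // E; last exact: dualD.
  by rewrite phiD // exprD /e mulf_div.
move=> m hm; rewrite /extend0; case: ifPn => [hp|hp].
  by rewrite (eE m 0%N) ?addr0 // expr0 divr1.
by apply/eqP; apply: contraNT hp; exact: tP.
Qed.

(** The separating character m0 is invertible on the chart of [A :&: B], hence nonzero at the point,
    hence orthogonal to t. Being positive on the rays of A outside B, it forces t into B; adding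
    multiples of it makes characters regular on [A :&: B] regular on A. *)
Lemma torus_part_glue x y om t e : x.1 \in cones Y -> y.1 \in cones Y ->
    torus_part x t e -> Defs.glue x y om ->
  torus_part y t e /\ forall m, dual (x.1 :&: y.1) m -> om m = extend0 t e m.
Proof.
case: x y => [A phi] [B psi] /= hA hB [/= tA he phiE] [[om0 omD] /= omA omB].
have [m0 hm0] := cone_separation hA hB.
have m0A : dual A m0.
  apply/dualP => p pA; have [h1 h2 _] := hm0 p.
  by have [/h1 ->|/h2 h] := boolP (p \in B); rewrite // ltW // h.
have m0p : perp (A :&: B) m0.
  by apply/perpP => p /setIP[pA pB]; have [h1 _ _] := hm0 p; exact: h1.
have om0n : om m0 != 0.
  apply/negP => /eqP h; have := omD m0 (- m0) (perp_dual m0p) (perp_dual (perpN m0p)).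
  by rewrite subrr om0 h mul0r => /eqP; rewrite oner_eq0.
have m0t : perp t m0.
  by move: om0n; rewrite omA // phiE // /extend0; case: ifP; rewrite ?eqxx.
have tB : t \subset B.
  apply/fintype.subsetP => p pt; have pA := fintype.subsetP tA _ pt.
  have [_ h _] := hm0 p; apply/negPn/negP => pB.
  by have := h pA pB; rewrite (perpP _ _ m0t) ?ltxx.
have tAB : t \subset A :&: B by rewrite finset.subsetI tA.
have omE m : dual (A :&: B) m -> om m = extend0 t e m.
  move=> hm; pose N := (\sum_(p : ray Y) `|dot m (g p)|)%N.
  have hs : dual A (m + m0 *+ N).
    apply/dualP => p pA; rewrite dotDl dotMnl; have [h1 h2 _] := hm0 p.
    have [pB|pB] := boolP (p \in B).
      by rewrite h1 // mul0rn addr0; move/dualP: hm; apply; rewrite inE pA.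
    by rewrite /N (bigD1 p) //= shift_ge0 // h2.
  have h0 : dual (A :&: B) (m0 *+ N) by apply: perp_dual; exact: perpMn.
  have := omD _ _ hm h0; rewrite (omA _ hs) phiE // (omA _ (dualMn N m0A)) phiE
    ?dualMn //.
  rewrite /extend0 perpMn // (dual_perpD tAB) // perpMn // andbT.
  have ne : e (m0 *+ N) != 0 by rewrite (torus_hom_neq0 he) // perpMn.
  case: ifPn => hp.
    by rewrite (proj2 he) ?perpMn // => /(mulIf ne).
  by move=> /esym/eqP; rewrite mulf_eq0 (negbTE ne) orbF => /eqP.
split=> //; split=> // m /= hm; rewrite -omB // omE //.
by apply: dualS hm; exact: finset.subsetIr.
Qed.

Lemma torus_part_glued x y t e : torus_part x t e -> torus_part y t e ->
  Defs.glue x y (extend0 t e).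
Proof.
move=> [tA he hx] [tB _ hy]; split.
- by apply: extend0_chart => //; rewrite finset.subsetI tA.
- by move=> m /hx.
- by move=> m /hy.
Qed.

Lemma torus_part_point t e B : torus_hom t e -> t \subset B -> B \in cones Y ->
  is_point (F := Y) (B, extend0 t e) /\ torus_part (B, extend0 t e) t e.
Proof. by move=> he tB hB; split; split => //=; exact: extend0_chart. Qed.

End Points.
End TorusPart.

(** * Line bundles on the toric limit *)

Section Laurent.
Variables (n : nat) (C : fieldType).
Implicit Types (f h : 'rV[int]_n -> C).

Definition monomial (c : C) (a : 'rV[int]_n) : 'rV[int]_n -> C :=
  fun m => if m == a then c else 0.

Lemma lmul_single f h a m : (forall x, x != a -> f x * h (m - x) = 0) ->
  lmul f h m = f a * h (m - a).
Proof.
move=> hx; rewrite /lmul (fsbigE [:: a]) //=; last first.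
  by move=> x _; rewrite inE; exact: hx.
by rewrite big_cons big_nil mem_set // addr0.
Qed.

Lemma lmul_monomial c d a b :
  lmul (monomial c a) (monomial d b) = monomial (c * d) (a + b).
Proof.
apply/funext => m; rewrite (@lmul_single _ _ a); last first.
  by move=> x /negbTE xa; rewrite /monomial xa mul0r.
rewrite /monomial eqxx subr_eq [b + a]addrC.
by case: eqP => // _; rewrite mulr0.
Qed.

Lemma monomial1 : @lone n C = monomial 1 0.
Proof. by apply/funext => m; rewrite /lone /monomial; case: eqP. Qed.

Lemma monomial_inj c d a b : c != 0 -> monomial c a = monomial d b -> a = b.
Proof.
move=> c0 /(congr1 (fun f => f a)); rewrite /monomial eqxx.
by case: eqP => // _ e; rewrite e eqxx in c0.
Qed.

Lemma leval_monomial (K : fieldType) (iota : {rmorphism C -> K}) phi c a :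
  c != 0 -> leval iota phi (monomial c a) = iota c * phi a.
Proof.
move=> c0; rewrite /leval (_ : [set m | _]%classic = [set a]%classic).
  by rewrite fsbig_set1 /monomial eqxx.
apply/seteqP; split=> m /=; rewrite /monomial; last by move=> ->; rewrite eqxx.
by case: (m =P a) => // _; rewrite eqxx.
Qed.

(* m -> sum_i m_i N^i, for N outside the roots of finitely many polynomials. *)
Lemma separating_form (s : seq 'rV[int]_n) : exists l : 'rV[int]_n -> int,
  (forall a b, l (a + b) = l a + l b) /\ {in s &, injective l}.
Proof.
pose P : {poly int} := \prod_(a <- s) \prod_(b <- s | a != b) rVpoly (a - b).
have P0 : P != 0.
  rewrite prodf_seq_neq0; apply/allP => a _ /=; rewrite prodf_seq_neq0.
  apply/allP => b _; apply/implyP => ab; apply: contraNneq ab => /(congr1 (poly_rV (d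
    := n))).
  by rewrite rVpolyK linear0 => /eqP; rewrite subr_eq0.
have [N hN] : exists N : nat, P.[N%:Z] != 0.
  apply: contrapT => h; pose rs := map Posz (iota 0 (size P)).
  have : all (root P) rs.
    apply/allP => _ /mapP[k _ ->]; apply/negPn/negP => hk; apply: h; by exists k.
  move=> /(max_poly_roots P0); rewrite map_inj_uniq ?iota_uniq; last by move=> a b [].
  by move=> /(_ isT); rewrite size_map size_iota ltnn.
exists (fun m => (rVpoly m).[N%:Z]); split=> [a b|a b sa sb e].
  by rewrite linearD hornerD.
apply/eqP/negPn/negP => ab; move/negP: hN; apply.
rewrite horner_prod prodf_seq_eq0; apply/hasP; exists a => //=.
rewrite horner_prod prodf_seq_eq0; apply/hasP; exists b => //=.
by rewrite ab linearB hornerD hornerN e subrr eqxx.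
Qed.

Lemma seq_argmax (T : eqType) (l : T -> int) (s : seq T) x : x \in s ->
  exists2 a, a \in s & {in s, forall b, l b <= l a}.
Proof.
elim: s x => // y s IH x _; case: s IH => [|z s] IH.
  by exists y; rewrite ?inE // => b; rewrite inE => /eqP ->.
have [|a sa ha] := IH z; first by rewrite inE eqxx.
have [h|h] := lerP (l y) (l a).
  by exists a => [|b]; rewrite inE ?sa ?orbT // => /orP[/eqP->|/ha].
exists y => [|b]; rewrite inE ?eqxx // => /orP[/eqP->//|/ha hb].
exact: le_trans hb (ltW h).
Qed.

(** Let l be additive and injective on the support s of f. The products of the l-highest terms and
    of the l-lowest terms of f and h cannot cancel, so both have exponent 0. Hence l has the same
    maximum and minimum on s, and s is one point. *)
Lemma unit_monomial f h : finite_set [set m | f m != 0]%classic ->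
    finite_set [set m | h m != 0]%classic -> lmul f h = @lone n C ->
  exists c a, c != 0 /\ f = monomial c a.
Proof.
move=> /finite_seqP[s sE] /finite_seqP[r rE] e.
have inS m : (m \in s) = (f m != 0).
  apply/idP/idP => hm.
    by have : [set` s]%classic m by []; rewrite -sE.
  by have : [set m | f m != 0]%classic m by []; rewrite sE.
have inR m : (m \in r) = (h m != 0).
  apply/idP/idP => hm.
    by have : [set` r]%classic m by []; rewrite -rE.
  by have : [set m | h m != 0]%classic m by []; rewrite rE.
have [l [lD linj]] := separating_form s.
have e1 m : lmul f h m = (m == 0)%:R by rewrite e.
have [x0 [x0s x0r]] : exists x, x \in s /\ 0 - x \in r.
  apply: contrapT => hn; have := e1 0; rewrite (@lmul_single _ _ 0) => [|x _].
    move=> h0; have : f 0 * h (0 - 0) != 0 by rewrite h0 eqxx oner_eq0.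
    by rewrite mulf_eq0 negb_or => /andP[h1 h2]; apply: hn; exists 0; rewrite inS inR.
  by apply/eqP/negPn/negP; rewrite mulf_eq0 negb_or => /andP[h1 h2]; apply: hn;
    exists x; rewrite inS inR.
have extreme (L : 'rV[int]_n -> int) a b : (forall a b, L (a + b) = L a + L b) ->
    {in s &, injective L} -> a \in s -> b \in r ->
    {in s, forall x, L x <= L a} -> {in r, forall x, L x <= L b} -> a + b = 0.
  move=> LD Linj sa rb ha hb.
  have := e1 (a + b); rewrite (@lmul_single _ _ a) => [|x xa]; last first.
    apply/eqP/negPn/negP; rewrite mulf_eq0 negb_or -inS -inR => /andP[h1 h2].
    move/negP: xa; apply; apply/eqP/Linj => //.
    have h3 : L a + L b = L x + L (a + b - x) by rewrite -!LD [x + _]addrC subrK.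
    have sq (p q u w : int) : p + q = u + w -> w <= q -> u <= p -> u = p by lia.
    exact: sq h3 (hb _ h2) (ha _ h1).
  rewrite addrC addrA addNr add0r => h0; apply/eqP/negPn/negP => /negbTE h1.
  move: h0; rewrite h1 => /eqP; rewrite mulf_eq0.
  have fa : f a != 0 by rewrite -inS.
  have hb0 : h b != 0 by rewrite -inR.
  by rewrite (negbTE fa) (negbTE hb0).
have lN x : l (- x) = - l x.
  have l0 : l 0 = 0 by have := lD 0 0; rewrite addr0; lia.
  by have := lD x (- x); rewrite subrr l0; lia.
have [a sa ha] := seq_argmax l x0s; have [b rb hb] := seq_argmax l x0r.
have [a' sa' ha'] := seq_argmax (fun x => - l x) x0s.
have [b' rb' hb'] := seq_argmax (fun x => - l x) x0r.
have ab := extreme l a b lD linj sa rb ha hb.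
have ab' : a' + b' = 0.
  apply: (extreme (fun x => - l x)) => //; first by move=> x y; rewrite lD opprD.
  by move=> x y sx sy /oppr_inj; exact: linj.
have aE x : x \in s -> x = a.
  move=> sx; apply: linj => //.
  have e2 : l a + l b = l a' + l b' by rewrite -!lD ab ab'.
  have sq (p q p' q' u : int) : p + q = p' + q' -> q' <= q -> - q <= - q' ->
    u <= p -> - u <= - p' -> u = p by lia.
  exact: sq e2 (hb _ rb') (hb' _ rb) (ha _ sx) (ha' _ sx).
exists (f a), a; split; first by rewrite -inS.
apply/funext => m; rewrite /monomial; case: (eqVneq m a) => [->//|ma].
by apply/eqP/negPn/negP; rewrite -inS => /aE/eqP; rewrite (negbTE ma).
Qed.

End Laurent.

(** * Line bundles as families of characters *)

Section LineBundle.
Variables (beta : nat -> nat -> int) (n : nat) (C : fieldType).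
Local Notation Y := (toric_limit beta n).

(** Cartier data: m_A - m_B has to be invertible on the overlap of the charts. *)
Definition compatible (m : {set ray Y} -> 'rV[int]_n) : Prop :=
  forall A B, A \in cones Y -> B \in cones Y -> perp (A :&: B) (m A - m B).

Definition transition (L : line_bundle Y C) (m : {set ray Y} -> 'rV[int]_n) : Prop :=
  forall A B, A \in cones Y -> B \in cones Y ->
    exists2 c, c != 0 & tr L A B = monomial c (m A - m B).

Lemma cone0 : finset.set0 \in cones Y.
Proof. by rewrite in_cones; apply/forallP => i; rewrite !inE. Qed.

(** The chart of the empty cone is the torus, so m_A can be read off the transition function between
    A and the torus. As transition functions and their inverses are regular on the chart of
    [A :&: B], m_A - m_B is orthogonal to that face. *)
Lemma line_bundle_transition (L : line_bundle Y C) :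
  exists2 m, compatible m & transition L m.
Proof.
have mP A B : exists m, A \in cones Y -> B \in cones Y ->
    exists2 c, c != 0 & tr L A B = monomial c m.
  have [hA|] := boolP (A \in cones Y); last by exists 0.
  have [hB|] := boolP (B \in cones Y); last by exists 0.
  have := tr_cocycle L hA hB hA; rewrite tr_id //.
  have [fin1 _] := tr_regular L hA hB; have [fin2 _] := tr_regular L hB hA.
  by move=> /(unit_monomial fin1 fin2)[c [a [c0 e]]]; exists a => _ _; exists c.
pose e A B := projT1 (cid (mP A B)).
have eP A B : A \in cones Y -> B \in cones Y ->
    exists2 c, c != 0 & tr L A B = monomial c (e A B) := projT2 (cid (mP A B)).
have eD A B D : A \in cones Y -> B \in cones Y -> D \in cones Y -> e A B + e B D = e
  A D.
  move=> hA hB hD; have [c c0 h1] := eP _ _ hA hB; have [d d0 h2] := eP _ _ hB hD.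
  have [b b0 h3] := eP _ _ hA hD; have := tr_cocycle L hA hB hD.
  by rewrite h1 h2 h3 lmul_monomial => /monomial_inj; apply; rewrite mulf_neq0.
have e0 A : A \in cones Y -> e A A = 0.
  by move=> hA; have := eD _ _ _ hA hA hA => /eqP; rewrite -subr_eq0 addrK => /eqP.
have eE A B : A \in cones Y -> B \in cones Y -> e A B = e A finset.set0 - e B
  finset.set0.
  by move=> hA hB; rewrite -(eD A B finset.set0) ?cone0 // addrK.
exists (fun A => e A finset.set0); last by move=> A B hA hB; rewrite -eE //; exact: eP.
move=> A B hA hB; rewrite -eE //.
have d A' B' : A' \in cones Y -> B' \in cones Y -> dual (A' :&: B') (e A' B').
  move=> hA' hB'; have [c c0 h] := eP _ _ hA' hB'.
  have [_ +] := tr_regular L hA' hB'; apply.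
  by rewrite h /monomial eqxx.
apply/perpP => p pAB; have /dualP/(_ p pAB) h1 := d _ _ hA hB.
have := d _ _ hB hA; rewrite finset.setIC => /dualP/(_ p pAB).
have -> : e B A = - e A B by apply/eqP; rewrite -addr_eq0 eD // e0.
by rewrite dotNl; lia.
Qed.

Lemma transition_line_bundle (m : {set ray Y} -> 'rV[int]_n) : compatible m ->
  exists L : line_bundle Y C, transition L m.
Proof.
move=> hm; pose t A B : 'rV[int]_n -> C := monomial 1 (m A - m B).
have t1 A B : A \in cones Y -> B \in cones Y -> regular (A :&: B) (t A B).
  move=> hA hB; have supp x : t A B x != 0 -> x = m A - m B.
    by rewrite /t /monomial; case: (x =P _) => // _; rewrite eqxx.
  split; last by move=> x /supp ->; apply: perp_dual; exact: hm.
  by apply: (@sub_finite_set _ _ [set m A - m B]%classic) => // x /supp ->.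
have t2 A : A \in cones Y -> t A A = @lone n C.
  by move=> _; rewrite monomial1 /t subrr.
have t3 A B D : A \in cones Y -> B \in cones Y -> D \in cones Y ->
    lmul (t A B) (t B D) = t A D.
  by move=> *; rewrite /t lmul_monomial mulr1 addrA subrK.
exists (LineBundle t1 t2 t3) => A B hA hB; exists 1 => //=; exact: oner_neq0.
Qed.

End LineBundle.

(** * Intersection numbers *)

Section Bases.
Variables (beta : nat -> nat -> int) (n : nat).
Local Notation Y := (toric_limit beta n).
Local Notation g := (limit_gen beta (n := n)).
Implicit Types (A B t : {set ray Y}) (m u : 'rV[int]_n).

(** Smoothness: one ray for each index gives a basis of the lattice. *)
Lemma dot_prescribed (s : 'I_n -> bool) (c : 'I_n -> int) :
  exists m, forall i, dot m (g (i, s i)) = c i.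
Proof.
have [|m hm] := @triangular_solve beta n (fun i x y => (if s i then x else y) = c i).
  move=> i t; case: (s i); first by exists (c i).
  by exists (- c i - t); ring.
by exists m => i; have := hm i; case: (s i).
Qed.

Lemma dot_gen_eq0 (s : 'I_n -> bool) m : (forall i, dot m (g (i, s i)) = 0) -> m = 0.
Proof.
move=> hm; suff h k (i : 'I_n) : (n - i <= k)%N -> m 0 i = 0.
  by apply/rowP => i; rewrite mxE (h n) // leq_subr.
elim: k i => [|k IH] i; first by rewrite leqn0 subn_eq0 leqNgt ltn_ord.
move=> hi; have := hm i; case: (s i); first by rewrite dot_gen_true.
rewrite dot_gen_false big1 => [|j ij]; first by rewrite subr0 => /eqP;
  rewrite oppr_eq0 => /eqP.
by rewrite IH ?mulr0 //; move: ij hi (ltn_ord j); lia.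
Qed.

(** A choice of maximal cone containing A: the ray (i, [sgn A i]) is the ray of A of index i if
    there is one, and e_i^+ by default. *)
Definition sgn A (i : 'I_n) : bool := (i, false) \notin A.

Lemma sgnP A p : A \in cones Y -> p \in A -> p = (p.1, sgn A p.1).
Proof.
case: p => i [] hA pA /=; rewrite /sgn; last by rewrite pA.
by case: (boolP ((i, false) \in A)) => // h; case: (conesP hA pA h).
Qed.

Lemma perp_basis t : t \in cones Y -> exists b : 'I_n -> 'rV[int]_n,
  (forall i j, dot (b i) (g (j, sgn t j)) = (i == j)%:R) /\
  forall m, m = \sum_i dot m (g (i, sgn t i)) *: b i.
Proof.
move=> ht; have bP i := dot_prescribed (sgn t) (fun j => (i == j)%:R).
pose b i := projT1 (cid (bP i)); exists b.
have bE i j : dot (b i) (g (j, sgn t j)) = (i == j)%:R := projT2 (cid (bP i)) j.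
split=> // m; apply/eqP; rewrite -subr_eq0; apply/eqP;
  apply: (dot_gen_eq0 (s := sgn t)) => j.
rewrite dotBl dot_suml (bigD1 j) //= dotZl bE eqxx mulr1 big1 ?addr0 ?subrr //.
by move=> i /negbTE ij; rewrite dotZl bE ij mulr0.
Qed.

(** Completeness of the star of t: u lies in a maximal cone containing t, up to coefficients of any
    sign on the rays of t. Since e_i^- has no coordinate before i, the coefficients are found from
    the first to the last, the sign of the current coordinate choosing the ray when t does not. *)
Lemma cone_decomposition t u : t \in cones Y -> exists (s : 'I_n -> bool) (c : 'I_n
  -> int),
  [/\ forall p, p \in t -> p.2 = s p.1, forall i, (i, s i) \in t \/ 0 <= c i
    & u = \sum_i c i *: g (i, s i)].
Proof.
move=> ht.
pose res k (s : 'I_n -> bool) (c : 'I_n -> int) := u - \sum_(i < n | (i < k)%N) c i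
  *: g (i, s i).
suff [s [c [h1 h2 h3]]] : exists (s : 'I_n -> bool) (c : 'I_n -> int),
    [/\ forall p, p \in t -> p.2 = s p.1, forall i, (i, s i) \in t \/ 0 <= c i
    & forall i : 'I_n, (i < n)%N -> res n s c 0 i = 0].
  exists s, c; split=> //; apply/eqP; rewrite -subr_eq0.
  have -> : u - \sum_i c i *: g (i, s i) = res n s c.
    by congr (_ - _); apply: eq_bigl => i; rewrite ltn_ord.
  by apply/eqP/rowP => i; rewrite h3 // mxE.
suff h k : (k <= n)%N -> exists (s : 'I_n -> bool) (c : 'I_n -> int),
    [/\ forall p, p \in t -> p.2 = s p.1, forall i, (i, s i) \in t \/ 0 <= c i
    & forall i : 'I_n, (i < k)%N -> res k s c 0 i = 0] by exact: h.
elim: k => [_|k IH kn].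
  exists (sgn t), (fun=> 0); split=> //; last by move=> i; right.
  by move=> p pt; rewrite [in LHS](sgnP ht pt).
have [s [c [h1 h2 h3]]] := IH (ltnW kn); pose k0 := Ordinal kn.
pose x := res k s c 0 k0.
pose b := if (k0, true) \in t then true else if (k0, false) \in t then false else 0
  <= x.
exists (fun i => if i == k0 then b else s i), (fun i => if i == k0 then (if b then x
  else - x) else c i).
split=> [p pt|i|i ik].
- case: eqP => [e|_]; last exact: h1.
  have pE := sgnP ht pt; rewrite [in LHS]pE /b /= e; move: pt; rewrite pE e /sgn.
  case: (boolP ((k0, false) \in t)) => /= [hf|hf] hp; last by rewrite hp.
  by case: ifP => // hT; case: (conesP ht hT hf).
- case: eqP => [->|_]; last exact: h2.
  rewrite /b; case: ifP => h; first by left.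
  case: ifP => h'; first by left.
  by right; case: (lerP 0 x) => h4 //; rewrite oppr_ge0 ltW.
have -> : res k.+1 (fun i => if i == k0 then b else s i)
    (fun i => if i == k0 then (if b then x else - x) else c i) =
    res k s c - (if b then x else - x) *: g (k0, b).
  rewrite /res (bigD1 k0) //= eqxx opprD addrCA addrC; congr (_ - _ - _).
  apply: eq_big => [j|j /andP[_ /negbTE ->] //].
  by rewrite -val_eqE /= ltnS; case: ltngtP.
rewrite !mxE.
have [lt|gt|e] := ltngtP i k0.
- have := h3 i lt; rewrite !mxE => ->; rewrite sub0r.
  suff -> : g (k0, b) 0 i = 0 by rewrite mulr0 oppr0.
  have ne : (i == k0) = false by apply/negbTE; rewrite -val_eqE /= neq_ltn lt.
  rewrite /limit_gen /=; case: (b); rewrite !mxE /= ne ?andbF //.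
  rewrite summxE big1 ?subr0 ?oppr0 // => j hj; rewrite !mxE /=.
  case: eqP => [e|_]; last by rewrite mulr0.
  by move: hj; rewrite -e ltnNge (ltnW lt).
- by move: ik gt; rewrite ltnS /= leqNgt => /negP.
have ei : i = k0 by exact: val_inj.
rewrite ei; have := erefl x; rewrite {1}/x !mxE => ->.
suff -> : g (k0, b) 0 k0 = if b then 1 else -1.
  by case: (b); rewrite ?mulr1 ?mulrN1 ?opprK subrr.
rewrite /limit_gen /=; case: (b); rewrite !mxE /= !eqxx //.
rewrite summxE big1 ?subr0 // => j hj; rewrite !mxE /=.
case: eqP => [e'|_]; last by rewrite mulr0.
by move: hj; rewrite -e' ltnn.
Qed.

End Bases.

(** A sum with infinite support is 0 by convention, so additivity asks for finite supports. *)
Lemma fsumD (T : choiceType) (P : set T) (f h : T -> int) :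
    finite_set [set x | P x /\ f x != 0]%classic ->
    finite_set [set x | P x /\ h x != 0]%classic ->
  \sum_(x \in P) (f x + h x) = \sum_(x \in P) f x + \sum_(x \in P) h x.
Proof.
move=> hf hh; have [r ur rE] : exists2 r : seq T, uniq r & forall x, (x \in r) <->
    ([set x | P x /\ f x != 0] `|` [set x | P x /\ h x != 0])%classic x.
  by apply: finite_set_seq; rewrite finite_setU.
have sub : ([set` r] `<=` P)%classic by move=> x /= /rE[[]|[]].
have f0 x : P x -> x \notin r -> f x = 0.
  move=> px xr; apply/eqP/negPn/negP => h0; move/negP: xr; apply; apply/rE; by left.
have h0 x : P x -> x \notin r -> h x = 0.
  move=> px xr; apply/eqP/negPn/negP => h0; move/negP: xr; apply; apply/rE; by right.
rewrite !(fsbigE r) //; first by rewrite big_split.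
by move=> x px xr; rewrite f0 // h0.
Qed.

(** * Centres of valuations on the toric variety *)

Section Centers.
Variables (beta : nat -> nat -> int) (n : nat).
Local Notation Y := (toric_limit beta n).
Local Notation g := (limit_gen beta (n := n)).
Implicit Types (A B : {set ray Y}) (m u : 'rV[int]_n).

Variables (C K : fieldType) (iota : {rmorphism C -> K}).
Variables (t : {set ray Y}) (e : 'rV[int]_n -> K).
Hypotheses (tcone : t \in cones Y) (he : torus_hom t e).

(* The centre of v lies in the chart of B. *)
Definition center (v : K -> int) B : Prop :=
  [/\ B \in cones Y, t \subset B & forall m, dual B m -> perp t m -> 0 <= v (e m)].

Lemma perpZ m a : perp t m -> perp t (a *: m).
Proof. by move=> /perpP h; apply/perpP => p pt; rewrite dotZl h // mulr0. Qed.

Section OneValuation.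
Variables (v : K -> int) (hv : valuation iota v).

Lemma val_torusD m m' : perp t m -> perp t m' -> v (e (m + m')) = v (e m) + v (e m').
Proof. by move=> h h'; rewrite (proj2 he) // (valM hv) ?(torus_hom_neq0 he). Qed.

Lemma val_torusN m : perp t m -> v (e (- m)) = - v (e m).
Proof. by move=> h; rewrite (torus_homN he) // (valV hv). Qed.

Lemma val_torusMn m k : perp t m -> v (e (m *+ k)) = v (e m) *+ k.
Proof. by move=> h; rewrite (torus_homMn k he h) (valX hv). Qed.

Lemma val_torusZ m a : perp t m -> v (e (a *: m)) = a * v (e m).
Proof.
move=> h; case: a => k.
  by rewrite -[k%:Z]natz scaler_nat val_torusMn // mulr_natl.
rewrite NegzE scaleNr val_torusN; last by rewrite -natz scaler_nat perpMn.
by rewrite -natz scaler_nat val_torusMn // mulNr mulr_natl.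
Qed.

Lemma val_torus_form : exists u, forall m, perp t m -> v (e m) = dot m u.
Proof.
have [b [bE bD]] := perp_basis tcone.
pose I i := (i, sgn t i) \notin t.
have bI i : I i -> perp t (b i).
  move=> hi; apply/perpP => p pt; rewrite (sgnP tcone pt) bE; case: eqP => // ip.
  by move: hi; rewrite /I ip -(sgnP tcone pt) pt.
exists (\sum_(i | I i) v (e (b i)) *: g (i, sgn t i)) => m hm.
rewrite dotC dot_suml {1}(bD m).
rewrite (bigID I) /= [X in _ + X]big1 ?addr0; last first.
  by move=> i /negPn hi; rewrite (perpP _ _ hm _ hi) scale0r.
suff [_ ->] : perp t (\sum_(i | I i) dot m (g (i, sgn t i)) *: b i) /\
    v (e (\sum_(i | I i) dot m (g (i, sgn t i)) *: b i)) =
    \sum_(i | I i) dot m (g (i, sgn t i)) * v (e (b i)).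
  by apply: eq_bigr => i _; rewrite dotZl mulrC [dot m _]dotC.
elim/big_rec2: _ => [|i y1 y2 hi [IH1 IH2]];
  first by rewrite perp0 (proj1 he) (val1 hv).
split; first by rewrite perpD // perpZ // bI.
by rewrite val_torusD // ?perpZ ?bI // val_torusZ ?bI // IH2.
Qed.

(** Valuative criterion of properness: on t^perp the valuation is the pairing with a vector u, and a
    maximal cone of the star of t containing u modulo the span of t is a centre. *)
Lemma center_exists : exists B, center v B.
Proof.
have [u hu] := val_torus_form; have [s [c [h1 h2 h3]]] := cone_decomposition u tcone.
exists [set p : ray Y | p.2 == s p.1]; split.
- rewrite in_cones; apply/forallP => i; rewrite !inE /=; by case: (s i).
- by apply/fintype.subsetP => p /h1 e2; rewrite inE e2.
move=> m /dualP hm /perpP hp; rewrite hu; last exact/perpP.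
rewrite dotC h3 dot_suml sumr_ge0 // => i _; rewrite dotZl dotC.
have [it|ci] := h2 i; first by rewrite hp // mulr0.
by rewrite mulr_ge0 // hm // inE.
Qed.

(** Valuative criterion of separatedness: the separating character has value 0, as it and its
    inverse are regular at v; adding multiples of it makes m and - m regular on the chart of B
    without changing their values. *)
Lemma center_unique B B' m : center v B -> center v B' -> perp (B :&: B') m -> v (e
  m) = 0.
Proof.
move=> [hB tB posB] [hB' tB' posB'] hm.
have [m0 hm0] := cone_separation hB hB'.
have tBB : t \subset B :&: B' by rewrite finset.subsetI tB.
have m0p : perp (B :&: B') m0.
  by apply/perpP => p /setIP[pA pB]; have [h1 _ _] := hm0 p; exact: h1.
have m0B : dual B m0.
  apply/dualP => p pA; have [h1 h2 _] := hm0 p.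
  by have [/h1 ->|/h2 h] := boolP (p \in B'); rewrite // ltW // h.
have m0B' : dual B' (- m0).
  apply/dualP => p pA; have [h1 _ h2] := hm0 p; rewrite dotNl oppr_ge0.
  by have [/h1 ->|/h2 h] := boolP (p \in B); rewrite // ltW // h.
have m0t := perpS tBB m0p.
have v0 : v (e m0) = 0.
  have := posB _ m0B m0t; have := posB' _ m0B' (perpN m0t); rewrite val_torusN //; lia.
have hpos p : p \in B -> p \notin B :&: B' -> 0 < dot m0 (g p).
  move=> pB; rewrite inE pB => pB'; have [_ h _] := hm0 p; exact: h.
have ge0 m' : perp (B :&: B') m' -> 0 <= v (e m').
  move=> hm'; have hs := dual_shift (finset.subsetIl B B') hm' m0B hpos.
  have ht := perpS tBB hm'.
  have := posB _ hs (perpD ht (perpMn _ m0t)).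
  by rewrite val_torusD ?perpMn // val_torusMn // v0 mul0rn addr0.
have := ge0 _ hm; have := ge0 _ (perpN hm); rewrite val_torusN ?(perpS tBB hm) //; lia.
Qed.

End OneValuation.
End Centers.

Lemma fsumZ (T : choiceType) (P : set T) (f : T -> int) (k : int) :
    finite_set [set x | P x /\ f x != 0]%classic ->
  \sum_(x \in P) (k * f x) = k * \sum_(x \in P) f x.
Proof.
move=> hf; have [r ur rE] := finite_set_seq hf.
have sub : ([set` r] `<=` P)%classic by move=> x /= /rE[].
have f0 x : P x -> x \notin r -> f x = 0.
  by move=> px xr; apply/eqP/negPn/negP => h0; move/negP: xr; apply; apply/rE.
rewrite !(fsbigE r) //; first by rewrite mulr_sumr.
by move=> x px xr; rewrite f0 // mulr0.
Qed.

Lemma fsum_gt0 (T : choiceType) (P : set T) (f : T -> int) x0 :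
    finite_set [set x | P x /\ f x != 0]%classic ->
    (forall x, P x -> 0 <= f x) -> P x0 -> 0 < f x0 -> 0 < \sum_(x \in P) f x.
Proof.
move=> hf f0 px0 fx0; have [r ur rE] := finite_set_seq hf.
have sub : ([set` r] `<=` P)%classic by move=> x /= /rE[].
have fr x : P x -> x \notin r -> f x = 0.
  by move=> px xr; apply/eqP/negPn/negP => h0; move/negP: xr; apply; apply/rE.
have x0r : x0 \in r by apply/rE; split=> //; rewrite gt_eqF.
rewrite (fsbigE r) // big_mkcond (bigD1_seq x0) //= mem_set //.
rewrite ltr_pwDl // sumr_ge0 // => x _; case: ifP => //; rewrite inE; exact: f0.
Qed.

(** * Degrees of families of characters on a curve *)

Section CurveDegree.
Variables (beta : nat -> nat -> int) (n : nat).
Local Notation Y := (toric_limit beta n).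
Local Notation g := (limit_gen beta (n := n)).
Implicit Types (A B : {set ray Y}) (m : {set ray Y} -> 'rV[int]_n).

(** Finite generation of t^perp as an induction principle; [curve_rank] applies it to a subset of K
    closed under the field operations. *)
Lemma perp_generated (t : {set ray Y}) : t \in cones Y -> exists s : seq 'rV[int]_n,
  {in s, forall x, perp t x} /\
  forall P : 'rV[int]_n -> Prop, P 0 ->
    (forall x y, perp t x -> perp t y -> P x -> P y -> P (x + y)) ->
    (forall x, perp t x -> P x -> P (- x)) -> {in s, forall x, P x} ->
    forall x, perp t x -> P x.
Proof.
move=> ht; have [b [bE bD]] := perp_basis ht.
pose I i := (i, sgn t i) \notin t.
have bI i : I i -> perp t (b i).
  move=> hi; apply/perpP => p pt; rewrite (sgnP ht pt) bE; case: eqP => // ip.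
  by move: hi; rewrite /I ip -(sgnP ht pt) pt.
exists [seq b i | i <- enum 'I_n & I i]; split.
  by move=> _ /mapP[i + ->]; rewrite mem_filter => /andP[hi _]; exact: bI.
move=> P P0 PD PN Ps x hx; have Pb i : I i -> P (b i).
  by move=> hi; apply: Ps; apply: map_f; rewrite mem_filter hi mem_enum.
rewrite (bD x) (bigID I) /= [X in _ + X]big1 ?addr0; last first.
  by move=> i /negPn hi; rewrite (perpP _ _ hx _ hi) scale0r.
suff [] : perp t (\sum_(i | I i) dot x (g (i, sgn t i)) *: b i) /\
    P (\sum_(i | I i) dot x (g (i, sgn t i)) *: b i) by [].
have Pn (k : nat) i : I i -> P (b i *+ k).
  move=> hi; elim: k => [|k IH]; first by rewrite mulr0n.
  by rewrite mulrS; apply: PD; rewrite ?perpMn ?bI //; exact: Pb.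
elim/big_rec: _ => [|i y hi [h1 h2]]; first by rewrite perp0.
have hz : perp t (dot x (g (i, sgn t i)) *: b i) by apply: perpZ; exact: bI.
split; first exact: perpD.
apply: PD => //; case: (dot _ _) => k; first by rewrite -[k%:Z]natz scaler_nat;
  exact: Pn.
rewrite NegzE scaleNr -natz scaler_nat; apply: PN; last exact: Pn.
by apply: perpMn; exact: bI.
Qed.

Variable C : closedFieldType.
Hypothesis charC : [pchar C] =i pred0.

Lemma curve_rank (Z : curve Y C) x :
  ~ algebraicOver (cincl Z) x -> exists N, rank_le (cincl Z) x N.
Proof.
apply: function_field_rank => //; last exact: cpt_trdeg1.
have [t [e [tA he eE]]] := torus_part_exists (cpt_point Z).
have [hA _] := cpt_point Z; have ht := cones_sub tA hA.
have [s [st sP]] := perp_generated ht.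
exists [seq e x | x <- s] => S Si Ss SD SM SV a.
have Se x' : perp t x' -> S (e x').
  apply: (sP (fun x => S (e x))) => [|y z hy hz Sy Sz|y hy Sy|y ys].
  - by rewrite (proj1 he) -(rmorph1 (cincl Z)).
  - by rewrite (proj2 he) //; exact: SM.
  - by rewrite (torus_homN he) //; exact: SV.
  - by apply: Ss; exact: map_f.
have S0 : S 0 by rewrite -(rmorph0 (cincl Z)).
have Sl f : regular (cpt Z).1 f -> S (leval (cincl Z) (cpt Z).2 f).
  move=> [_ hf]; rewrite /leval; apply: (big_ind S) => // y _.
  have [->|fy] := eqVneq (f y) 0; first by rewrite rmorph0 mul0r.
  apply: SM => //; rewrite eE ?hf // /extend0; case: ifP => // hy; exact: Se.
by have [f [h [rf rh _ ->]]] := cpt_residue a; apply: SM; [exact: Sl | apply: SV;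
  exact: Sl].
Qed.

Section OneCurve.
Variables (Z : curve Y C) (t : {set ray Y}) (e : 'rV[int]_n -> cfield Z).
Hypothesis hZ : torus_part (cpt Z) t e.
Local Notation val := [set v | valuation (cincl Z) v]%classic.

Let he : torus_hom t e. Proof. by case: hZ. Qed.
Let tA : t \subset (cpt Z).1. Proof. by case: hZ. Qed.
Let Acone : (cpt Z).1 \in cones Y. Proof. by case: (cpt_point Z). Qed.
Let tcone : t \in cones Y. Proof. exact: cones_sub tA Acone. Qed.

Lemma section_orderP (L : line_bundle Y C) m v k :
    compatible m -> transition L m -> valuation (cincl Z) v ->
  section_order L v k <->
  exists2 B, center t e v B & k = v (e (m B - m (cpt Z).1)).
Proof.
move=> cm tm hv.
have levalE B om : B \in cones Y -> t \subset B ->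
    (forall x, dual ((cpt Z).1 :&: B) x -> om x = extend0 t e x) ->
    v (leval (cincl Z) om (tr L B (cpt Z).1)) = v (e (m B - m (cpt Z).1)).
  move=> hB tB omE; have [c c0 ->] := tm _ _ hB Acone.
  have hp := cm _ _ hB Acone; rewrite finset.setIC in hp.
  have hpt : perp t (m B - m (cpt Z).1).
    by apply: perpS hp; rewrite finset.subsetI tA.
  rewrite leval_monomial // omE ?perp_dual // /extend0 hpt.
  by rewrite (valM hv) ?(torus_hom_neq0 he) ?fmorph_eq0 // (val_iota hv) add0r.
split=> [[B [psi [om [[/= hB hpsi] hg posB ->]]]]|[B [hB tB posB] ->]].
  have [[/= tB _ psiE] omE] := torus_part_glue (y := (B, psi)) Acone hB hZ hg.
  exists B; last by rewrite levalE.
  by split=> // x hx hp; have := posB x hx; rewrite psiE // /extend0 hp.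
exists B, (extend0 t e), (extend0 t e).
have [h1 h2] := torus_part_point he tB hB; split=> //.
- exact: torus_part_glued hZ h2.
- by move=> x hx; rewrite /extend0; case: ifP => [hp|_];
  [exact: posB | rewrite (val0 hv)].
- by rewrite levalE.
Qed.

(* Which centre is chosen does not matter, see [center_compatible]. *)
Definition cen (v : cfield Z -> int) : {set ray Y} :=
  xget finset.set0 [set B | center t e v B]%classic.

Lemma cenP v : valuation (cincl Z) v -> center t e v (cen v).
Proof.
move=> hv; rewrite /cen; case: xgetP => [B _ //|h].
by have [B hB] := center_exists tcone he hv; case: (h B).
Qed.

Lemma perp_compatible m A B : compatible m -> A \in cones Y -> B \in cones Y ->
  t \subset A -> t \subset B -> perp t (m A - m B).
Proof. by move=> cm hA hB h1 h2; apply: perpS (cm _ _ hA hB);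
  rewrite finset.subsetI h1. Qed.

Lemma center_compatible m v B : compatible m -> valuation (cincl Z) v ->
  center t e v B -> v (e (m B - m (cen v))) = 0.
Proof.
move=> cm hv hB; have hc := cenP hv; apply: (center_unique tcone he hv hB hc).
by case: hB => ? _ _; case: hc => ? _ _; exact: cm.
Qed.

Lemma section_order_val (L : line_bundle Y C) m v :
    compatible m -> transition L m -> valuation (cincl Z) v ->
  xget 0 [set k | section_order L v k]%classic = v (e (m (cen v) - m (cpt Z).1)).
Proof.
move=> cm tm hv; apply: xget_unique => /=.
  by apply/(section_orderP _ cm tm hv); exists (cen v) => //; exact: cenP.
move=> k /(section_orderP _ cm tm hv)[B hB ->].
have [hc tc _] := cenP hv; have [hBc tB _] := hB.
have -> : m B - m (cpt Z).1 = (m B - m (cen v)) + (m (cen v) - m (cpt Z).1).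
  by rewrite addrA subrK.
by rewrite [LHS](val_torusD he hv) ?perp_compatible // center_compatible // add0r.
Qed.

Definition cdeg m : int := \sum_(v \in val) v (e (m (cen v) - m t)).

Lemma cdeg_finite m A :
  finite_set [set v | val v /\ v (e (m (cen v) - m A)) != 0]%classic.
Proof.
apply: (@sub_finite_set _ _ (\bigcup_(B in [set: {set ray Y}])
  [set v | valuation (cincl Z) v /\ v (e (m B - m A)) != 0])%classic).
  by move=> v /= [hv h]; exists (cen v).
by apply: bigcup_finite => // B _; apply: finite_val; exact: curve_rank.
Qed.

(** The rational section is 1 in the chart A of the generic point; replacing m_A by m_t multiplies
    it by a rational function, whose divisor has degree 0. *)
Lemma intersectionE (L : line_bundle Y C) m : compatible m -> transition L m ->
  intersection L Z = cdeg m.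
Proof.
move=> cm tm; pose A := (cpt Z).1.
transitivity (\sum_(v \in val) v (e (m (cen v) - m A))).
  by apply: eq_fsbigr => v; rewrite inE => hv; exact: section_order_val.
have h : forall v, val v -> v (e (m (cen v) - m t)) = v (e (m (cen v) - m A)) + v (e
  (m A - m t)).
  move=> v hv; have [hc tc _] := cenP hv.
  by rewrite -(val_torusD he hv) ?perp_compatible // addrA subrK.
rewrite /cdeg [RHS](eq_fsbigr (fun v => v (e (m (cen v) - m A)) + v (e (m A - m
  t)))); last first.
  by move=> v; rewrite inE => hv; exact: h.
rewrite fsumD; first by rewrite degree_eq0 ?addr0 //; exact: curve_rank.
- exact: cdeg_finite.
- by apply: finite_val; exact: curve_rank.
Qed.

Lemma cdegD m m' : compatible m -> compatible m' ->
  cdeg (fun A => m A + m' A) = cdeg m + cdeg m'.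
Proof.
move=> cm cm'; rewrite /cdeg -fsumD; try exact: cdeg_finite.
apply: eq_fsbigr => v; rewrite inE => hv; have [hc tc _] := cenP hv.
by rewrite -(val_torusD he hv) ?perp_compatible // opprD addrACA.
Qed.

Lemma cdegZ m k : compatible m -> cdeg (fun A => k *: m A) = k * cdeg m.
Proof.
move=> cm; rewrite /cdeg -fsumZ; last exact: cdeg_finite.
apply: eq_fsbigr => v; rewrite inE => hv; have [hc tc _] := cenP hv.
by rewrite -(val_torusZ he hv) ?perp_compatible // scalerBr.
Qed.

(** At a centre B the character m_B - l and its inverse are regular, so the sum is the degree of the
    divisor of the function e(l - m_t). *)
Lemma cdeg_linear m l : (forall A, A \in cones Y -> perp A (m A - l)) -> cdeg m = 0.
Proof.
move=> hm; rewrite /cdeg.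
rewrite (eq_fsbigr (fun v : cfield Z -> int => v (e (l - m t)))); last first.
  move=> v; rewrite inE => hv; have [hc tc pos] := cenP hv.
  have h1 := hm _ hc; have h2 := hm _ tcone.
  have -> : m (cen v) - m t = (m (cen v) - l) + (l - m t) by rewrite addrA subrK.
  have h3 : perp t (l - m t) by rewrite -opprB perpN.
  have h4 := perpS tc h1.
  rewrite (val_torusD he hv) //.
  have p1 := pos _ (perp_dual h1) h4; have p2 := pos _ (perp_dual (perpN h1)) (perpN
    h4).
  move: p2; rewrite (val_torusN he hv) // oppr_ge0 => p2.
  by rewrite (_ : v (e (m (cen v) - l)) = 0) ?add0r //; apply/eqP; rewrite eq_le p2.
by rewrite degree_eq0 //; exact: curve_rank.
Qed.

Lemma compatibleD m m' : compatible m -> compatible m' -> compatible (fun A => m A +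
  m' A).
Proof.
move=> cm cm' A B hA hB; rewrite opprD addrACA; apply: perpD; first exact: cm.
exact: cm'.
Qed.

Lemma compatibleZ m k : compatible m -> compatible (fun A => k *: m A).
Proof. by move=> cm A B hA hB; rewrite -scalerBr; apply: perpZ; exact: cm. Qed.

Lemma cdeg_sum (I : finType) (c : I -> int) (M : I -> {set ray Y} -> 'rV[int]_n) :
    (forall i, compatible (M i)) ->
  compatible (fun A => \sum_i c i *: M i A) /\
  cdeg (fun A => \sum_i c i *: M i A) = \sum_i c i * cdeg (M i).
Proof.
move=> cM; elim: (index_enum I) => [|i r [IH1 IH2]].
  have -> : (fun A => \sum_(i <- [::]) c i *: M i A) = (fun=> 0).
    by apply/funext => A; rewrite big_nil.
  split; first by move=> A B _ _; rewrite subrr perp0.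
  by rewrite big_nil; apply: (@cdeg_linear _ 0) => A _; rewrite subrr perp0.
have -> : (fun A => \sum_(j <- i :: r) c j *: M j A) =
    (fun A => c i *: M i A + \sum_(j <- r) c j *: M j A).
  by apply/funext => A; rewrite big_cons.
have cMi := compatibleZ (c i) (cM i).
split; first exact: compatibleD.
by rewrite big_cons -IH2 -cdegZ // -cdegD.
Qed.

End OneCurve.
End CurveDegree.

(** * Primitive relations *)

Section Indices.
Variables (beta : nat -> nat -> int) (n : nat).
Local Notation g := (limit_gen beta (n := n)).

Lemma ohead_filter_iota (P : pred nat) m k :
  match ohead [seq l <- iota m k | P l] with
  | Some l => [/\ (m <= l < m + k)%N, P l & forall h, (m <= h < l)%N -> ~~ P h]
  | None => forall h, (m <= h < m + k)%N -> ~~ P h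
  end.
Proof.
elim: k m => [|k IH] m /=; first by move=> h; lia.
case: ifPn => Pm /=; first by split=> //; [lia | move=> h; lia].
have := IH m.+1; case: ohead => [l [h1 h2 h3]|h1].
  split=> //; first lia.
  by move=> h hh; have [->//|ne] := eqVneq h m; apply: h3; lia.
by move=> h hh; have [->//|ne] := eqVneq h m; apply: h1; lia.
Qed.

Lemma next_indexP j (P : pred nat) :
  match next_index n j P with
  | Some l => [/\ (j < l < n)%N, P l & forall h, (j < h < l)%N -> ~~ P h]
  | None => forall h, (j < h < n)%N -> ~~ P h
  end.
Proof.
have := ohead_filter_iota P j.+1 (n - j.+1); rewrite /next_index.
case: ohead => [l [h1 h2 h3]|h1]; last by move=> h hh; apply: h1; lia.
by split=> //; lia.
Qed.

Lemma indices_from_gt fuel j a l : l \in indices_from beta n fuel j a -> (j < l)%N.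
Proof.
elim: fuel j a => //= fuel IH j a; have := next_indexP j (fun l => a l < 0).
case: next_index => // k [hk _ _]; rewrite inE => /orP[/eqP->|/IH]; lia.
Qed.

(** At the first negative coefficient a_l, substitute e_l^+ = - e_l^- - sum_h beta_lh e_h^+: the
    coefficient of e_l^- is - a_l > 0 and the later a_h become - a_l beta_lh + a_h, which is the
    recursion of the algorithm. *)
Lemma indices_from_relation fuel j (a : nat -> int) : (n <= fuel + j.+1)%N ->
  exists2 c : 'I_n -> int, forall l, 0 <= c l &
    \sum_(l < n | (j < l)%N) a l *: g (l, true) =
    \sum_(l < n | (j < l)%N) c l *: g (l, nat_of_ord l \notin indices_from beta n
      fuel j a).
Proof.
elim: fuel j a => [|fuel IH] j a hf.
  have h (l : 'I_n) : (j < l)%N -> False by have := ltn_ord l; lia.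
  by exists (fun=> 0) => //; rewrite !big1 // => l /h.
rewrite /=; have := next_indexP j (fun l => a l < 0); case: next_index => [l0|h].
  move=> [hl0 al0 h]; have l0n : (l0 < n)%N by case/andP: hl0.
  pose k0 := Ordinal l0n; have [|c c0 hc] := IH l0 (fun h => - a l0 * beta l0 h + a h).
    by lia.
  set J := indices_from _ _ _ _ _ in hc *.
  (* Between j and l0 no a_l is negative; the absolute value keeps c nonnegative also at the indices
     l <= j, which the sum ignores. *)
  exists (fun l : 'I_n => if (l < l0)%N then `|a l| else if l == k0 then - a l0 else
    c l).
    by move=> l; case: ifP => // _; case: ifP => // _; move: al0; lia.
  have split_sum (F : 'I_n -> 'rV[int]_n) : \sum_(l < n | (j < l)%N) F l =
      \sum_(l < n | (j < l < l0)%N) F l + (F k0 + \sum_(l < n | (l0 < l)%N) F l).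
    rewrite (bigID (fun l : 'I_n => (l < l0)%N)) /=; congr (_ + _).
    rewrite (bigD1 k0) /= => [|]; last by move: hl0; lia.
    congr (_ + _); apply: eq_bigl => l; rewrite -val_eqE /=; lia.
  rewrite !split_sum; congr (_ + _).
    apply: eq_bigr => l /andP[jl ll]; rewrite ll ger0_norm; last first.
      by have := h l; rewrite jl ll => /(_ isT); rewrite -leNgt.
    have n1 : nat_of_ord l != l0 by move: ll; lia.
    have n2 : nat_of_ord l \notin J by apply/negP => /indices_from_gt; move: ll; lia.
    by rewrite inE negb_or n1 n2.
  rewrite ltnn eqxx [nat_of_ord k0 \in _]inE /= eqxx /=.
  have -> : \sum_(l < n | (l0 < l)%N) (if (l < l0)%N then `|a l| else
      if l == k0 then - a l0 else c l) *: g (l, nat_of_ord l \notin l0 :: J) =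
      \sum_(l < n | (l0 < l)%N) c l *: g (l, nat_of_ord l \notin J).
    apply: eq_bigr => l hl; rewrite ltnNge (ltnW hl) /= -val_eqE /= inE.
    by rewrite gtn_eqF.
  rewrite -hc [g (k0, false)]/limit_gen [g (k0, true)]/limit_gen /= scaleNr scalerBr
    scalerN opprB opprK.
  rewrite [X in _ = X + _]addrC -addrA; congr (_ + _).
  rewrite -[LHS](addrNK (a l0 *: \sum_(l < n | (l0 < l)%N) beta l0 l *: delta_mx 0
    l)) addrC; congr (_ + _).
  rewrite scaler_sumr -sumrB; apply: eq_bigr => l _.
  by rewrite /limit_gen /= scalerDl mulNr scaleNr scalerA addrC.
exists (fun l : 'I_n => `|a l|) => // ; apply: eq_bigr => l jl.
rewrite in_nil /= ger0_norm //.
by have := h l; rewrite jl ltn_ord => /(_ isT); rewrite -leNgt.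
Qed.

(** Started from - beta_ih, the coefficients of e_i^+ + e_i^-, the special step of the definition
    that finds j_2 becomes an ordinary step of the recursion. *)
Lemma tildeIE i : tildeI beta n i = i :: indices_from beta n n.+1 i (fun h => - beta
  i h).
Proof.
rewrite /tildeI /=; congr (_ :: _).
have -> : (fun l => 0 < beta i l) = (fun l => - beta i l < 0).
  by apply/funext => l; rewrite oppr_lt0.
by case: next_index => // l; congr (_ :: indices_from _ _ _ _ _); apply/funext => h;
  rewrite opprK.
Qed.

(* The primitive relation of the primitive collection {e_i^+, e_i^-}. *)
Lemma tildeI_relation (i : 'I_n) : exists2 c : 'I_n -> int, forall l, 0 <= c l &
  g (i, true) + g (i, false) =
  \sum_(l < n | (i < l)%N) c l *: g (l, nat_of_ord l \notin tildeI beta n i).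
Proof.
have [|c c0 hc] := @indices_from_relation n.+1 i (fun h => - beta i h); first by lia.
exists c => //; rewrite tildeIE.
rewrite (eq_bigr (fun l : 'I_n => c l *: g (l, nat_of_ord l \notin
   indices_from beta n n.+1 i (fun h => - beta i h)))) => [|l il]; last first.
  by rewrite inE gtn_eqF.
rewrite -hc /limit_gen /= addrA subrr add0r -sumrN.
by apply: eq_bigr => l _; rewrite scaleNr.
Qed.

Lemma tildeI_ge (i j : nat) : j \in tildeI beta n i -> (i <= j)%N.
Proof. by rewrite tildeIE inE => /orP[/eqP->//|/indices_from_gt/ltnW]. Qed.

End Indices.

(** * Support functions and their defects on the primitive relations *)

Section Relations.
Variables (beta : nat -> nat -> int) (n : nat).
Local Notation Y := (toric_limit beta n).
Local Notation g := (limit_gen beta (n := n)).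
Variables (eps : 'I_n -> 'I_n -> bool) (c : 'I_n -> 'I_n -> int).
Hypothesis c_ge0 : forall i l, 0 <= c i l.
Hypothesis rel_gen : forall i, g (i, true) + g (i, false) =
  \sum_(l < n | (i < l)%N) c i l *: g (l, eps i l).

Definition rel (a : 'I_n * bool -> int) (i : 'I_n) : int :=
  a (i, true) + a (i, false) - \sum_(l < n | (i < l)%N) c i l * a (l, eps i l).

Lemma dot_rel m i : dot m (g (i, false)) =
  \sum_(l < n | (i < l)%N) c i l * dot m (g (l, eps i l)) - dot m (g (i, true)).
Proof.
apply/eqP; rewrite eq_sym subr_eq addrC eq_sym ![dot m (g (i, _))]dotC -dotDl rel_gen
  dot_suml.
by apply/eqP/eq_bigr => l _; rewrite dotZl dotC.
Qed.

Lemma ord_down_ind (P : 'I_n -> Prop) :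
  (forall i : 'I_n, (forall l : 'I_n, (i < l)%N -> P l) -> P i) -> forall i, P i.
Proof.
move=> h i; have [k] := ubnP (n - i); elim: k i => // k IH i hk.
apply: h => l il; apply: IH; have := ltn_ord l; lia.
Qed.

(** The value at e_i^- occurs in the i-th relation with coefficient 1 and otherwise only in
    relations of smaller index, so these can be imposed from the last to the first. *)
Lemma rel_solve (r : 'I_n -> int) : exists a, forall i, rel a i = r i.
Proof.
suff h k : (k <= n)%N -> exists a, forall i : 'I_n, (k <= i)%N -> rel a i = r i.
  by have [//|a ha] := h 0%N; exists a => i; exact: ha.
move=> kn; rewrite -(subKn kn); elim: (n - k)%N (leq_subr k n) => [_|l IH ln].
  by exists (fun=> 0) => i; rewrite subn0 leqNgt ltn_ord.
have [a ha] := IH (ltnW ln); have kn' : (n - l.+1 < n)%N by move: ln; lia.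
pose k0 := Ordinal kn'.
exists (fun p => if p == (k0, false) then r k0 - rel a k0 + a (k0, false) else a p)
  => i hi.
have e : \sum_(l < n | (i < l)%N) c i l * (if (l, eps i l) == (k0, false) then r k0 -
  rel a k0 + a (k0, false) else a (l, eps i l)) =
    \sum_(l < n | (i < l)%N) c i l * a (l, eps i l).
  apply: eq_bigr => j ij; rewrite (_ : _ == _ = false) //; apply/eqP => -[e _].
  by move: ij hi; rewrite e /=; lia.
rewrite /rel e xpair_eqE andbF xpair_eqE andbT; case: eqP => [->|ne].
  by rewrite /rel; ring.
by rewrite -/(rel a i) ha //; move/eqP: ne hi; rewrite -val_eqE /=; lia.
Qed.

(** The values on the e_i^+ define a character; the relations, from the last one down, propagate the
    equality to the e_i^-. *)
Lemma rel_eq0_linear a : (forall i, rel a i = 0) -> exists m, forall p, dot m (g p) =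
  a p.
Proof.
move=> ha; pose m : 'rV[int]_n := \row_i a (i, true); exists m => -[i b].
move: i b; apply: ord_down_ind => i IH b.
have ht : dot m (g (i, true)) = a (i, true) by rewrite dot_gen_true mxE.
case: b => //; rewrite dot_rel ht.
rewrite (eq_bigr (fun l => c i l * a (l, eps i l))) => [|l il]; last by rewrite IH.
have := ha i; rewrite /rel => /eqP; rewrite subr_eq0 => /eqP <-; ring.
Qed.

(* The character with values a on the rays of a maximal cone containing A; for A
   itself the condition determines it only up to the orthogonal of A. *)
Definition family (a : 'I_n * bool -> int) (A : {set ray Y}) : 'rV[int]_n :=
  projT1 (cid (dot_prescribed beta (sgn A) (fun i => a (i, sgn A i)))).

Lemma familyE a A i : dot (family a A) (g (i, sgn A i)) = a (i, sgn A i).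
Proof. exact: projT2 (cid (dot_prescribed beta (sgn A) (fun i => a (i, sgn A i)))) i.
  Qed.

Lemma family_ray a A p : A \in cones Y -> p \in A -> dot (family a A) (g p) = a p.
Proof. by move=> hA pA; rewrite (sgnP hA pA) familyE. Qed.

Lemma family_compatible a : compatible (family a).
Proof.
move=> A B hA hB; apply/perpP => p /setIP[pA pB].
by rewrite dotBl !family_ray // subrr.
Qed.

(* Batyrev's criterion: it is enough to test convexity on primitive
   collections. *)
Lemma family_nef a : (forall i, 0 <= rel a i) -> forall A p, dot (family a A) (g p)
  <= a p.
Proof.
move=> ha A [i b]; move: i b; apply: ord_down_ind => i IH b.
have [->|] := eqVneq b (sgn A i); first by rewrite familyE.
move=> nb; have e := familyE a A i.
have h1 := dot_rel (family a A) i.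
have h2 := ha i; rewrite /rel in h2.
have h3 : \sum_(l < n | (i < l)%N) c i l * dot (family a A) (g (l, eps i l)) <=
    \sum_(l < n | (i < l)%N) c i l * a (l, eps i l).
  by apply: ler_sum => l il; apply: ler_wpM2l => //; exact: IH.
move: e nb; case: (sgn A i) => e; case: b => //= _; lia.
Qed.

Definition ray_values (m : {set ray Y} -> 'rV[int]_n) (p : 'I_n * bool) : int :=
  dot (m [set p]) (g p).

Lemma set1_cone p : [set p] \in cones Y.
Proof.
rewrite in_cones; apply/forallP => i; rewrite !inE; apply/negP => /andP[/eqP<-].
by rewrite xpair_eqE andbF.
Qed.

Lemma ray_valuesE m A p : compatible m -> A \in cones Y -> p \in A ->
  dot (m A) (g p) = ray_values m p.
Proof.
move=> cm hA pA; have /perpP/(_ p) := cm _ _ hA (set1_cone p).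
by rewrite inE pA inE eqxx dotBl => /(_ isT)/eqP; rewrite subr_eq0 => /eqP.
Qed.

Lemma rel_linear (I : finType) (k : I -> int) (b : I -> 'I_n * bool -> int) a i :
  rel (fun p => a p - \sum_j k j * b j p) i = rel a i - \sum_j k j * rel (b j) i.
Proof.
rewrite /rel.
have -> : \sum_j k j * (b j (i, true) + b j (i, false) - \sum_(l < n | (i < l)%N) c i
  l * b j (l, eps i l)) =
   \sum_j k j * b j (i, true) + \sum_j k j * b j (i, false) -
   \sum_(l < n | (i < l)%N) c i l * \sum_j k j * b j (l, eps i l).
  under [X in _ = _ - X]eq_bigr do rewrite mulr_sumr.
  rewrite exchange_big /= -big_split -sumrB /=; apply: eq_bigr => j _.
  rewrite mulrBr mulrDr; congr (_ - _); rewrite mulr_sumr; apply: eq_bigr => l _; ring.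
under [X in _ - X = _]eq_bigr do rewrite mulrBr.
rewrite sumrB; ring.
Qed.

End Relations.

(** * The curves L_I *)

Section Fibration.
Variables (beta : nat -> nat -> int) (k : nat).
Local Notation Y := (toric_limit beta k).
Local Notation Y' := (toric_limit beta k.+1).
Local Notation g := (limit_gen beta (n := k)).
Local Notation g' := (limit_gen beta (n := k.+1)).
Local Notation up p := (lift ord_max p.1, p.2).

Lemma dot_gen_max (m : 'rV[int]_k.+1) b :
  dot m (g' (ord_max, b)) = if b then m 0 ord_max else - m 0 ord_max.
Proof.
case: b; first by rewrite dot_gen_true.
rewrite dot_gen_false big1 ?subr0 // => j; rewrite ltnNge -ltnS ltn_ord //.
Qed.

Lemma restrE (m : 'rV[int]_k.+1) j : restr m 0 j = m 0 (lift ord_max j).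
Proof. by rewrite mxE. Qed.

Lemma restrD (m m' : 'rV[int]_k.+1) : restr (m + m') = restr m + restr m'.
Proof. by apply/rowP => j; rewrite !mxE. Qed.

Lemma dot_gen_lift (m : 'rV[int]_k.+1) (p : 'I_k * bool) : m 0 ord_max = 0 ->
  dot m (g' (up p)) = dot (restr m) (g p).
Proof.
case: p => i b m0; case: b; first by rewrite !dot_gen_true restrE.
rewrite !dot_gen_false restrE; congr (_ - _).
rewrite big_mkcond big_ord_recr /= m0 mulr0 if_same addr0 [RHS]big_mkcond /= /bump
  !(leqNgt k) !ltn_ord.
apply: eq_bigr => j _.
have -> : widen_ord (leqnSn k) j = lift ord_max j by apply: val_inj;
  rewrite [RHS]lift_max.
by rewrite restrE.
Qed.

Lemma extend_lift (m : 'rV[int]_k) j : extend m 0 (lift ord_max j) = m 0 j.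
Proof. by rewrite mxE liftK. Qed.

Lemma extend_max (m : 'rV[int]_k) : extend m 0 ord_max = 0.
Proof. by rewrite mxE unlift_none. Qed.

Lemma extendK (m : 'rV[int]_k) : restr (extend m) = m.
Proof. by apply/rowP => j; rewrite restrE extend_lift. Qed.

Lemma lift_cases (p : 'I_k.+1 * bool) :
  (exists b, p = (ord_max, b)) \/ exists q : 'I_k * bool, p = up q.
Proof.
case: p => i b; case: (unliftP ord_max i) => [j ->|->]; first by right; exists (j, b).
by left; exists b.
Qed.

Lemma up_inj : injective (fun p : 'I_k * bool => up p).
Proof. by move=> [i b] [j b'] h; move: (congr1 fst h) (congr1 snd h) => /=
  /lift_inj-> ->. Qed.

Lemma up_neq_max (p : 'I_k * bool) b : up p != (ord_max, b).
Proof. by rewrite xpair_eqE eq_sym (negbTE (neq_lift _ _)). Qed.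

Definition section_cone b (A : {set ray Y}) : {set ray Y'} :=
  (ord_max, b) |: [set up p | p in A].

Lemma in_section_cone_up b A p : ((up p : ray Y') \in section_cone b A) = (p \in A).
Proof.
rewrite in_setU1 (negbTE (up_neq_max _ _)) /=;
  apply/imsetP/idP => [[q qA /up_inj->]|pA] //.
by exists p.
Qed.

Lemma in_section_cone_max b b' A : ((ord_max, b') \in section_cone b A) = (b' == b).
Proof.
rewrite in_setU1 xpair_eqE eqxx /=; case: eqP => //= _.
by apply/imsetP => -[q _ h]; have := up_neq_max q b'; rewrite h eqxx.
Qed.

Lemma section_cone_cones b A : A \in cones Y -> section_cone b A \in cones Y'.
Proof.
move=> hA; rewrite in_cones; apply/forallP => i; apply/negP => /andP[].
case: (lift_cases (i, true)) => [[b' [-> _]]|[q]].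
  by rewrite !in_section_cone_max => /eqP<-.
move=> [-> _].
rewrite (in_section_cone_up b A (q.1, true)) (in_section_cone_up b A (q.1, false)).
exact: conesP.
Qed.

Lemma perp_section_cone b t m : perp (section_cone b t) m =
  (m 0 ord_max == 0) && perp t (restr m).
Proof.
apply/perpP/andP => [h|[/eqP m0 /perpP h] p].
  have m0 : m 0 ord_max = 0.
    have := h (ord_max, b); rewrite in_section_cone_max eqxx dot_gen_max => /(_ isT).
    by case: (b) => // /eqP; rewrite oppr_eq0 => /eqP.
  rewrite m0; split=> //; apply/perpP => p pt; rewrite -dot_gen_lift //.
  by apply: h; rewrite in_section_cone_up.
case: (lift_cases p) => [[b' ->] _|[q -> qt]].
  by rewrite dot_gen_max m0 oppr0 if_same.
by rewrite dot_gen_lift // h // -(in_section_cone_up b).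
Qed.

Variable K : fieldType.

(** The section identifies the orbit of t with the orbit of t enlarged by one ray: the characters of
    the latter have last coordinate 0. *)
Lemma torus_part_section b (y : tpoint Y K) t e : torus_part y t e ->
  torus_part (section_pt b y) (section_cone b t) (fun m => e (restr m)).
Proof.
move=> [tA [e0 eD] yE]; split=> /=.
- by apply: finset.setUS; exact: imsetS.
- split.
    by rewrite -e0; congr e; apply/rowP => j; rewrite !mxE.
  move=> m m'; rewrite !perp_section_cone => /andP[_ h] /andP[_ h'].
  by rewrite restrD eD.
move=> m /dualP hm; rewrite /extend0 perp_section_cone; case: eqP => //= m0.
rewrite yE //; apply/dualP => p pA; rewrite -dot_gen_lift //; apply: hm.
by rewrite -/(section_cone b y.1) in_section_cone_up.
Qed.

Definition schubert_cone : {set ray Y} := [set p | p.2].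

Lemma schubert_cone_cones : schubert_cone \in cones Y.
Proof. by rewrite in_cones; apply/forallP => i; rewrite !inE. Qed.

Lemma perp_schubert_cone m : perp schubert_cone m = (m == 0).
Proof.
apply/perpP/eqP => [h|-> p _]; last by rewrite dot0l.
by apply: (@dot_gen_eq0 beta k (fun=> true)) => i; apply: h; rewrite inE.
Qed.

Lemma torus_part_schubert : torus_part (schubert_point beta K k) schubert_cone (fun=>
  1).
Proof.
split=> //=; first by split=> // m m' _ _; rewrite mulr1.
by move=> m _; rewrite /extend0 perp_schubert_cone; case: eqP.
Qed.

Lemma proj_cones (x : tpoint Y' K) : x.1 \in cones Y' -> (Defs.proj x).1 \in cones Y.
Proof.
move=> hx; rewrite in_cones; apply/forallP => i; rewrite !inE /=.
by apply/negP => /andP[h1 h2]; exact: conesP hx h1 h2.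
Qed.

Lemma glue_sym n (F : fan n) (x y : tpoint F K) om : Defs.glue x y om -> Defs.glue y
  x om.
Proof. by move=> [h1 h2 h3]; split=> //; rewrite finset.setIC. Qed.

(** The character dual to e_j^+ vanishes at the Schubert point, so its pull-back vanishes at x.
    Among the rays of the chart of x only e_j^+ pairs nontrivially with it, so this ray is in t. *)
Lemma schubert_line_torus_part (x : tpoint Y' K) t e : x.1 \in cones Y' ->
    torus_part x t e -> same_point (Defs.proj x) (schubert_point beta K k) ->
  forall j : 'I_k, (lift ord_max j, true) \in t.
Proof.
move=> hx [tA he xE] [om hom] j.
have [[/= sub _ pE] _] := torus_part_glue (x := schubert_point beta K k)
  schubert_cone_cones (proj_cones hx)
  torus_part_schubert (glue_sym hom).
have inA (l : 'I_k) : (lift ord_max l, true) \in x.1.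
  by have := fintype.subsetP sub (l, true); rewrite !inE /=; apply.
have ninA (l : 'I_k) : (lift ord_max l, false) \notin x.1.
  by apply/negP => h; exact: conesP hx (inA l) h.
pose d : 'rV[int]_k := delta_mx 0 j.
have dd l : dot d (g (l, true)) = (l == j)%:R by rewrite dot_gen_true mxE eqxx.
have dE p : p \in x.1 -> dot (extend d) (g' p) != 0 -> p = (lift ord_max j, true).
  case: (lift_cases p) => [[b -> _]|[[l []] -> pA]].
  - by rewrite dot_gen_max extend_max oppr0 if_same eqxx.
  - rewrite dot_gen_lift ?extend_max // extendK dd.
    by case: (l =P j) => [->//|]; rewrite eqxx.
  - by have := ninA l; rewrite pA.
have dA : dual x.1 (extend d).
  apply/dualP => p pA; have [->//|h] := eqVneq (dot (extend d) (g' p)) 0.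
  by rewrite (dE _ pA h) (dot_gen_lift (j, true)) ?extend_max // extendK dd.
have dA' : dual (Defs.proj x).1 d.
  apply/dualP => -[l b]; rewrite inE /= => lA.
  case: b lA => lA; first by rewrite dd.
  by have := ninA l; rewrite lA.
have d0 : d != 0.
  by apply/negP => /eqP/rowP/(_ j); rewrite !mxE !eqxx => /eqP; rewrite oner_eq0.
have := pE d dA'; rewrite /= xE // /extend0 perp_schubert_cone (negbTE d0).
case: ifP => [hp /eqP|/negbT np _]; first by rewrite (negbTE (torus_hom_neq0 he hp)).
have [p pt hp] : exists2 p, p \in t & dot (extend d) (g' p) != 0.
  move: np; rewrite negb_forall => /existsP[p]; rewrite negb_imply => /andP[pt h].
  by exists p.
by rewrite -(dE p _ hp) //; exact: fintype.subsetP tA _ pt.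
Qed.

End Fibration.

(** * The cone attached to the generic point of L_I *)

Section Wall.
Variables (beta : nat -> nat -> int) (I : seq nat).
Local Notation i := (head 0%N I).
Hypothesis I_ge : forall j, j \in I -> (i <= j)%N.

Definition wall n : {set ray (toric_limit beta n)} :=
  [set p : 'I_n * bool | (nat_of_ord p.1 != i) && (p.2 == (nat_of_ord p.1 \notin I))].

Lemma wall_cones n : wall n \in cones (toric_limit beta n).
Proof.
rewrite in_cones; apply/forallP => j; rewrite !inE /=.
by apply/negP => /andP[/andP[_ /eqP<-] /andP[_]].
Qed.

Lemma wallS n : n != i -> wall n.+1 = section_cone (n \notin I) (wall n).
Proof.
move=> ni; apply/finset.setP => p; case: (lift_cases p) => [[b ->]|[q ->]].
  by rewrite in_section_cone_max inE /= ni.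
by rewrite in_section_cone_up !inE /= /bump leqNgt ltn_ord.
Qed.

(** Only an inclusion: that t has no further ray will follow from the transcendence degree, in
    [wall_torus_part]. *)
Lemma generic_torus_part (K : fieldType) n (x : tpoint (toric_limit beta n) K) :
  is_point x -> generic_pt_L I x -> exists t e, torus_part x t e /\ wall n \subset t.
Proof.
elim: n x => [//|k IH] x xp /=; case: eqP => [ki|/eqP ki].
  move=> hs; have [t [e ht]] := torus_part_exists xp; exists t, e; split=> //.
  have hin := schubert_line_torus_part (proj1 xp) ht hs.
  apply/fintype.subsetP => p; case: (lift_cases p) => [[b ->]|[[l b] ->]].
    by rewrite inE /= -ki eqxx.
  rewrite inE /= => /andP[_ /eqP ->]; rewrite /bump leqNgt ltn_ord /=.
  have -> : (nat_of_ord l \notin I) = true; last exact: hin.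
  by apply/negP => /I_ge; rewrite -ki leqNgt ltn_ord.
move=> [y [yp yL [om hom]]]; have [t [e [ht wt]]] := IH y yp yL.
have hsec := torus_part_section (k \notin I) ht.
have [h _] := torus_part_glue (x := section_pt (k \notin I) y) (section_cone_cones _
  (proj1 yp)) (proj1 xp) hsec (glue_sym hom).
exists (section_cone (k \notin I) t), (fun m => e (restr m)); split=> //.
by rewrite wallS //; apply: finset.setUS; exact: imsetS.
Qed.

End Wall.

Lemma fraction_surj (R : idomainType) (a : {fraction R}) :
  exists p q : R, q != 0 /\ a = tofrac p / tofrac q.
Proof.
elim/quotW: a => -[[p q] /= q0]; exists p, q; split=> //.
apply: (mulIf (x := tofrac q)); first by rewrite tofrac_eq0.
rewrite divfK ?tofrac_eq0 //; unlock FracField.tofrac; rewrite -[LHS]FracField.pi_mul.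
apply/eqP; rewrite piE /=; apply/eqP.
by rewrite /FracField.mulf !numden_Ratio ?mulr1 ?oner_eq0 ?mulf_neq0 ?oner_eq0 //=
  mulrC.
Qed.

Lemma root_linear (F : fieldType) (u v : F) : u != 0 -> root (u%:P * 'X - v%:P) (v / u).
Proof.
by move=> u0; rewrite /root hornerD hornerN hornerM !hornerC hornerX mulrC divfK ?subrr.
Qed.

(** * Existence of L_I, with function field C(X) *)

Section WallCurve.
Variables (C : fieldType) (beta : nat -> nat -> int) (I : seq nat).
Local Notation i := (head 0%N I).
Hypothesis I_ge : forall j, j \in I -> (i <= j)%N.

Let K : fieldType := {fraction {poly C}}.
Let iota : {rmorphism C -> K} := (@FracField.tofrac {poly C} : {poly C} -> K) \o polyC.
Let X : K := tofrac 'X.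

Let X0 : X != 0. Proof. by rewrite tofrac_eq0 polyX_eq0. Qed.

Let evX p : ev iota X p = tofrac p.
Proof.
rewrite evE -[in RHS](coefK p) poly_def rmorph_sum /=; apply: eq_bigr => j _.
by rewrite -mul_polyC rmorphM rmorphXn.
Qed.

(* The i-th coordinate, 0 when n <= i. *)
Definition coord n (m : 'rV[int]_n) : int := \sum_(j < n | nat_of_ord j == i) m 0 j.

Lemma coordD n (m m' : 'rV[int]_n) : coord (m + m') = coord m + coord m'.
Proof. by rewrite -big_split; apply: eq_bigr => j _; rewrite mxE. Qed.

Lemma coordE n (i0 : 'I_n) (m : 'rV[int]_n) : nat_of_ord i0 = i -> coord m = m 0 i0.
Proof.
by move=> e; rewrite /coord (big_pred1 i0) // => j; rewrite -e.
Qed.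

(** The i-th coordinate becomes the exponent of X, a generic point of a one-dimensional torus. For n
    <= i the morphism is trivial, so one formula serves for all n. *)
Let e n : 'rV[int]_n -> K := fun m => X ^ coord m.

Lemma e_hom n (t : {set ray (toric_limit beta n)}) : torus_hom t (@e n).
Proof.
split=> [|m m' _ _]; last by rewrite /e coordD expfzDr ?X0.
by rewrite /e /coord big1 // => j _; rewrite mxE.
Qed.

Definition wall_pt n : tpoint (toric_limit beta n) K := (wall beta I n, extend0 (wall
  beta I n) (@e n)).

Lemma wall_pt_part n : is_point (wall_pt n) /\ torus_part (wall_pt n) (wall beta I n)
  (@e n).
Proof.
by apply: torus_part_point (wall_cones _ _ _); [exact: e_hom | exact: subxx].
Qed.

Lemma coord_restr k (m : 'rV[int]_k.+1) : k != i -> coord (restr m) = coord m.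
Proof.
move=> ki; rewrite /coord big_mkcond [RHS]big_mkcond [RHS]big_ord_recr /= (negbTE ki)
  addr0.
apply: eq_bigr => j _; rewrite restrE.
by have -> : widen_ord (leqnSn k) j = lift ord_max j by apply: val_inj;
  rewrite [RHS]lift_max.
Qed.

Lemma coord_extend (m : 'rV[int]_i) : coord (extend m) = 0.
Proof.
rewrite (@coordE _ ord_max) //; exact: extend_max.
Qed.

Lemma lift_in_wall (l : 'I_i) b : ((lift ord_max l, b) \in wall beta I i.+1) = b.
Proof.
rewrite inE /= /bump leqNgt ltn_ord /= neq_ltn ltn_ord /=.
have -> : (nat_of_ord l \notin I) = true; last by case: b.
by apply/negP => /I_ge; rewrite leqNgt ltn_ord.
Qed.

Lemma generic_pt_wall n : (i < n)%N -> generic_pt_L I (wall_pt n).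
Proof.
elim: n => // k IH ik /=; case: eqP => [ki|/eqP ki].
  (* Characters pulled back from below have i-th coordinate 0, where [e] is 1: the image is the
     Schubert point. *)
  have h : torus_part (Defs.proj (wall_pt k.+1)) (schubert_cone beta k) (fun=> 1).
    rewrite {}ki {k IH ik}; split.
    - by apply/fintype.subsetP => -[l b]; rewrite inE => /= hb;
      rewrite inE lift_in_wall.
    - by split=> // *; rewrite mulr1.
    move=> m _ /=; rewrite /extend0 perp_schubert_cone.
    have -> : perp (wall beta I i.+1) (extend m) = (m == 0).
      apply/perpP/eqP => [h|-> p _].
        apply/rowP => j; rewrite mxE -(extend_lift m j) -(dot_gen_true beta).
        by apply: h; rewrite lift_in_wall.
      have -> : extend (0 : 'rV[int]_i) = 0; last by rewrite dot0l.
      by apply/rowP => j; rewrite !mxE; case: (unliftP ord_max j) => [l|] _ //=;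
        rewrite mxE.
    by rewrite /e coord_extend.
  by exists (extend0 (schubert_cone beta k) (fun=> 1));
    exact: torus_part_glued h (torus_part_schubert _ _ _).
have [yp yt] := wall_pt_part k.
exists (wall_pt k); split => //; first by apply: IH; rewrite ltn_neqAle eq_sym ki -ltnS.
have [xp xt] := wall_pt_part k.+1.
exists (extend0 (wall beta I k.+1) (@e k.+1)); apply: torus_part_glued xt _.
have := torus_part_section (k \notin I) yt; rewrite -wallS //.
have -> // : (fun m => e (restr m)) = @e k.+1.
by apply/funext => m; rewrite /e coord_restr.
Qed.

Variable r : nat.
Hypothesis ir : (i < r)%N.
Let i0 : 'I_r := Ordinal ir.

Lemma wall_generator : exists2 m0 : 'rV[int]_r, perp (wall beta I r) m0 & coord m0 = 1.
Proof.
have [m hm] := dot_prescribed beta (fun j : 'I_r => (j == i0) || (nat_of_ord j \notin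
  I))
  (fun j => (j == i0)%:R).
exists m; last by have := hm i0; rewrite eqxx /= dot_gen_true (coordE (i0 := i0)).
apply/perpP => -[j b]; rewrite inE /= => /andP[ji /eqP ->].
have ne : (j == i0) = false by apply/negbTE; rewrite -val_eqE.
by have := hm j; rewrite ne.
Qed.

(** Replacing X^k by the character k m0, on which e takes the value X^k, lifts every polynomial to a
    regular function; so the residue field is all of C(X). *)
Lemma wall_leval (P : {poly C}) : exists2 f, regular (wall_pt r).1 f &
  leval iota (wall_pt r).2 f = tofrac P.
Proof.
have [m0 hp hc] := wall_generator.
pose f (m : 'rV[int]_r) : C := if m == m0 *+ `|coord m| then P`_(`|coord m|) else 0.
have cX k : coord (m0 *+ k) = k%:Z.
  elim: k => [|k IH]; first by rewrite mulr0n /coord big1 // => j _; rewrite mxE.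
  by rewrite mulrS coordD IH hc.
have fX k : f (m0 *+ k) = P`_k by rewrite /f cX eqxx.
have supp m : f m != 0 -> exists2 k, (k < size P)%N & m = m0 *+ k.
  rewrite /f; case: (m =P _) => [e0|_]; last by rewrite eqxx.
  move=> h; exists `|coord m|%N => //; rewrite ltnNge; apply: contraNN h => h.
  by rewrite nth_default.
pose s := [seq m0 *+ k | k <- seq.iota 0 (size P)].
have us : uniq s.
  rewrite map_inj_uniq ?iota_uniq // => k l h.
  by have := cX k; rewrite h cX => -[].
exists f; first split.
- apply: (@sub_finite_set _ _ [set` s]%classic) => // m /supp[k hk ->] /=.
  by apply: map_f; rewrite mem_iota.
- by move=> m /supp[k _ ->]; apply: perp_dual; exact: perpMn.
rewrite /leval (fsbig_fwiden s) //; first last.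
- by move=> m [_ /= /negP/negPn/eqP ->]; rewrite rmorph0 mul0r.
- move=> m /supp[k hk ->] /=; by apply: map_f; rewrite mem_iota.
rewrite big_map -[in RHS](coefK P) poly_def rmorph_sum -[X in seq.iota X _]/(0%N).
rewrite -{1}[size P]subn0 -/(index_iota 0 (size P)) big_mkord.
apply: eq_bigr => k _; rewrite fX /= /extend0 perpMn // /e cX.
by rewrite -mul_polyC [RHS]rmorphM rmorphXn.
Qed.

Lemma wall_curve : exists Z : curve (toric_limit beta r) C, is_L I Z.
Proof.
have res a : exists f g, [/\ regular (wall_pt r).1 f, regular (wall_pt r).1 g,
    leval iota (wall_pt r).2 g != 0 & a = leval iota (wall_pt r).2 f / leval iota
      (wall_pt r).2 g].
  have [p [q [q0 ->]]] := fraction_surj a.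
  have [f rf fE] := wall_leval p; have [g rg gE] := wall_leval q.
  by exists f, g; rewrite fE gE tofrac_eq0.
have tr : exists z : K, ~ algebraicOver iota z /\ forall a : K,
    exists2 P : {poly {poly C}}, P != 0 & root (map_poly (fun p => (map_poly iota
      p).[z]) P) a.
  exists X; split.
    move=> [p p0]; rewrite /root -/(ev iota X p) evX tofrac_eq0; exact/negP.
  move=> a; have [p [q [q0 ->]]] := fraction_surj a.
  exists (q%:P * 'X - p%:P).
    apply: contraNneq q0 => /(congr1 (fun P : {poly {poly C}} => P`_1)).
    by rewrite coefB coefMX coefC coefC /= subr0 coef0 => ->.
  have -> : map_poly (fun p => (map_poly iota p).[X]) (q%:P * 'X - p%:P) =
      (tofrac q)%:P * 'X - (tofrac p)%:P.
    rewrite [X in map_poly X _](_ : _ = @FracField.tofrac {poly C}); last first.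
      by apply/funext => p'; exact: evX.
    by rewrite rmorphB rmorphM /= map_polyX !map_polyC.
  by apply: root_linear; rewrite tofrac_eq0.
exists (Curve (proj1 (wall_pt_part r)) res tr).
exact: generic_pt_wall.
Qed.

End WallCurve.

(** * The Mori cone *)

Section Dual.
Variables (beta : nat -> nat -> int) (n : nat).
Local Notation Y := (toric_limit beta n).
Local Notation g := (limit_gen beta (n := n)).
Variable C : closedFieldType.
Hypothesis charC : [pchar C] =i pred0.

Let eps (i l : 'I_n) : bool := nat_of_ord l \notin tildeI beta n i.
Variable c : 'I_n -> 'I_n -> int.
Hypothesis c_ge0 : forall i l, 0 <= c i l.
Hypothesis rel_gen : forall i, g (i, true) + g (i, false) =
  \sum_(l < n | (i < l)%N) c i l *: g (l, eps i l).
Local Notation rel := (rel eps c).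

Lemma family_sgn (a : 'I_n * bool -> int) (A B : {set ray Y}) : sgn A =1 sgn B ->
  family a A = family a B.
Proof. by move=> /funext e; rewrite /family e. Qed.

(** At a centre B, convexity puts m_B - m_t into the dual of B, so that all terms of the degree are
    nonnegative. *)
Lemma intersection_nef (L : line_bundle Y C) a (Z : curve Y C) :
  transition L (family a) -> (forall i, 0 <= rel a i) -> 0 <= intersection L Z.
Proof.
move=> tL ha; have [t [e hZ]] := torus_part_exists (cpt_point Z).
rewrite (intersectionE charC hZ (family_compatible a) tL) fsumr_ge0 // => v hv.
have [hB tB pos] := cenP hZ hv.
have tcone : t \in cones Y := cones_sub tB hB.
apply: pos; last by apply: perp_compatible => //; exact: family_compatible.
apply/dualP => p pB; rewrite dotBl family_ray // subr_ge0.
exact: family_nef c_ge0 rel_gen _ ha _ _.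
Qed.

(** The coefficients rho depend on L only, so the values on the [Lb j] determine a class in N_1. *)
Lemma intersection_decomposition (b : 'I_n -> 'I_n * bool -> int) (Lb : 'I_n ->
  line_bundle Y C) :
    (forall j, transition (Lb j) (family (b j))) ->
    (forall j i, rel (b j) i = (i == j)%:R) ->
  forall L : line_bundle Y C, exists rho : 'I_n -> int, forall Z : curve Y C,
    intersection L Z = \sum_j rho j * intersection (Lb j) Z.
Proof.
move=> tb hb L; have [m cm tm] := line_bundle_transition L.
pose rho j := rel (ray_values m) j; exists rho => Z.
have [t [e hZ]] := torus_part_exists (cpt_point Z).
rewrite (intersectionE charC hZ cm tm).
under eq_bigr do rewrite (intersectionE charC hZ (family_compatible (b _)) (tb _)).
have [cS <-] := cdeg_sum charC hZ rho (fun j => family_compatible (b j)).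
set S := (fun A => _) in cS *.
have cD := compatibleD cm (compatibleZ (-1) cS).
suff : cdeg t e (fun A => m A + (-1) *: S A) = 0.
  rewrite (cdegD charC hZ) // ?(cdegZ charC hZ) //; last exact: compatibleZ.
  by rewrite mulN1r => /eqP; rewrite subr_eq0 => /eqP.
have [|l hl] := @rel_eq0_linear _ _ eps c rel_gen
    (fun p => ray_values m p - \sum_j rho j * b j p).
  move=> i; rewrite rel_linear (bigD1 i) //= hb eqxx mulr1 big1 ?addr0 ?subrr // => j
    /negbTE ji.
  by rewrite hb eq_sym ji mulr0.
apply: (cdeg_linear charC hZ (l := l)) => A hA; apply/perpP => p pA.
rewrite dotBl hl dotDl dotZl mulN1r (ray_valuesE cm hA pA) dot_suml.
rewrite (eq_bigr (fun j => rho j * b j p)) ?subrr // => j _.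
by rewrite dotZl family_ray.
Qed.

Section WallCurve.
Variables (i : 'I_n) (Z : curve Y C).
Hypothesis hL : is_L (tildeI beta n i) Z.
Let W : {set ray Y} := wall beta (tildeI beta n i) n.

(** K is generated by C and the values e m, so if these were algebraic over C, all of K would be. *)
Lemma curve_nonconstant t e : torus_part (cpt Z) t e ->
  ~ (forall m, perp t m -> algebraicOver (cincl Z) (e m)).
Proof.
move=> [tA he eE] hm; have [z [hz _]] := cpt_trdeg1 Z; apply: hz.
have alg f : regular (cpt Z).1 f -> algebraicOver (cincl Z) (leval (cincl Z) (cpt
  Z).2 f).
  have a0 : algebraicOver (cincl Z) 0 by rewrite -(rmorph0 (cincl Z));
    exact: algebraic_id.
  move=> [_ hf]; rewrite /leval; apply: (big_ind (algebraicOver (cincl Z))) => //.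
    by move=> *; exact: algebraic_add.
  move=> y _; have [->|fy] := eqVneq (f y) 0; first by rewrite rmorph0 mul0r.
  apply: algebraic_mul; first exact: algebraic_id.
  by rewrite eE ?hf // /extend0; case: ifP => // /hm.
by have [f [h [rf rh _ ->]]] := cpt_residue z; apply: algebraic_div; exact: alg.
Qed.

Lemma in_wall (j : 'I_n) b : ((j, b) \in W) = (j != i) && (b == eps i j).
Proof. by rewrite inE. Qed.

(** A ray of t outside W would have index i and make t a maximal cone; then t^perp = 0 and e takes
    only the value 1 there. *)
Lemma wall_torus_part : exists e, torus_part (cpt Z) W e.
Proof.
have Wge j : j \in tildeI beta n i -> (head 0%N (tildeI beta n i) <= j)%N.
  by move=> /tildeI_ge.
have [t [e [ht Wt]]] := generic_torus_part Wge (cpt_point Z) hL.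
suff -> : W = t by exists e.
apply/eqP; rewrite finset.eqEsubset Wt /=; apply/fintype.subsetP => -[j b] pt.
have [tA he _] := ht; have tcone := cones_sub tA (proj1 (cpt_point Z)).
have [ji|ji] := eqVneq j i; last first.
  have jW : (j, eps i j) \in W by rewrite in_wall ji eqxx.
  by rewrite (sgnP tcone pt) -(sgnP tcone (fintype.subsetP Wt _ jW)).
case: (curve_nonconstant ht) => m /perpP hm.
suff -> : m = 0.
  by rewrite (proj1 he) -(rmorph1 (cincl Z)); exact: algebraic_id.
apply: (@dot_gen_eq0 beta n (sgn t)) => l; apply: hm.
have [->|li] := eqVneq l i; first by rewrite -ji -(sgnP tcone pt).
have lW : (l, eps i l) \in W by rewrite in_wall li eqxx.
have lt := fintype.subsetP Wt _ lW.
by rewrite -(sgnP tcone lt).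
Qed.

Variables (L : line_bundle Y C) (a : 'I_n * bool -> int).
Hypothesis tL : transition L (family a).

(** One of the two maximal cones containing W; for the other one, which has e_i^+, [family] chooses
    the same character as for W, by the default in [sgn]. So D below is the only nontrivial
    transition along the curve. *)
Let B : {set ray Y} := (i, false) |: W.

Let Bcone : B \in cones Y.
Proof.
rewrite in_cones; apply/forallP => j; rewrite !in_setU1 !in_wall !xpair_eqE andbF
  andbT /=.
by case: eqP => //= _; case: eps.
Qed.

Let Wcone : W \in cones Y. Proof. exact: wall_cones. Qed.

Let WB : W \subset B. Proof. exact: finset.subsetUr. Qed.

Let D := family a B - family a W.

Let perpD' : perp W D.
Proof. by apply: perpS (family_compatible a Bcone Wcone);
  rewrite finset.subsetI WB subxx. Qed.

Let dotD : dot D (g (i, false)) = rel a i.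
Proof.
rewrite dotBl family_ray // ?in_setU1 ?eqxx // (dot_rel rel_gen).
have -> : dot (family a W) (g (i, true)) = a (i, true).
  have := familyE a W i.
  by rewrite /sgn in_wall eqxx.
rewrite (eq_bigr (fun l => c i l * a (l, eps i l))) => [|l il].
  by rewrite /rel; ring.
by rewrite family_ray // in_wall eqxx andbT -val_eqE /= gtn_eqF.
Qed.

Let perpW_eq0 m : perp W m -> dot m (g (i, false)) = 0 -> m = 0.
Proof.
move=> /perpP hm h0; apply: (@dot_gen_eq0 beta n (fun j => if j == i then false else
  eps i j)) => j.
case: eqP => [->//|/eqP ji]; apply: hm; by rewrite in_wall ji eqxx.
Qed.

Let family_star A : A \in cones Y -> W \subset A ->
  family a A - family a W = if (i, false) \in A then D else 0.
Proof.
move=> hA WA.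
have sA j : j != i -> sgn A j = eps i j.
  move=> ji; have jW : (j, eps i j) \in W by rewrite in_wall ji eqxx.
  by have [] := sgnP hA (fintype.subsetP WA _ jW).
have sW j : j != i -> sgn W j = eps i j.
  by move=> ji; rewrite /sgn in_wall ji /=; case: (eps i j).
have sB j : j != i -> sgn B j = eps i j.
  by move=> ji; rewrite /sgn in_setU1 xpair_eqE (negbTE ji) /= in_wall ji /=;
    case: (eps i j).
case: ifP => hi.
  congr (_ - _); apply: family_sgn => j; have [->|ji] := eqVneq j i;
    last by rewrite sA // sB.
  by rewrite /sgn hi in_setU1 eqxx.
rewrite (@family_sgn a A W) ?subrr // => j; have [->|ji] := eqVneq j i;
  last by rewrite sA // sW.
by rewrite /sgn hi in_wall eqxx.
Qed.

Lemma intersection_wall_eq0 : rel a i = 0 -> intersection L Z = 0.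
Proof.
move=> ra; have [e hZ] := wall_torus_part.
have D0 : D = 0 by apply: perpW_eq0 => //; rewrite dotD.
rewrite (intersectionE charC hZ (family_compatible a) tL); apply: fsbig1 => v hv.
have [hB tB _] := cenP hZ hv; rewrite family_star // D0 if_same.
by have [_ [-> _] _] := hZ; rewrite (val1 hv).
Qed.

(** D generates W^perp, so e D is transcendental and has a zero v; v has centre B and contributes a
    positive value. The other terms are 0, or nonnegative because D is regular at centres containing
    e_i^-. Positivity is enough, since a ray ignores positive factors. *)
Lemma intersection_wall_gt0 : rel a i = 1 -> 0 < intersection L Z.
Proof.
move=> ra; have [e hZ] := wall_torus_part; have [_ he _] := hZ.
have mE m : perp W m -> m = dot m (g (i, false)) *: D.
  move=> hm; apply/eqP; rewrite -subr_eq0; apply/eqP/perpW_eq0.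
    by apply: perpB => //; exact: perpZ.
  by rewrite dotBl dotZl dotD ra mulr1 subrr.
have eX k : e (D *+ k) = e D ^+ k by rewrite (torus_homMn k he).
have trX : ~ algebraicOver (cincl Z) (e D).
  move=> ha; apply: (curve_nonconstant hZ) => m hm; rewrite (mE m hm).
  have algX k : algebraicOver (cincl Z) (e (D *+ k)).
    rewrite eX; elim: k => [|k IH]; last by rewrite exprS; exact: algebraic_mul.
    by rewrite expr0 -(rmorph1 (cincl Z)); exact: algebraic_id.
  case: (dot _ _) => k; first by rewrite -[k%:Z]natz scaler_nat.
  rewrite NegzE scaleNr -natz scaler_nat (torus_homN he) ?perpMn //.
  exact: algebraic_inv.
have [N hN] := curve_rank charC trX; have [v hv vD] := exists_zero trX hN.
rewrite (intersectionE charC hZ (family_compatible a) tL).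
have vE w : valuation (cincl Z) w -> w (e (family a (cen W e w) - family a W)) =
    if (i, false) \in cen W e w then w (e D) else 0.
  move=> hw; have [hB tB _] := cenP hZ hw; rewrite family_star //; case: ifP => // _.
  by rewrite (proj1 he) (val1 hw).
have hcB : center W e v B.
  split=> // m /dualP hm hp; rewrite (mE m hp) (val_torusZ he hv) //.
  by rewrite mulr_ge0 // ?(ltW vD) // hm // in_setU1 eqxx.
apply: (fsum_gt0 (x0 := v)) => [|||]; first exact: (cdeg_finite charC W e (family a) W).
- move=> w hw; rewrite vE //; case: ifP => // hi.
  have [hB tB pos] := cenP hZ hw; apply: pos => //; apply/dualP => -[j b] pB.
  have [ji|ji] := eqVneq j i.
    by rewrite ji (_ : b = false) ?dotD ?ra //; move: pB; rewrite ji;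
      case: b => // /(conesP hB)/(_ hi).
  have jW : (j, eps i j) \in W by rewrite in_wall ji eqxx.
  have [e2] := sgnP hB (fintype.subsetP tB _ jW); have [e1] := sgnP hB pB.
  by rewrite e1 -e2 (perpP _ _ perpD').
- exact: hv.
(* The chosen centre of v may differ from B; by compatibility this does not change the value. *)
have h := center_compatible hZ (family_compatible a) hv hcB.
have [hB tB _] := cenP hZ hv.
have DE : D = (family a B - family a (cen W e v)) + (family a (cen W e v) - family a W).
  by rewrite addrA subrK.
by move: vD; rewrite {1}DE (val_torusD he hv) ?h ?add0r //;
  apply: perp_compatible => //; exact: family_compatible.
Qed.

End WallCurve.
End Dual.

(** * The extremal rays *)

Section Mori.
Variables (R : realType) (C : closedFieldType) (beta : nat -> nat -> int) (n : nat).
Hypothesis charC : [pchar C] =i pred0.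
Local Notation Y := (toric_limit beta n).
Local Notation V := (line_bundle Y C -> R).
Local Notation mori := (mori_cone (F := Y) (C := C) (R := R)).

Lemma cycle_classE (z : one_cycle Y C R) (L : line_bundle Y C) :
  cycle_class z L = \sum_(p <- z) p.1 * (intersection L p.2)%:~R.
Proof. by []. Qed.

Lemma effective_mori (z : one_cycle Y C R) :
  all (fun p => 0 <= p.1) z -> mori (cycle_class z).
Proof.
move=> hz; split; first by exists z.
by apply: subset_closure; exists z.
Qed.

(** The inequality holds on effective classes and is closed, evaluation at L being continuous for
    pointwise convergence. *)
Lemma mori_ge0 (c : V) (L : line_bundle Y C) :
  (forall Z : curve Y C, 0 <= intersection L Z) -> mori c -> 0 <= c L.
Proof.
move=> hL [_]; pose A : set {ptws line_bundle Y C -> R} := [set f | 0 <= f L]%classic.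
have cA : closed A.
  apply: (@preimage_closed _ _ (fun f : {ptws line_bundle Y C -> R} => f L)
    [set x | 0 <= x]%classic).
    by move=> f _; exact: (@proj_continuous {classic line_bundle Y C} (fun=> R) L f).
  exact: closed_ge.
move=> hc; suff : A c by [].
rewrite ((closure_id A).1 cA); apply: closure_subset hc => _ [z hz ->] /=.
rewrite /A /= cycle_classE; elim: z hz => [|p z IH] /=; first by rewrite big_nil.
by move=> /andP[p0 /IH hz]; rewrite big_cons addr_ge0 // mulr_ge0 // ler0z.
Qed.

Lemma class_ofE (Z : curve Y C) L : class_of R Z L = (intersection L Z)%:~R.
Proof. by rewrite /class_of cycle_classE big_seq1 mul1r. Qed.

Theorem toric_limit_extremal_rays (Q : set V) : extremal_ray mori Q <->
  exists (i : 'I_n) (Z : curve Y C),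
    is_L (tildeI beta n i) Z /\ Q = ray_through (class_of R Z).
Proof.
pose eps (i l : 'I_n) : bool := nat_of_ord l \notin tildeI beta n i.
have relP (i : 'I_n) : exists c : 'I_n -> int, (forall l, 0 <= c l) /\
    limit_gen beta (i, true) + limit_gen beta (i, false) =
    \sum_(l < n | (i < l)%N) c l *: limit_gen beta (l, eps i l).
  by have [c c0 h] := tildeI_relation beta i; exists c.
pose c i := projT1 (cid (relP i)).
have c_ge0 i : forall l, 0 <= c i l by case: (projT2 (cid (relP i))).
have rel_gen i : limit_gen beta (i, true) + limit_gen beta (i, false) =
    \sum_(l < n | (i < l)%N) c i l *: limit_gen beta (l, eps i l).
  by case: (projT2 (cid (relP i))).
have bP (j : 'I_n) := rel_solve eps c (fun i => (i == j)%:R).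
pose b j := projT1 (cid (bP j)).
have hb j i : rel eps c (b j) i = (i == j)%:R := projT2 (cid (bP j)) i.
have LP j := transition_line_bundle C (family_compatible (beta := beta) (b j)).
pose Lb j := projT1 (cid (LP j)).
have hLb j : transition (Lb j) (family (b j)) := projT2 (cid (LP j)).
have ZP (i : 'I_n) : exists Z : curve Y C, is_L (tildeI beta n i) Z.
  by apply: wall_curve; [exact: tildeI_ge | exact: ltn_ord].
pose Zc i := projT1 (cid (ZP i)).
have hZc (i : 'I_n) : is_L (tildeI beta n i) (Zc i) := projT2 (cid (ZP i)).
have nef j (Z : curve Y C) : 0 <= intersection (Lb j) Z.
  by apply: (intersection_nef charC c_ge0 rel_gen Z (hLb j)) => i; rewrite hb;
    case: eqP.
have off (i j : 'I_n) (Z : curve Y C) : is_L (tildeI beta n i) Z -> i != j ->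
  intersection (Lb j) Z = 0.
  move=> hZ ij; apply: (intersection_wall_eq0 charC rel_gen hZ (hLb j)).
  by rewrite hb (negbTE ij).
have diag (i : 'I_n) (Z : curve Y C) : is_L (tildeI beta n i) Z -> 0 < intersection
  (Lb i) Z.
  move=> hZ; apply: (intersection_wall_gt0 charC rel_gen hZ (hLb i)).
  by rewrite hb eqxx.
have rhoP := intersection_decomposition charC rel_gen hLb hb.
pose rho L := projT1 (cid (rhoP L)).
have hrho L (Z : curve Y C) : intersection L Z = \sum_j rho L j * intersection (Lb j) Z.
  exact: (projT2 (cid (rhoP L)) Z).
(* The basis of N_1 dual to the [Lb j]; the classes of the curves L_I are positive multiples of its
   members. *)
pose r (j : 'I_n) : V := fun L => (rho L j)%:~R.
have decomp (z : V) : N1 z -> forall L, z L = \sum_j z (Lb j) * r j L.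
  move=> [s ->] L; elim: s => [|p s IH].
    by rewrite cycle_classE big_nil big1 // => j _; rewrite cycle_classE big_nil mul0r.
  have cc L' : cycle_class (p :: s) L' = p.1 * (intersection L' p.2)%:~R +
    cycle_class s L'.
    by rewrite !cycle_classE big_cons.
  rewrite cc IH hrho rmorph_sum mulr_sumr -big_split; apply: eq_bigr => j _.
  by rewrite cc /r rmorphM /=; ring.
have mori_pos (z : V) j : mori z -> 0 <= z (Lb j) by apply: mori_ge0.
have N1_class (Z : curve Y C) : N1 (class_of R Z) by exists [:: (1, Z)].
have classE (i : 'I_n) (Z : curve Y C) : is_L (tildeI beta n i) Z ->
    forall L, class_of R Z L = (intersection (Lb i) Z)%:~R * r i L.
  move=> hZ L; rewrite (decomp _ (N1_class Z)) (bigD1 i) //= class_ofE big1 ?addr0 //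
    => j ji.
  by rewrite class_ofE (off i) ?mul0r // eq_sym.
have tpos (i : 'I_n) (Z : curve Y C) : is_L (tildeI beta n i) Z -> 0 < (intersection
  (Lb i) Z)%:~R :> R.
  by move=> hZ; rewrite ltr0z diag.
have ray_mori (s : R) (Z : curve Y C) : 0 <= s -> mori (s *: class_of R Z).
  move=> s0; have -> : s *: class_of R Z = cycle_class [:: (s, Z)].
    by apply/funext => L; rewrite cycle_classE big_seq1 -class_ofE.
  by apply: effective_mori; rewrite /= s0.
split=> [[[[Q0 QD QZ] Qsub Qext] [u [Qu u0] uQ]]|[i [Z [hZ ->]]]].
  have hu := Qsub _ Qu.
  (* A nonzero class has a nonzero coordinate. Then u is the sum of a positive multiple of the i-th
     curve and of an effective class, so extremality puts that curve into Q. *)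
  have [i ui] : exists i, u (Lb i) != 0.
    apply: contrapT => hn; move/negP: u0; apply; apply/eqP/funext => L.
    rewrite (decomp _ (proj1 hu)) big1 // => j _.
    by have [->|h] := eqVneq (u (Lb j)) 0; rewrite ?mul0r //; case: hn; exists j.
  have ui0 : 0 < u (Lb i) by rewrite lt_neqAle eq_sym ui mori_pos.
  pose Z := Zc i; have t0 := tpos i Z (hZc i); exists i, Z; split; first exact: hZc.
  set t : R := (intersection (Lb i) Z)%:~R in t0.
  pose z := class_of R Z; have zE L : z L = t * r i L by exact: classE.
  pose a := (u (Lb i) / t) *: z.
  pose s := [seq (u (Lb j) / (intersection (Lb j) (Zc j))%:~R, Zc j) | j <- enum 'I_n
    & j != i].
  have ua : u = a + cycle_class s.
    apply/funext => L; rewrite (decomp _ (proj1 hu)) (bigD1 i) //=.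
    have -> : (a + cycle_class s) L = a L + cycle_class s L by [].
    congr (_ + _).
      have -> : a L = (u (Lb i) / t) * z L by [].
      by rewrite zE mulrA divfK // gt_eqF.
    rewrite cycle_classE big_map big_filter big_enum_cond /=.
    rewrite [LHS]big_mkcond [RHS]big_mkcond; apply: eq_bigr => j _ /=;
      case: ifP => // _.
    by rewrite -class_ofE (classE j) // mulrA divfK // gt_eqF // tpos.
  have ha : mori a by apply: ray_mori; rewrite divr_ge0 ?ltW.
  have hs : mori (cycle_class s).
    apply: effective_mori; rewrite all_map; apply/allP => j _ /=.
    by rewrite divr_ge0 ?mori_pos // ltW // tpos.
  have [Qa _] : Q a /\ Q (cycle_class s) by apply: Qext => //; rewrite -ua.
  have Qz : Q z.
    have -> : z = (t / u (Lb i)) *: a.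
      by rewrite scalerA mulrA divfK ?mulfV ?scale1r // gt_eqF.
    by apply: QZ => //; rewrite divr_ge0 ?ltW.
  have zi : z (Lb i) = t by rewrite /z class_ofE.
  have [s0 zs] := uQ _ Qz.
  have s00 : s0 != 0.
    by apply/negP => /eqP e; move: t0; rewrite -zi zs e scale0r ltxx.
  apply/seteqP; split=> [v Qv|_ [x x0 <-]]; last exact: QZ.
  have [x vx] := uQ _ Qv.
  have vE : v = (x / s0) *: z by rewrite zs scalerA divfK.
  (* The sign of the factor is read off on [Lb i], which is nonnegative on the Mori cone and
     positive on z. *)
  exists (x / s0) => //=; have := mori_pos _ i (Qsub _ Qv); rewrite vE.
  have -> : ((x / s0) *: z) (Lb i) = (x / s0) * z (Lb i) by [].
  by rewrite zi pmulr_lge0.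
have t0 := tpos i Z hZ; set t : R := (intersection (Lb i) Z)%:~R in t0.
set z := class_of R Z; have zE L : z L = t * r i L by exact: classE.
have zi : z (Lb i) = t by rewrite /z class_ofE.
split; first split.
- split.
  + by exists 0; rewrite /= ?scale0r.
  + by move=> _ _ [x x0 <-] [y y0 <-]; exists (x + y); rewrite /= ?scalerDl ?addr_ge0.
  + by move=> x _ x0 [y y0 <-]; exists (x * y); rewrite /= ?scalerA ?mulr_ge0.
- by move=> _ [x x0 <-]; exact: ray_mori.
- move=> u v hu hv [x x0 xe].
  (* The j-th coordinates of u and v are nonnegative and add up to that of a multiple of z, which is
     0. *)
  have zero j : j != i -> u (Lb j) = 0 /\ v (Lb j) = 0.
    move=> ji; have := congr1 (fun f : V => f (Lb j)) xe.
    have -> : (x *: z) (Lb j) = x * z (Lb j) by [].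
    have -> : (u + v) (Lb j) = u (Lb j) + v (Lb j) by [].
    rewrite {1}/z class_ofE (off i) 1?eq_sym // mulr0 => e.
    by have := mori_pos _ j hu; have := mori_pos _ j hv; lra.
  have ray w : mori w -> (forall j, j != i -> w (Lb j) = 0) -> ray_through z w.
    move=> hw w0; exists (w (Lb i) / t); first by rewrite /= divr_ge0 ?mori_pos // ltW.
    apply/funext => L; rewrite [RHS](decomp _ (proj1 hw)) (bigD1 i) //= big1 => [|j ji].
      have -> : ((w (Lb i) / t) *: z) L = (w (Lb i) / t) * z L by [].
      by rewrite addr0 zE mulrA divfK // gt_eqF.
    by rewrite w0 // mul0r.
  by split; apply: ray => // j /zero[].
exists z; last by move=> _ [x _ <-]; exists x.
split; first by exists 1; rewrite /= ?scale1r.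
by apply/negP => /eqP/(congr1 (fun f : V => f (Lb i))); rewrite zi => e;
  rewrite e ltxx in t0.
Qed.

End Mori.

Theorem corollary7p9 (R : realType) (d : nat) (A : 'M[int]_d)
    (hA : generalized_Cartan A) (w : seq 'I_d) :
  let r := size w in
  let beta := word_pairing A w in
  let Y := toric_limit beta r in
  forall Q : set (line_bundle Y R[i] -> R),
    extremal_ray (mori_cone (F := Y) (C := R[i]) (R := R)) Q <->
    exists (i : 'I_r) (Z : curve Y R[i]),
      is_L (tildeI beta r i) Z /\ Q = ray_through (class_of R Z).
Proof.
move=> r beta Y Q.
apply: (@toric_limit_extremal_rays R R[i] beta r _ Q).
exact: pchar_num.
Qed.
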